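(* Let $Y=Y_{(n,q)}$ and let $\mathcal{X}\to S$ be Arndt's miniversal deformation of $Y$, with deformation parameters $s_i^{(l)}$ ($1<i<e$, $1\le l<a_i$) and $t_j$ ($2<j<e-1$). (1) Let $1<h<e$ and let $p,d$ be positive integers with $1\le dp\le \mathrm{length}(Q_\sigma(w^h))$. Then the deformation $\pi_{h,p}^d$ of $Y$ is induced from $\mathcal{X}\to S$ (i.e. is isomorphic to the pullback of $\mathcal X\to S$ along a morphism $\mathbb{A}^1_{\mathbb{C}}\to S$, where $\mathbb{A}^1_{\mathbb{C}}$ has coordinate $\lambda$) by setting $$s_h^{(pl)}=\binom{d}{l}\lambda^l\qquad\text{for }1\le l\le d,$$ and setting all other deformation parameters to $0$. (2) Let $2<h<e-1$ and $1\le d\le \#\left(Q_\sigma(w^h)\cap L^h\right)$. Then the deformation $\overline{\pi}_h^d$ of $Y$ is induced from $\mathcal{X}\to S$ by setting $$t_h=\lambda,\qquad s_h^{(l)}=\binom{d-1}{l}\lambda^l\quad\text{for }1\le l\le d-1,$$ and setting all other deformation parameters to $0$.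
   Context: Setting. $n,q$ are relatively prime integers with $n\ge 3$ and $0<q<n-1$; $Y=Y_{(n,q)}=\mathbb{C}^2/(\mathbb{Z}/n\mathbb{Z})$ with a generator acting by $\mathrm{diag}(\xi,\xi^q)$, $\xi$ a primitive $n$-th root of unity. Let $N=\mathbb{Z}^2+\mathbb{Z}\cdot\frac1n(1,q)$, $M$ the dual lattice (elements written $[a,b]$), $\sigma\subset N_{\mathbb{R}}$ the cone generated by $(1,0)$ and $(0,1)$; then $Y=\mathrm{Spec}\,\mathbb{C}[M\cap\sigma^\vee]$. Let $n/(n-q)=[a_2,\dots,a_{e-1}]=a_2-1/(a_3-1/(\cdots))$ be the unique continued fraction expansion with all $a_i\ge2$; $e$ is the embedding dimension of $Y$. The minimal generators (Hilbert basis) of $M\cap\sigma^\vee$ are $w^1=[n,0],w^2,\dots,w^e=[0,n]$, with $w^{i-1}+w^{i+1}=a_iw^i$ for $2\le i\le e-1$. Segments. For $2\le h\le e-1$, $H^h=\{v\in N_{\mathbb{R}}:\langle v,w^h\rangle=1\}$; choosing a point of $N\cap H^h$ as origin makes $H^h$ a one-dimensional vector space with lattice $L^h=N\cap H^h\cong\mathbb{Z}$. It is oriented so that the endpoint of $Q:=Q_\sigma(w^h):=H^h\cap\sigma$ at which $w^e$ vanishes is the left one and the endpoint at which $w^1$ vanishes is the right one. Write $Q=(\beta,\gamma)$, where $(\beta,\gamma)$ denotes the closed segment from $\beta$ to $\gamma$; lengths are measured with respect to $L^h\cong\mathbb{Z}$. Decompositions. For positive integers $p,d$ with $pd\le\mathrm{length}(Q)$,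 $D_{h,p}^d$ is the Minkowski decomposition $Q=Q_0+Q_1$ with $Q_0=(\beta,\gamma-pd)$, $Q_1=p\cdot(0,d)=(0,pd)$. For $2<h<e-1$, $p=1$ and $1\le d\le\#(Q\cap L^h)$, $\overline{D}_h^d$ is the decomposition $Q=Q_0+Q_1$ with $Q_0=(\beta,c)$, $Q_1=(0,\gamma-c)$, where $c=\lceil\beta+\#(Q\cap L^h)-d\rceil$. Deformations. Given such a decomposition $Q_0=(\beta_0,\gamma_0)$, $Q_1=(\beta_1,\gamma_1)$ (with its $p$), let $N'=L^h\times\mathbb{Z}^2$, $e_0,e_1$ the standard basis of $\mathbb{Z}^2$, $M'$ the dual of $N'$, $\sigma'\subset N'_{\mathbb{R}}$ the cone generated by $(\beta_0,e_0),(\gamma_0,e_0),(\beta_1/p,e_1),(\gamma_1/p,e_1)$, and $X=\mathrm{Spec}\,\mathbb{C}[M'\cap\sigma'^\vee]$. The linear map $\varphi:N\to N'$ with $\varphi(a)=(a,1,p)$ for $a\in L^h$ induces a closed embedding $Y\to X$, and $\lambda\mapsto x^{[0,0,1]}-x^{[0,p,0]}$ defines $\pi:X\to\mathbb{A}^1_{\mathbb{C}}=\mathrm{Spec}\,\mathbb{C}[\lambda]$, which is a deformation of $Y$ (Altmann). It is denoted $\pi_{h,p}^d$ if the decomposition is $D_{h,p}^d$, and $\overline{\pi}_h^d$ if it is $\overline{D}_h^d$. Arndt's versal family. Let $x_1,\dots,x_e$ be the coordinates on $\mathbb{A}^e\supset Y$ corresponding to $w^1,\dots,w^e$. Put $y_i=x_i+t_i$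 for $2<i<e-1$, $y_2=x_2$, $y_{e-1}=x_{e-1}$, $y_e=x_e$, and $Z_i=y_i\left(x_i^{a_i-1}+x_i^{a_i-2}s_i^{(1)}+\dots+s_i^{(a_i-1)}\right)$ for $1<i<e$. Arndt's family is a miniversal deformation $\mathcal{X}\to S$ of $Y$, where $S$ is a closed subscheme (through the origin) of the affine space with coordinates all $s_i^{(l)},t_j$, and $\mathcal{X}\subset\mathbb{A}^e\times S$ is the flat family determined by the $e-2$ equations $G_{i-1,i+1}:\ x_{i-1}y_{i+1}-Z_i=0$ for $1<i<e$: these equations hold on $\mathcal{X}$, and all remaining equations of $\mathcal{X}$ and the equations of $S$ are computed from them by Arndt's algorithm. *)

(* Defs.v *)
From HB Require Import structures.
From mathcomp Require Import all_boot all_order all_algebra.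
From mathcomp Require Import finmap.
From mathcomp Require Import classical_sets cardinality reals.
From mathcomp Require Import complex.

Set Implicit Arguments.
Unset Strict Implicit.
Unset Printing Implicit Defensive.

Import Order.TTheory GRing.Theory Num.Theory.
Local Open Scope ring_scope.

(* Affine schemes over a field k are represented by commutative k-algebras:   *)
(* a morphism Spec B -> Spec A is a k-algebra morphism A -> B, a closed       *)
(* subscheme of an affine space is an algebra with a chosen family of         *)
(* generators (the coordinate functions), and a fibre product is a pushout.   *)

Section Algebras.
Variable k : fieldType.

Definition alg_generated (B : comAlgType k) (G : B -> Prop) : Prop :=
  forall P : B -> Prop,
    (forall c : k, P c%:A) ->
    (forall b b', P b -> P b' -> P (b + b')) ->
    (forall b b', P b -> P b' -> P (b * b')) ->
    (forall g, G g -> P g) ->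
  forall b, P b.

(* B' is the coproduct of B and A' over A:    A --f--> B
                                              |g       |g'
                                              A' -f'-> B'                     *)
Definition pushout (A B A' B' : comAlgType k)
    (f : {lrmorphism A -> B}) (g : {lrmorphism A -> A'})
    (f' : {lrmorphism A' -> B'}) (g' : {lrmorphism B -> B'}) : Prop :=
  (forall a, g' (f a) = f' (g a)) /\
  forall (D : comAlgType k) (u : {lrmorphism B -> D}) (v : {lrmorphism A' -> D}),
    (forall a, u (f a) = v (g a)) ->
    exists2 h : {lrmorphism B' -> D},
        (forall b, h (g' b) = u b) /\ (forall a, h (f' a) = v a)
      & forall h' : {lrmorphism B' -> D},
          (forall b, h' (g' b) = u b) -> (forall a, h' (f' a) = v a) ->
          forall b, h' b = h b.

(* \sum_j m_j (x) b_j = 0 in the tensor product of M and B over A, expressed  *)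
(* by the universal property of the tensor product.                           *)
Definition tensor_zero (A B : comAlgType k) (f : {lrmorphism A -> B})
    (M : lmodType A) (r : nat) (m : 'I_r -> M) (b : 'I_r -> B) : Prop :=
  forall (P : zmodType) (beta : M -> B -> P),
    (forall x x' y, beta (x + x') y = beta x y + beta x' y) ->
    (forall x y y', beta x (y + y') = beta x y + beta x y') ->
    (forall (a : A) x y, beta (a *: x) y = beta x (f a * y)) ->
  \sum_(j < r) beta (m j) (b j) = 0.

Definition flat (A B : comAlgType k) (f : {lrmorphism A -> B}) : Prop :=
  forall (M N : lmodType A) (g : {linear M -> N}), injective g ->
  forall (r : nat) (m : 'I_r -> M) (b : 'I_r -> B),
    tensor_zero f (fun j => g (m j)) b -> tensor_zero f m b.

(* B is the monoid algebra k[P] of the submonoid P of the lattice L, with     *)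
(* chi m the element usually written x^m.                                     *)
Definition monoid_algebra (L : zmodType) (P : L -> Prop)
    (B : comAlgType k) (chi : L -> B) : Prop :=
  [/\ chi 0 = 1,
      forall m m', P m -> P m' -> chi (m + m') = chi m * chi m',
      forall b, exists (r : seq L) (c : L -> k),
        (forall m, m \in r -> P m) /\ b = \sum_(m <- r) c m *: chi m
    & forall (r : seq L) (c : L -> k), uniq r -> (forall m, m \in r -> P m) ->
        \sum_(m <- r) c m *: chi m = 0 -> forall m, m \in r -> c m = 0].

End Algebras.

(* in_alg B and horner_alg g as morphisms of k-algebras; the library makes    *)
(* them ring morphisms only, resp. linear for another scaling law.            *)
Section Evaluation.
Variables (k : fieldType) (B : comAlgType k).

Definition scalars (c : k^o) : B := c%:A.

Fact scalars_is_linear : linear scalars.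
Proof. by move=> c b b'; rewrite /scalars scalerDl scalerA. Qed.

Fact scalars_is_monoid_morphism : monoid_morphism scalars.
Proof.
by split=> [|b b']; rewrite /scalars ?scale1r // -scalerAl mul1r scalerA.
Qed.

HB.instance Definition _ :=
  GRing.isLinear.Build k k^o B *:%R scalars scalars_is_linear.
HB.instance Definition _ :=
  GRing.isMonoidMorphism.Build k^o B scalars scalars_is_monoid_morphism.

Variable g : B.

Definition poly_eval (f : {poly k}) : B := horner_alg g f.

Fact poly_eval_is_linear : linear poly_eval.
Proof.
move=> c f f'; rewrite /poly_eval rmorphD -mul_polyC rmorphM /= horner_algC.
by rewrite mulr_algl.
Qed.

Fact poly_eval_is_monoid_morphism : monoid_morphism poly_eval.
Proof. by split=> [|f f']; rewrite /poly_eval ?rmorph1 ?rmorphM. Qed.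

HB.instance Definition _ :=
  GRing.isLinear.Build k {poly k} B *:%R poly_eval poly_eval_is_linear.
HB.instance Definition _ :=
  GRing.isMonoidMorphism.Build {poly k} B poly_eval poly_eval_is_monoid_morphism.
End Evaluation.
Arguments scalars {k} B c.

Section Deformations.
Variables (k : fieldType) (OY : comAlgType k).

(* A family over Spec fbase with a rational base point and a morphism from    *)
(* Spec OY to its total space.                                                *)
Record pointed_family := Family {
  fbase : comAlgType k;
  fpoint : {lrmorphism fbase -> k^o};
  ftotal : comAlgType k;
  fstruct : {lrmorphism fbase -> ftotal};
  ffibre : {lrmorphism ftotal -> OY} }.

(* The family over A^1 = Spec k[lambda], with lambda the variable 'X, given   *)
(* by the function g on the total space.                                      *)
Definition line_family (B : comAlgType k) (g : B) (i : {lrmorphism B -> OY}) :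
    pointed_family :=
  @Family {poly k} (horner_eval (0 : k)) B (poly_eval g) i.

(* flat, and ffibre identifies Spec OY with the fibre over the base point     *)
Definition deformation (X : pointed_family) : Prop :=
  flat (fstruct X) /\
  pushout (fstruct X) (fpoint X) (scalars OY) (ffibre X).

(* (f, F) exhibits E as the pullback of D along the morphism of pointed       *)
(* schemes defined by f, compatibly with the identifications of the special   *)
(* fibres.                                                                    *)
Definition is_pullback (D E : pointed_family)
    (f : {lrmorphism fbase D -> fbase E})
    (F : {lrmorphism ftotal D -> ftotal E}) : Prop :=
  [/\ forall a, fpoint E (f a) = fpoint D a,
      forall b, ffibre E (F b) = ffibre D b
    & pushout (fstruct D) f (fstruct E) F].

Definition local_artinian (A : comAlgType k) (pt : {lrmorphism A -> k^o}) : Prop :=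
  (exists r : seq A, forall a, exists c : nat -> k,
      a = \sum_(j < size r) c j *: r`_j) /\
  (exists N : nat, forall r : seq A,
      size r = N -> (forall a, a \in r -> pt a = 0) -> \prod_(a <- r) a = 0).

Definition dual_numbers (A : comAlgType k) (pt : {lrmorphism A -> k^o}) : Prop :=
  exists2 eps : A, eps != 0 /\ eps * eps = 0
    & forall a, exists c : k, a = (pt a : k)%:A + c *: eps.

(* Smoothness of the morphism from (the completion of) the base at its point  *)
(* to the deformation functor of Spec OY on local Artinian k-algebras.        *)
Definition versal (X : pointed_family) : Prop :=
  forall (D D0 : pointed_family),
    deformation D -> deformation D0 ->
    local_artinian (fpoint D) -> local_artinian (fpoint D0) ->
  forall (theta : {lrmorphism fbase D -> fbase D0})
         (rho : {lrmorphism ftotal D -> ftotal D0}),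
    is_pullback theta rho -> (forall a0, exists a, theta a = a0) ->
  forall (u0 : {lrmorphism fbase X -> fbase D0})
         (F0 : {lrmorphism ftotal X -> ftotal D0}),
    is_pullback u0 F0 ->
  exists (u : {lrmorphism fbase X -> fbase D})
         (F : {lrmorphism ftotal X -> ftotal D}),
    [/\ is_pullback u F,
        forall a, theta (u a) = u0 a
      & forall b, rho (F b) = F0 b].

(* versal, with injective Kodaira-Spencer map *)
Definition miniversal (X : pointed_family) : Prop :=
  [/\ deformation X, versal X
    & forall D : pointed_family, deformation D -> dual_numbers (fpoint D) ->
      forall (u u' : {lrmorphism fbase X -> fbase D})
             (F F' : {lrmorphism ftotal X -> ftotal D}),
        is_pullback u F -> is_pullback u' F' -> forall a, u a = u' a].

End Deformations.

Section Toric.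
Variable R : realType.

Definition rowv (K : nzRingType) (r : nat) (s : seq K) : 'rV[K]_r :=
  \row_(i < r) s`_i.

Definition pairing (r : nat) (v : 'rV[R]_r) (m : 'rV[int]_r) : R :=
  \sum_i v 0 i * (m 0 i)%:~R.

Definition cone (r : nat) (s : seq 'rV[R]_r) (v : 'rV[R]_r) : Prop :=
  exists2 c : nat -> R, forall j, 0 <= c j
    & v = \sum_(j < size s) c j *: s`_j.

Definition dual_cone (r : nat) (C : 'rV[R]_r -> Prop) (m : 'rV[int]_r) : Prop :=
  forall v, C v -> 0 <= pairing v m.

Section CyclicQuotient.
Variables n q : nat.

(* N = Z^2 + Z (1/n) (1, q) *)
Definition lattN (v : 'rV[R]_2) : Prop :=
  exists a b c : int,
    v = rowv 2 [:: a%:~R; b%:~R] + c%:~R *: rowv 2 [:: n%:R^-1; q%:R / n%:R].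

(* Since N contains Z^2, its dual M consists of integral vectors.             *)
Definition lattM (m : 'rV[int]_2) : Prop :=
  forall v, lattN v -> pairing v m \is a Num.int.

Definition sigma : 'rV[R]_2 -> Prop := cone [:: rowv 2 [:: 1; 0]; rowv 2 [:: 0; 1]].

Definition monY (m : 'rV[int]_2) : Prop := lattM m /\ dual_cone sigma m.

Definition indecomposable (m : 'rV[int]_2) : Prop :=
  [/\ monY m, m <> 0
    & forall m1 m2, monY m1 -> monY m2 -> m = m1 + m2 -> m1 = 0 \/ m2 = 0].

(* [a_2, ..., a_{e-1}] = a_2 - 1 / (a_3 - 1 / ...) *)
Fixpoint hj_value (s : seq nat) : rat :=
  match s with
  | [::] => 0
  | [:: c] => c%:R
  | c :: s' => c%:R - (hj_value s')^-1
  end.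

(* The list a is (a_2, ..., a_{e-1}). *)
Definition hj_expansion (a : seq nat) : Prop :=
  all (fun c => 2 <= c)%N a /\ hj_value a = n%:R / (n%:R - q%:R).

Definition embdim (a : seq nat) : nat := (size a).+2.
Definition coefa (a : seq nat) (i : nat) : nat := nth 0%N a (i - 2).

Definition hilbert_basis (a : seq nat) (w : nat -> 'rV[int]_2) : Prop :=
  let e := embdim a in
  [/\ forall m, indecomposable m <-> exists2 i, (1 <= i <= e)%N & m = w i,
      w 1%N = rowv 2 [:: n%:Z; 0],
      w e = rowv 2 [:: 0; n%:Z]
    & forall i, (1 < i < e)%N -> w i.-1 + w i.+1 = w i *+ coefa a i].

(* The points of N on H = {v | <v, wh> = 1} are the o + j u, j in Z; this     *)
(* identifies H with R by x |-> o + x u, the segment Q = H /\ sigma becoming  *)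
(* [beta, gamma], where we vanishes at beta and w1 at gamma.                  *)
Definition segment_chart (w1 wh we : 'rV[int]_2) (o u : 'rV[R]_2)
    (beta gamma : R) : Prop :=
  [/\ forall v, (lattN v /\ pairing v wh = 1) <->
        exists j : int, v = o + j%:~R *: u,
      forall x : R, sigma (o + x *: u) <-> beta <= x <= gamma,
      pairing (o + beta *: u) we = 0
    & pairing (o + gamma *: u) w1 = 0].

End CyclicQuotient.

Definition num_lattice_points (beta gamma : R) : nat :=
  #|` fset_set [set j : int | beta <= j%:~R <= gamma]%classic |%fset.

(* A Minkowski decomposition ((beta_0, gamma_0), (beta_1, gamma_1)). *)
Definition decomposition : Type := ((R * R) * (R * R))%type.

Definition dec (p d : nat) (beta gamma : R) : decomposition :=
  ((beta, gamma - (p * d)%:R), (0, (p * d)%:R)).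

Definition dec_bar (d : nat) (beta gamma : R) : decomposition :=
  let c : R :=
    (Num.ceil (beta + (num_lattice_points beta gamma)%:R - d%:R))%:~R in
  ((beta, c), (0, gamma - c)).

(* N' = L^h x Z^2 is identified with Z^3 by means of the chart. *)
Definition sigma' (p : nat) (Q : decomposition) : 'rV[R]_3 -> Prop :=
  cone [:: rowv 3 [:: Q.1.1; 1; 0]; rowv 3 [:: Q.1.2; 1; 0];
           rowv 3 [:: Q.2.1 / p%:R; 0; 1]; rowv 3 [:: Q.2.2 / p%:R; 0; 1]].

(* m is the image of m' under M' -> M dual to phi : N -> N', where phi is     *)
(* the linear map with phi (o + j u) = (j, 1, p).                             *)
Definition dual_phi (o u : 'rV[R]_2) (p : nat)
    (m' : 'rV[int]_3) (m : 'rV[int]_2) : Prop :=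
  forall j : int,
    pairing (o + j%:~R *: u) m = pairing (rowv 3 [:: j%:~R; 1; p%:R]) m'.

(* OX = C[M' /\ sigma'^vee] with monomials chi', and i : OX -> OY is the      *)
(* surjection induced by phi.                                                 *)
Definition toric_embedding (o u : 'rV[R]_2) (p : nat) (Q : decomposition)
    (n q : nat) (OY : comAlgType R[i]) (chi : 'rV[int]_2 -> OY)
    (OX : comAlgType R[i]) (chi' : 'rV[int]_3 -> OX)
    (i : {lrmorphism OX -> OY}) : Prop :=
  monoid_algebra (dual_cone (sigma' p Q)) chi' /\
  forall m' m, dual_cone (sigma' p Q) m' -> lattM n q m ->
    dual_phi o u p m' m -> i (chi' m') = chi m.

Definition toric_family (p : nat) (OY OX : comAlgType R[i])
    (chi' : 'rV[int]_3 -> OX) (i : {lrmorphism OX -> OY}) : pointed_family OY :=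
  line_family (chi' (rowv 3 [:: 0; 0; 1]) - chi' (rowv 3 [:: 0; p%:Z; 0])) i.

End Toric.

Section Arndt.
Variable (R : realType).
Variables (n q : nat) (a : seq nat) (w : nat -> 'rV[int]_2).
Variables (OY : comAlgType R[i]) (chi : 'rV[int]_2 -> OY).

Let e := embdim a.

Definition s_index (j l : nat) : bool := (1 < j < e)%N && (1 <= l < coefa a j)%N.
Definition t_index (j : nat) : bool := (2 < j < e.-1)%N.

Section Equations.
Variables (X : pointed_family OY) (s : nat -> nat -> fbase X) (t : nat -> fbase X).
Variable (x : nat -> ftotal X).

Definition arndt_y (j : nat) : ftotal X :=
  if t_index j then x j + fstruct X (t j) else x j.

Definition arndt_Z (j : nat) : ftotal X :=
  arndt_y j * (x j ^+ (coefa a j).-1 +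
    \sum_(1 <= l < coefa a j) x j ^+ ((coefa a j).-1 - l) * fstruct X (s j l)).

Definition torus_char (z1 z2 : R[i]) (m : 'rV[int]_2) : R[i] :=
  z1 ^ (m 0 0) * z2 ^ (m 0 1).

(* The equations x_{j-1} y_{j+1} = Z_j are homogeneous for the M-grading with *)
(* deg x_j = deg t_j = w^j and deg s_j^(l) = l w^j, hence so is every         *)
(* equation computed from them: the torus acts on X -> S.                     *)
Definition torus_equivariant : Prop :=
  forall z1 z2 : R[i], z1 != 0 -> z2 != 0 ->
  exists (f : {lrmorphism fbase X -> fbase X})
         (F : {lrmorphism ftotal X -> ftotal X}),
    [/\ forall b, F (fstruct X b) = fstruct X (f b),
        forall j, (1 <= j <= e)%N -> F (x j) = torus_char z1 z2 (w j) *: x j,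
        forall j l, s_index j l ->
          f (s j l) = torus_char z1 z2 (w j) ^+ l *: s j l
      & forall j, t_index j -> f (t j) = torus_char z1 z2 (w j) *: t j].

(* S is a closed subscheme, through the origin, of the affine space with      *)
(* coordinates s, t, and X a closed subscheme of A^e x S whose fibre over the *)
(* origin is Y with its embedding by the w^j.  A miniversal X -> S contained  *)
(* in the locus of the e - 2 equations is determined by them formally at the  *)
(* origin, and then, by homogeneity, globally.                                *)
Definition arndt_family : Prop :=
  [/\ [/\ alg_generated (fun b : fbase X =>
            (exists j l, s_index j l /\ b = s j l) \/
            (exists2 j, t_index j & b = t j)),
          forall j l, s_index j l -> fpoint X (s j l) = 0
        & forall j, t_index j -> fpoint X (t j) = 0],
      alg_generated (fun b : ftotal X =>
            (exists2 j, (1 <= j <= e)%N & b = x j) \/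
            (exists b0, b = fstruct X b0)) /\
      (forall j, (1 <= j <= e)%N -> ffibre X (x j) = chi (w j)),
      miniversal X,
      forall j, (1 < j < e)%N -> x j.-1 * arndt_y j.+1 - arndt_Z j = 0
    & torus_equivariant].

End Equations.
End Arndt.

(* Main.v *)
Require Import Defs.
From HB Require Import structures.
From mathcomp Require Import all_boot all_order all_algebra.
From mathcomp Require Import finmap boolp classical_sets cardinality.
From mathcomp Require Import reals complex.
From mathcomp Require Import zify ring lra.

Set Implicit Arguments.
Unset Strict Implicit.
Unset Printing Implicit Defensive.

Import Order.TTheory GRing.Theory Num.Theory.
Local Open Scope ring_scope.

(** Why the induced family is the toric one.

    The total space Z of a toric family is a thickening of Y: the function
    lambda is a nonzerodivisor of O_Z, the fibre lambda = 0 is Y, and every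
    monomial of O_Y has a monomial lift.  Hence O_Z has lambda-adic coordinates
    along the monomials of O_Y, and its truncation modulo lambda^(n+1) is a
    deformation of Y over k[lambda]/(lambda^(n+1)).  Versality of X -> S
    classifies these truncations compatibly, but says nothing about the values
    taken by the parameters s and t.  These are found as follows.

    Suitable monomial lifts X_j of the generators x_j satisfy, with the
    announced values of s and t, the e - 2 equations x_(j-1) y_(j+1) = Z_j
    exactly (model_equation).  For j different from h this is the additivity of
    a linear lift of exponents.  There are two such lifts, lneg before h and
    lpos after h; they differ at w^h only in the second kind of family, and the
    difference lambda of the two lifts of x_h is what t_h = lambda records.
    For j = h the equation is, with U the lift of x_h and V = U^p + lambda, the
    binomial formula for U^(N - pD) (U^p + lambda)^D (binomial_fill).

    By induction on n, the versal lift modulo lambda^(n+2) differs from this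
    explicit solution by a multiple of lambda^(n+1), so that the difference
    solves the linearised equations over O_Y.  Comparing the coefficients of
    degree a_i w^i - l w^j in the equations i = j - 1, j, j + 1 shows that the
    variations of s and t vanish (linearised_params_eq0): no w^i - l w^j lies
    in the monoid except for i = j and l = 1, and e >= 4 makes at least one
    neighbouring equation available.  The variations of the x_j then extend to
    a derivation of O_Y (derivation_of_solution), and the corresponding
    automorphism of the truncated family moves the versal lift onto the
    explicit solution (formal_lift_step).

    This identifies the toric family with the pullback formally along lambda = 0.
    Globally everything is graded with positive weights, the grading being read
    off from the torus element (2, 2).  The grading of O_Z makes the
    intersection of the powers of lambda vanish, so the formal morphisms come
    from morphisms f and F, and inductions on the weight show that O_Z is the
    pushout of the family over S along f (ev_surjective, ev_kernel,
    line_pullback).  Altogether arndt_pullback reduces the theorem to the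
    exhibition of homogeneous solutions of the Arndt equations in a graded
    thickening of O_Y. *)

(** * Algebra morphisms and quotient algebras *)

Section Algebras.
Variable k : fieldType.
Implicit Types A B D : comAlgType k.

Lemma linear_of (V W : lmodType k) (f : V -> W) :
  linear f -> {F : {linear V -> W} | F =1 f}.
Proof.
move=> fl.
pose F : {linear V -> W} := HB.pack f (GRing.isLinear.Build k V W *:%R f fl).
by exists F.
Qed.

Lemma lrmorphism_of A B (f : A -> B) :
  linear f -> monoid_morphism f -> {F : {lrmorphism A -> B} | F =1 f}.
Proof.
move=> fl fm.
pose F : {lrmorphism A -> B} := HB.pack f (GRing.isLinear.Build k A B *:%R f fl)
  (GRing.isMonoidMorphism.Build A B f fm).
by exists F.
Qed.

Section Morphisms.
Variables (A B : comAlgType k) (f : {lrmorphism A -> B}).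

Lemma lrm0 : f 0 = 0. Proof. exact: rmorph0. Qed.
Lemma lrm1 : f 1 = 1. Proof. exact: rmorph1. Qed.
Lemma lrmD x y : f (x + y) = f x + f y. Proof. exact: rmorphD. Qed.
Lemma lrmB x y : f (x - y) = f x - f y. Proof. exact: rmorphB. Qed.
Lemma lrmN x : f (- x) = - f x. Proof. exact: rmorphN. Qed.
Lemma lrmM x y : f (x * y) = f x * f y. Proof. exact: rmorphM. Qed.
Lemma lrmX n x : f (x ^+ n) = f x ^+ n. Proof. exact: rmorphXn. Qed.
Lemma lrmZ c x : f (c *: x) = c *: f x. Proof. exact: linearZ. Qed.
Lemma lrmA (c : k) : f c%:A = c%:A. Proof. by rewrite lrmZ lrm1. Qed.
Lemma lrm_sum I (r : seq I) (P : pred I) (E : I -> A) :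
  f (\sum_(i <- r | P i) E i) = \sum_(i <- r | P i) f (E i).
Proof. exact: rmorph_sum. Qed.
End Morphisms.

End Algebras.

Section ScalarAlgebra.
Variables (k : fieldType) (Q : comNzRingType) (s : {rmorphism k -> Q}).

(** The morphism s is a phantom argument of the alias, so that the algebra
    structure it defines can be inferred. *)
Definition scalar_alg of {rmorphism k -> Q} : Type := Q.
Local Notation A := (scalar_alg s).

HB.instance Definition _ := GRing.ComNzRing.on A.

Let sc (c : k) (x : A) : A := s c * (x : Q).

Fact sc_comp c d v : sc c (sc d v) = sc (c * d) v.
Proof. by rewrite /sc rmorphM mulrA. Qed.
Fact sc_one : left_id 1 sc.
Proof. by move=> v; rewrite /sc rmorph1 mul1r. Qed.
Fact sc_addr : right_distributive sc +%R.
Proof. by move=> c v v'; rewrite /sc mulrDr. Qed.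
Fact sc_addl v : {morph sc^~ v : c d / c + d}.
Proof. by move=> c d; rewrite /sc rmorphD mulrDl. Qed.

HB.instance Definition _ :=
  GRing.Zmodule_isLmodule.Build k A sc_comp sc_one sc_addr sc_addl.

Fact sc_mul (c : k) (u v : A) : c *: (u * v) = c *: u * v.
Proof. exact: mulrA. Qed.

HB.instance Definition _ := GRing.Lmodule_isLalgebra.Build k A sc_mul.
HB.instance Definition _ := GRing.Lalgebra_isComAlgebra.Build k A.

Lemma scalar_algE (c : k) (x : A) : c *: x = (s c * (x : Q)).
Proof. by []. Qed.

End ScalarAlgebra.

Section Quotient.
Local Open Scope quotient_scope.
Variables (k : fieldType) (B : comAlgType k).

Definition is_proper_ideal (J : B -> Prop) : Prop :=
  [/\ J 0, ~ J 1, forall a b, J a -> J b -> J (a + b)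
    & forall a b, J b -> J (a * b)].

Lemma quotient_algebra (J : B -> Prop) : is_proper_ideal J ->
  exists (Q : comAlgType k) (pi : {lrmorphism B -> Q}),
    (forall y, exists x, pi x = y) /\ forall x, pi x = 0 <-> J x.
Proof.
move=> [J0 J1 JD JM].
pose S : B -> bool := fun b => `[< J b >].
have cS : idealr_closed (S : {pred B}).
  split; first exact/asboolP.
    by apply/negP => /asboolP.
  move=> a u v /asboolP Ju /asboolP Jv; apply/asboolP; apply: JD => //.
  exact: JM.
pose I : idealr B := HB.pack S (isIdealr.Build B S cS).
pose Q0 : comNzRingType := {ideal_quot I}.
pose p : B -> Q0 := \pi_(Quotient.quot I).
have pE x y : (p x = p y) <-> J (x - y).
  split; first by move/eqP; rewrite -Quotient.idealrBE => /asboolP.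
  by move=> /asboolP h; apply/eqP; rewrite -Quotient.idealrBE.
have pD : zmod_morphism p by move=> x y; rewrite /p rmorphB.
have pM : monoid_morphism p by split=> [|x y]; rewrite /p ?rmorph1 ?rmorphM.
pose pm : {rmorphism B -> Q0} :=
  HB.pack p (GRing.isZmodMorphism.Build _ _ p pD)
   (GRing.isMonoidMorphism.Build _ _ p pM).
pose s : {rmorphism k -> Q0} := pm \o in_alg B.
pose A := scalar_alg s.
pose pA : B -> A := p.
have lA : linear pA.
  move=> c x y; rewrite scalar_algE /pA.
  rewrite -[c *: x]mul1r -scalerAr scalerAl.
  by rewrite [LHS](rmorphD pm) [pm (_ * _)](rmorphM pm).
have [pi piE] := lrmorphism_of lA pM.
exists A, pi; split.
  move=> y; exists (repr (y : {ideal_quot I})); rewrite piE.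
  exact: reprK.
move=> x; rewrite piE -[x in J x]subr0 -pE.
have -> : p 0 = 0 := rmorph0 pm.
by [].
Qed.

Lemma factor_surjective (Q D : comAlgType k) (pi : {lrmorphism B -> Q})
    (h : {lrmorphism B -> D}) :
  (forall y, exists x, pi x = y) -> (forall x, pi x = 0 -> h x = 0) ->
  exists h' : {lrmorphism Q -> D}, forall x, h' (pi x) = h x.
Proof.
move=> pis pih.
have ex y : exists x, pi x = y by [].
pose r y := projT1 (cid (ex y)).
have rK y : pi (r y) = y by rewrite /r; case: cid.
have hE x : h (r (pi x)) = h x.
  apply/eqP; rewrite -subr_eq0 -lrmB; apply/eqP/pih.
  by rewrite lrmB rK subrr.
have lh : linear (fun y => h (r y)).
  by move=> c x y /=; rewrite -{1}[x]rK -{1}[y]rK -lrmZ -lrmD hE lrmD lrmZ.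
have mh : monoid_morphism (fun y => h (r y)).
  split=> [|x y] /=; first by rewrite -(lrm1 pi) hE lrm1.
  by rewrite -{1}[x]rK -{1}[y]rK -lrmM hE lrmM.
have [h' h'E] := lrmorphism_of lh mh.
by exists h' => x; rewrite h'E hE.
Qed.

End Quotient.

(** * Coordinates in a monoid algebra *)

Section MonoidAlgebra.
Variables (k : fieldType) (L : zmodType) (P : L -> Prop).
Variables (B : comAlgType k) (chi : L -> B).
Hypothesis hB : monoid_algebra P chi.

Lemma chi0 : chi 0 = 1. Proof. by case: hB. Qed.

Lemma chiD m m' : P m -> P m' -> chi (m + m') = chi m * chi m'.
Proof. by case: hB => _ h _ _; apply: h. Qed.

Lemma chi_free (r : seq L) (c : L -> k) : uniq r -> (forall m, m \in r -> P m) ->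
  \sum_(m <- r) c m *: chi m = 0 -> forall m, m \in r -> c m = 0.
Proof. by case: hB => _ _ _; apply. Qed.

Lemma chi_ind (Q : B -> Prop) :
  (forall m, P m -> Q (chi m)) -> Q 0 ->
  (forall b b', Q b -> Q b' -> Q (b + b')) ->
  (forall c b, Q b -> Q (c *: b)) -> forall b, Q b.
Proof.
move=> Qchi Q0 QD QZ b; case: hB => _ _ /(_ b)[r [c [rP ->]]] _.
rewrite big_seq; elim/big_ind: _ => // m /rP Pm; exact/QZ/Qchi.
Qed.

(** The coefficient function is 0 off the list, which makes it depend on b
    only. *)
Definition expansion (b : B) (rc : seq L * (L -> k)) : Prop :=
  [/\ uniq rc.1, forall m, m \in rc.1 -> P m,
      forall m, m \notin rc.1 -> rc.2 m = 0
    & b = \sum_(m <- rc.1) rc.2 m *: chi m].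

Lemma expansion_exists b : exists rc, expansion b rc.
Proof.
case: hB => _ _ /(_ b)[r [c [rP ->]]] _.
exists (undup r, fun m => c m *+ count_mem m r); split=> /=.
- exact: undup_uniq.
- by move=> m; rewrite mem_undup => /rP.
- by move=> m; rewrite mem_undup => /count_memPn ->.
rewrite -big_undup_iterop_count; apply: eq_bigr => m _.
by rewrite -scalerMnl.
Qed.

Lemma expansion_wide b rc (s : seq L) : expansion b rc -> uniq s ->
  {subset rc.1 <= s} -> forall (V : lmodType k) (v : L -> V),
  \sum_(m <- s) rc.2 m *: v m = \sum_(m <- rc.1) rc.2 m *: v m.
Proof.
case=> ur rP r0 _ us sub V v.
rewrite (bigID (mem rc.1)) /= [X in _ + X]big1 ?addr0; last first.
  by move=> m /r0 ->; rewrite scale0r.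
rewrite -big_filter; apply: perm_big; apply: uniq_perm => //.
  exact: filter_uniq.
by move=> m; rewrite mem_filter; case: (boolP (m \in rc.1)) => // /sub ->.
Qed.

Lemma expansion_unique b rc rc' : expansion b rc -> expansion b rc' ->
  rc.2 =1 rc'.2.
Proof.
move=> h h'; pose s := undup (rc.1 ++ rc'.1) => m.
have us : uniq s by exact: undup_uniq.
have sub : {subset rc.1 <= s} by move=> x hx; rewrite mem_undup mem_cat hx.
have sub' : {subset rc'.1 <= s}.
  by move=> x hx; rewrite mem_undup mem_cat hx orbT.
have sP x : x \in s -> P x.
  rewrite mem_undup mem_cat => /orP[].
    by case: h => _ + _ _; apply.
  by case: h' => _ + _ _; apply.
have [ms|] := boolP (m \in s); last first.
  rewrite mem_undup mem_cat negb_or => /andP[n1 n2].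
  have [_ _ z _] := h; have [_ _ z' _] := h'.
  by rewrite z // z'.
apply/eqP; rewrite -subr_eq0; apply/eqP.
apply: (chi_free (c := fun m => rc.2 m - rc'.2 m) us sP _ ms).
under eq_bigr do rewrite scalerBl.
rewrite sumrB (expansion_wide h us sub) (expansion_wide h' us sub').
by case: h => _ _ _ <-; case: h' => _ _ _ <-; rewrite subrr.
Qed.

Definition expand b := projT1 (cid (expansion_exists b)).
Definition csupp b := (expand b).1.
Definition ccoef m b := (expand b).2 m.

Lemma expandP b : expansion b (expand b).
Proof. by rewrite /expand; case: cid. Qed.

Lemma csupp_uniq b : uniq (csupp b). Proof. by case: (expandP b). Qed.
Lemma csuppP b m : m \in csupp b -> P m.
Proof. by case: (expandP b) => _ + _ _; apply. Qed.
Lemma ccoef_out b m : m \notin csupp b -> ccoef m b = 0.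
Proof. by case: (expandP b) => _ _ + _; apply. Qed.
Lemma ccoef_notP b m : ~ P m -> ccoef m b = 0.
Proof.
by move=> nP; apply: ccoef_out; apply/negP => /csuppP.
Qed.
Lemma csumE b : b = \sum_(m <- csupp b) ccoef m b *: chi m.
Proof. by case: (expandP b). Qed.

Lemma csum_wide b s (V : lmodType k) (v : L -> V) : uniq s ->
  {subset csupp b <= s} ->
  \sum_(m <- s) ccoef m b *: v m = \sum_(m <- csupp b) ccoef m b *: v m.
Proof. move=> us sub; exact: (expansion_wide (expandP b) us sub). Qed.

Lemma ccoefE b (s : seq L) (c : L -> k) : uniq s -> (forall m, m \in s -> P m) ->
  (forall m, m \notin s -> c m = 0) -> b = \sum_(m <- s) c m *: chi m ->
  forall m, ccoef m b = c m.
Proof.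
move=> us sP s0 bE m.
by apply: (expansion_unique (rc := expand b) (rc' := (s, c)));
  [exact: expandP | split].
Qed.

Lemma ccoefD m b b' : ccoef m (b + b') = ccoef m b + ccoef m b'.
Proof.
pose s := undup (csupp b ++ csupp b').
have us : uniq s by exact: undup_uniq.
have sub : {subset csupp b <= s} by move=> x hx; rewrite mem_undup mem_cat hx.
have sub' : {subset csupp b' <= s}.
  by move=> x hx; rewrite mem_undup mem_cat hx orbT.
apply: (ccoefE (s := s) (c := fun m => ccoef m b + ccoef m b')) => //.
- by move=> x; rewrite mem_undup mem_cat => /orP[] /csuppP.
- move=> x; rewrite mem_undup mem_cat negb_or => /andP[h h'].
  by rewrite !ccoef_out // addr0.
under eq_bigr do rewrite scalerDl.
by rewrite big_split /= !csum_wide // -!csumE.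
Qed.

Lemma ccoefZ m c b : ccoef m (c *: b) = c * ccoef m b.
Proof.
apply: (ccoefE (s := csupp b) (c := fun m => c * ccoef m b)).
- exact: csupp_uniq.
- by move=> x /csuppP.
- by move=> x hx; rewrite ccoef_out // mulr0.
under eq_bigr do rewrite -scalerA.
by rewrite -scaler_sumr -csumE.
Qed.

Lemma ccoef0 m : ccoef m 0 = 0.
Proof. by rewrite -(scale0r (0 : B)) ccoefZ mul0r. Qed.

Lemma ccoef_sum m I (r : seq I) (Q : pred I) (E : I -> B) :
  ccoef m (\sum_(j <- r | Q j) E j) = \sum_(j <- r | Q j) ccoef m (E j).
Proof. by apply: (big_morph (ccoef m)) => [x y|]; rewrite ?ccoefD ?ccoef0. Qed.

Lemma ccoef_chi m m' : P m' -> ccoef m (chi m') = (m == m')%:R.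
Proof.
move=> Pm'; apply: (ccoefE (s := [:: m']) (c := fun m => (m == m')%:R)) => //.
- by move=> x; rewrite inE => /eqP ->.
- by move=> x; rewrite inE => /negPf ->.
by rewrite big_seq1 eqxx scale1r.
Qed.

Lemma ccoef_eq b b' : (forall m, ccoef m b = ccoef m b') -> b = b'.
Proof.
move=> h; pose s := undup (csupp b ++ csupp b').
have us : uniq s by exact: undup_uniq.
have sub : {subset csupp b <= s} by move=> x hx; rewrite mem_undup mem_cat hx.
have sub' : {subset csupp b' <= s}.
  by move=> x hx; rewrite mem_undup mem_cat hx orbT.
rewrite (csumE b) (csumE b') -(csum_wide chi us sub) -(csum_wide chi us sub').
by apply: eq_bigr => m _; rewrite h.
Qed.

Hypothesis PD : forall m m', P m -> P m' -> P (m + m').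

(** The coefficient function may be read at any element of L; it vanishes off P
    by ccoef_notP, so that no membership of m - m' has to be assumed. *)
Lemma ccoef_chiM m m' b : P m' -> ccoef m (chi m' * b) = ccoef (m - m') b.
Proof.
move=> Pm'; elim/chi_ind: b => [x Px||b b' hb hb'|c b hb].
- by rewrite -chiD // !ccoef_chi ?subr_eq 1?[x + _]addrC //; apply: PD.
- by rewrite mulr0 !ccoef0.
- by rewrite mulrDr !ccoefD hb hb'.
- by rewrite -scalerAr !ccoefZ hb.
Qed.

Lemma chi_linear_ext (V : lmodType k) (psi : L -> V) :
  {F : {linear B -> V} | forall m, P m -> F (chi m) = psi m}.
Proof.
pose F b := \sum_(m <- csupp b) ccoef m b *: psi m.
have lF : linear F.
  move=> c b b'; rewrite /F.
  pose s := undup (csupp b ++ csupp b' ++ csupp (c *: b + b')).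
  have us : uniq s by exact: undup_uniq.
  have s1 : {subset csupp b <= s} by move=> x hx; rewrite mem_undup !mem_cat hx.
  have s2 : {subset csupp b' <= s}.
    by move=> x hx; rewrite mem_undup !mem_cat hx orbT.
  have s3 : {subset csupp (c *: b + b') <= s}.
    by move=> x hx; rewrite mem_undup !mem_cat hx !orbT.
  rewrite -(csum_wide _ us s1) -(csum_wide _ us s2) -(csum_wide _ us s3).
  rewrite scaler_sumr -big_split /=; apply: eq_bigr => m _.
  by rewrite ccoefD ccoefZ scalerDl scalerA.
have [G GE] := linear_of lF.
exists G => m Pm; rewrite GE /F -(csum_wide (s := undup (m :: csupp (chi m)))).
- under eq_bigr do rewrite ccoef_chi //.
  rewrite (bigD1_seq m) ?undup_uniq ?mem_undup ?mem_head //= eqxx scale1r.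
  by rewrite big1 ?addr0 // => x /negPf ->; rewrite scale0r.
- exact: undup_uniq.
- by move=> x hx; rewrite mem_undup inE hx orbT.
Qed.

Hypothesis P0 : P 0.

Lemma chi_lrmorphism_ext (D : comAlgType k) (psi : L -> D) :
  psi 0 = 1 ->
  (forall m m', P m -> P m' -> psi (m + m') = psi m * psi m') ->
  {F : {lrmorphism B -> D} | forall m, P m -> F (chi m) = psi m}.
Proof.
move=> psi0 psiD; have [F FE] := chi_linear_ext psi.
have mF : monoid_morphism F.
  split=> [|b b']; first by rewrite -[X in F X]chi0 FE.
  elim/chi_ind: b => [m Pm||b c hb hc|c b hb].
  - elim/chi_ind: b' => [m' Pm'||b c hb hc|c b hb].
    + by rewrite -chiD // !FE ?psiD //; apply: PD.
    + by rewrite mulr0 !raddf0 mulr0.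
    + by rewrite mulrDr !raddfD /= hb hc mulrDr.
    + by rewrite -scalerAr !linearZ /= hb -scalerAr.
  - by rewrite mul0r !raddf0 mul0r.
  - by rewrite mulrDl !raddfD /= hb hc mulrDl.
  - by rewrite -scalerAl !linearZ /= hb -scalerAl.
have [G GE] := lrmorphism_of (linearP F) mF.
by exists G => m Pm; rewrite GE FE.
Qed.

End MonoidAlgebra.

(** * Flatness from coordinates; truncations of a family over the line *)

Section Flatness.
Variables (k : fieldType) (A B : comAlgType k) (f : {lrmorphism A -> B}).

(** The hypotheses say that B behaves as a free A-module on the e m, with
    coordinate functions kap m.  If the image of a tensor under an injective g
    vanishes, so do its coordinates, which lie in N; hence the coordinates of
    the tensor itself vanish in M. *)
Lemma flat_of_coordinates (L : eqType) (e : L -> B) (kap : L -> B -> A) :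
  (forall m x y, kap m (x + y) = kap m x + kap m y) ->
  (forall m a y, kap m (f a * y) = a * kap m y) ->
  (forall b, exists r : seq L, [/\ uniq r, forall m, m \notin r -> kap m b = 0
      & b = \sum_(m <- r) f (kap m b) * e m]) ->
  flat f.
Proof.
move=> kD kM kE M N g ginj r m b H P beta bD1 bD2 bZ.
have b0 y : beta 0 y = 0.
  by have := bD1 0 0 y; rewrite addr0 -[LHS]addr0 => /addrI/esym.
have b0r z : beta z 0 = 0.
  by have := bD2 z 0 0; rewrite addr0 -[LHS]addr0 => /addrI/esym.
have bS1 I (s : seq I) E y :
    beta (\sum_(x <- s) E x) y = \sum_(x <- s) beta (E x) y.
  exact: (big_morph (beta ^~ y) (fun x z => bD1 x z y) (b0 y)).
have bS2 I (s : seq I) E z :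
    beta z (\sum_(x <- s) E x) = \sum_(x <- s) beta z (E x).
  exact: (big_morph (beta z) (fun x y => bD2 z x y) (b0r z)).
pose sj j := projT1 (cid (kE (b j))).
pose s := undup (flatten [seq sj j | j <- enum 'I_r]).
have bE j : b j = \sum_(x <- s) f (kap x (b j)) * e x.
  have [us s0 {1}->] : [/\ uniq (sj j),
      forall m, m \notin sj j -> kap m (b j) = 0
      & b j = \sum_(m <- sj j) f (kap m (b j)) * e m].
    by rewrite /sj; case: cid.
  rewrite [RHS](bigID (mem (sj j))) /= [X in _ = _ + X]big1 ?addr0; last first.
    by move=> x /s0 ->; rewrite lrm0 mul0r.
  rewrite -[RHS]big_filter; apply: perm_big; apply: uniq_perm => //.
    by rewrite filter_uniq ?undup_uniq.
  move=> x; rewrite mem_filter mem_undup.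
  case: (boolP (x \in sj j)) => //= hx; apply/esym/flattenP.
  by exists (sj j) => //; apply: map_f; rewrite mem_enum.
have mE x : \sum_(j < r) kap x (b j) *: m j = 0.
  apply: ginj; rewrite raddf0 raddf_sum /=.
  under eq_bigr do rewrite linearZ /=.
  (* the coordinate at x is a balanced map on N x B *)
  apply: (H N (fun n y => kap x y *: n)) => [n n' y|n y y'|a n y].
  - by rewrite scalerDr.
  - by rewrite kD scalerDl.
  - by rewrite kM scalerA mulrC.
transitivity (\sum_(j < r) \sum_(x <- s) beta (kap x (b j) *: m j) (e x)).
  apply: eq_bigr => j _; rewrite {1}bE bS2; apply: eq_bigr => x _.
  by rewrite bZ.
rewrite exchange_big /= big1 // => x _.
by rewrite -bS1 mE b0.
Qed.

End Flatness.

Section PolyEval.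
Variables (k : fieldType).

Lemma poly_evalX (B : comAlgType k) (g : B) : poly_eval g 'X = g.
Proof. exact: horner_algX. Qed.

Lemma poly_alg_ind (Q : {poly k} -> Prop) :
  Q 0 -> (forall c p, Q p -> Q ('X * p + c%:A)) -> forall p, Q p.
Proof.
move=> Q0 QX; elim/poly_ind => [|p c] // /(QX c).
by rewrite alg_polyC mulrC.
Qed.

Lemma lrm_poly_eval (B D : comAlgType k) (f : {lrmorphism B -> D}) g p :
  f (poly_eval g p) = poly_eval (f g) p.
Proof.
elim/poly_alg_ind: p => [|c p IH]; first by rewrite !lrm0.
by rewrite !lrmD !lrmM !lrmA /= !poly_evalX IH.
Qed.

Lemma poly_eval0 (B : comAlgType k) p : poly_eval (0 : B) p = p.[0]%:A.
Proof.
elim/poly_alg_ind: p => [|c p IH]; first by rewrite lrm0 horner0 scale0r.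
rewrite lrmD lrmM lrmA /= poly_evalX mul0r add0r.
by rewrite hornerD hornerM hornerX mul0r add0r alg_polyC hornerC.
Qed.

Lemma lr_line_ext (D : comAlgType k) (v v' : {lrmorphism {poly k} -> D}) :
  v 'X = v' 'X -> v =1 v'.
Proof.
move=> h p; elim/poly_alg_ind: p => [|c p IH]; first by rewrite !lrm0.
by rewrite !lrmD !lrmM !lrmA IH h.
Qed.

End PolyEval.

Section Thickening.
Variable k : fieldType.

(** A one-parameter family over the affine line with special fibre O, together
    with a linear splitting of the restriction to the fibre.  The parameter is
    a nonzerodivisor, as for a flat family. *)
Record thickening (O : comAlgType k) := Thickening {
  th_alg : comAlgType k;
  th_par : th_alg;
  th_fib : {lrmorphism th_alg -> O};
  th_sec : {linear O -> th_alg};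
  th_secK : forall y, th_fib (th_sec y) = y;
  th_fib_par : th_fib th_par = 0;
  th_ker : forall x, th_fib x = 0 -> exists c, x = th_par * c;
  th_reg : forall x, th_par * x = 0 -> x = 0 }.

Section Truncation.
Variables (O : comAlgType k) (T : thickening O).
Local Notation B := (th_alg T).
Local Notation g := (th_par T).

Lemma th_regX n x : g ^+ n * x = 0 -> x = 0.
Proof.
elim: n => [|n IH] in x *; first by rewrite mul1r.
by rewrite exprS -mulrA => /th_reg /IH.
Qed.

Lemma th_injX n x y : g ^+ n * x = g ^+ n * y -> x = y.
Proof.
move=> h; apply/eqP; rewrite -subr_eq0; apply/eqP/(th_regX (n := n)).
by rewrite mulrBr h subrr.
Qed.

Definition par_multiple n (x : B) : Prop := exists c, x = g ^+ n * c.

Lemma par_multiple_ideal n : is_proper_ideal (par_multiple n.+1).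
Proof.
split.
- by exists 0; rewrite mulr0.
- case=> c /(congr1 (th_fib T)); rewrite lrmM lrmX th_fib_par expr0n mul0r.
  by rewrite lrm1 => /eqP; rewrite oner_eq0.
- by move=> a b [c ->] [d ->]; exists (c + d); rewrite mulrDr.
- by move=> a b [c ->]; exists (a * c); rewrite mulrCA.
Qed.

(* trunc n is th_alg T modulo the (n+1)-st power of the parameter *)
Let trunc_ex n := cid (quotient_algebra (par_multiple_ideal n)).
Definition trunc n : comAlgType k := projT1 (trunc_ex n).
Let tpi_ex n := cid (projT2 (trunc_ex n)).
Definition tpi n : {lrmorphism B -> trunc n} := projT1 (tpi_ex n).

Lemma tpi_surj n y : exists x, tpi n x = y.
Proof. by case: (projT2 (tpi_ex n)) => + _; apply. Qed.

Lemma tpi_ker n x : tpi n x = 0 <-> par_multiple n.+1 x.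
Proof. by case: (projT2 (tpi_ex n)). Qed.

Lemma tpi_par n c : tpi n (g ^+ n.+1 * c) = 0.
Proof. by apply/tpi_ker; exists c. Qed.

Lemma tpi_eq n x y : tpi n x = tpi n y -> exists c, x = y + g ^+ n.+1 * c.
Proof.
move=> h; have /tpi_ker[c cE] : tpi n (x - y) = 0 by rewrite lrmB h subrr.
by exists c; rewrite -cE addrC subrK.
Qed.

Lemma tfib_ex n :
  exists h : {lrmorphism trunc n -> O}, forall x, h (tpi n x) = th_fib T x.
Proof.
apply: factor_surjective; first exact: tpi_surj.
move=> x /tpi_ker[c ->].
by rewrite lrmM lrmX th_fib_par expr0n mul0r.
Qed.
Definition tfib n := projT1 (cid (tfib_ex n)).
Lemma tfibE n x : tfib n (tpi n x) = th_fib T x.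
Proof. by rewrite /tfib; case: cid. Qed.

Lemma trans_ex n :
  exists h : {lrmorphism trunc n.+1 -> trunc n}, forall x, h (tpi n.+1 x) = tpi n x.
Proof.
apply: factor_surjective; first exact: tpi_surj.
by move=> x /tpi_ker[c ->]; rewrite exprSr -mulrA tpi_par.
Qed.
Definition trans n := projT1 (cid (trans_ex n)).
Lemma transE n x : trans n (tpi n.+1 x) = tpi n x.
Proof. by rewrite /trans; case: cid. Qed.

Lemma digit_ex z : exists z', z - th_sec T (th_fib T z) = g * z'.
Proof. by apply: th_ker; rewrite lrmB th_secK subrr. Qed.
(** The splitting determines lambda-adic digits: z is the section of its
    restriction to the fibre plus lambda times shift z. *)
Definition shift z := projT1 (cid (digit_ex z)).
Lemma shiftP z : z = th_sec T (th_fib T z) + g * shift z.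
Proof. by rewrite /shift; case: cid => z' /= <-; rewrite addrC subrK. Qed.

Lemma shift_unique z y z' : z = th_sec T y + g * z' -> shift z = z'.
Proof.
move=> h; have yE : th_fib T z = y.
  by rewrite h lrmD lrmM th_fib_par mul0r addr0 th_secK.
apply: (@th_injX 1); rewrite expr1; move: h.
by rewrite {1}(shiftP z) yE => /addrI.
Qed.

Lemma shift_linear : linear shift.
Proof.
move=> c x y.
apply: (@shift_unique _ (c *: th_fib T x + th_fib T y)).
rewrite linearP {1}(shiftP x) {1}(shiftP y) mulrDr scalerDr -scalerAr.
by rewrite addrACA.
Qed.

Lemma shift_par z : shift (g * z) = z.
Proof. by apply: (@shift_unique _ 0); rewrite raddf0 add0r. Qed.

Definition digit a z := th_fib T (iter a shift z).

Lemma digitD a x y : digit a (x + y) = digit a x + digit a y.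
Proof.
have sD u v : shift (u + v) = shift u + shift v.
  by have := shift_linear 1 u v; rewrite !scale1r.
rewrite /digit -lrmD; congr (th_fib T _).
by elim: a => //= a ->.
Qed.

Lemma shift0 : shift 0 = 0.
Proof. by rewrite -{1}(mulr0 g) shift_par. Qed.

Lemma digitZ a c x : digit a (c *: x) = c *: digit a x.
Proof.
have sZ u : shift (c *: u) = c *: shift u.
  by have := shift_linear c u 0; rewrite shift0 !addr0.
rewrite /digit -lrmZ; congr (th_fib T _).
by elim: a => //= a ->.
Qed.

Lemma digit_par a z : digit a.+1 (g * z) = digit a z.
Proof. by rewrite /digit iterSr shift_par. Qed.

Lemma digit0_par z : digit 0 (g * z) = 0.
Proof. by rewrite /digit /= lrmM th_fib_par mul0r. Qed.

Lemma digit_parX n a z : (a < n)%N -> digit a (g ^+ n * z) = 0.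
Proof.
elim: n a => // n IH [|a] h; rewrite exprS -mulrA ?digit0_par // digit_par.
exact: IH.
Qed.

Lemma digit_expansion N z :
  z = \sum_(a < N) g ^+ a * th_sec T (digit a z) + g ^+ N * iter N shift z.
Proof.
elim: N => [|N IH]; first by rewrite big_ord0 mul1r add0r.
rewrite {1}IH {1}(shiftP (iter N shift z)) big_ord_recr /= mulrDr addrA.
by rewrite mulrA -exprSr.
Qed.

End Truncation.

Lemma horner_eval0_C (c : k) : horner_eval (0 : k) c%:P = c.
Proof. by rewrite /horner_eval hornerC. Qed.

Lemma polyC_linear : linear (polyC : k^o -> {poly k}).
Proof. by move=> c x y; rewrite polyCD -mul_polyC polyCM. Qed.

HB.instance Definition _ :=
  GRing.isLinear.Build k k^o {poly k} *:%R (polyC : k^o -> {poly k}) polyC_linear.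

Lemma horner_eval0_ker (p : {poly k}) :
  horner_eval (0 : k) p = 0 -> exists c, p = 'X * c.
Proof.
rewrite /horner_eval => /eqP /factor_theorem [q ->].
by exists q; rewrite subr0 mulrC.
Qed.

Lemma polyX_reg (p : {poly k}) : 'X * p = 0 -> p = 0.
Proof. by move/eqP; rewrite mulf_eq0 polyX_eq0 => /eqP. Qed.

(** The line itself as a thickening of its origin: the bases and the total
    spaces of the truncated families are then instances of the same
    construction. *)
Definition line : thickening k^o :=
  @Thickening k^o {poly k} 'X (horner_eval (0 : k)) (polyC : k^o -> {poly k})
    horner_eval0_C (hornerX 0) horner_eval0_ker polyX_reg.

End Thickening.

(** * Truncated families as deformations *)

Section TruncatedFamilies.
Variables (k : fieldType) (O : comAlgType k) (T : thickening O).
Local Notation B := (th_alg T).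
Local Notation g := (th_par T).
Local Notation A n := (trunc (line k) n).
Local Notation pA n := (tpi (line k) n).
Local Notation pB n := (tpi T n).
Local Notation pt n := (tfib (line k) n).

Lemma lineE n (p : {poly k}) : pt n (pA n p) = p.[0].
Proof. exact: tfibE. Qed.

Lemma line_par n (c : {poly k}) : pA n ('X^(n.+1) * c) = 0.
Proof. exact: (@tpi_par _ _ (line k)). Qed.

Lemma line_ker n (p : {poly k}) : pA n p = 0 -> exists c, p = 'X^(n.+1) * c.
Proof. by move/tpi_ker. Qed.

Lemma line_surj n (y : A n) : exists p : {poly k}, pA n p = y.
Proof. exact: (@tpi_surj _ _ (line k) n y). Qed.

Lemma tstr_ex n : exists h : {lrmorphism A n -> trunc T n},
  forall p : {poly k}, h (pA n p) = pB n (poly_eval g p).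
Proof.
pose e : {lrmorphism {poly k} -> B} := poly_eval g.
pose h0 : {lrmorphism th_alg (line k) -> trunc T n} := pB n \o e.
have [|h hE] := @factor_surjective _ _ _ _ (pA n) h0 (@tpi_surj _ _ (line k) n).
  move=> p /line_ker[c ->]; rewrite /h0 /=.
  by rewrite (lrmM e) (lrmX e) /e /= poly_evalX tpi_par.
by exists h => p; rewrite hE.
Qed.
Definition tstr n := projT1 (cid (tstr_ex n)).
Lemma tstrE n (p : {poly k}) : tstr n (pA n p) = pB n (poly_eval g p).
Proof. by rewrite /tstr; case: cid. Qed.

Definition tfam n : pointed_family O := Family (pt n) (tstr n) (tfib T n).

Lemma tstr_point n a : tfib T n (tstr n a) = scalars O (pt n a).
Proof.
have [p <-] := line_surj a.
by rewrite tstrE tfibE lineE lrm_poly_eval th_fib_par poly_eval0.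
Qed.

(** The truncated family restricts to O over the origin since its restriction
    map is surjective with kernel generated by the parameter. *)
Lemma tfam_pushout n :
  pushout (tstr n) (pt n) (scalars O) (tfib T n).
Proof.
split; first exact: tstr_point.
move=> D u v uv.
pose up : {lrmorphism B -> D} := u \o pB n.
have [||h hE] := @factor_surjective _ _ _ _ (th_fib T) up.
- by move=> y; exists (th_sec T y); rewrite th_secK.
- move=> x /th_ker[c ->]; rewrite /up /= !lrmM.
  have -> : pB n g = tstr n (pA n 'X) by rewrite tstrE poly_evalX.
  by rewrite uv lineE hornerX lrm0 mul0r.
have hf b : h (tfib T n b) = u b.
  by have [x <-] := tpi_surj b; rewrite tfibE hE.
exists h.
  split=> // a; rewrite /scalars lrmA.
  have -> : a = a%:A :> k^o by rewrite /GRing.scale /= mulr1.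
  by rewrite lrmA /GRing.scale /= mulr1.
move=> h' h'b _ y; rewrite -(th_secK T y) -(tfibE n).
by rewrite h'b hf.
Qed.

(** For coef a coefficient function on O, the truncated power series in lambda
    whose coefficients are the coefficients of the lambda-adic digits of z. *)
Definition base_coord (coef : O -> k) n (z : B) : A n :=
  pA n (\sum_(a < n.+1) coef (digit a z) *: 'X^a : {poly k}).

Section Coordinates.
Variable coef : O -> k.
Hypothesis coefD : forall x y, coef (x + y) = coef x + coef y.
Hypothesis coefZ : forall c x, coef (c *: x) = c * coef x.

Let coef0 : coef 0 = 0.
Proof. by rewrite -(scale0r (0 : O)) coefZ mul0r. Qed.

Lemma base_coordD n x y :
  base_coord coef n (x + y) = base_coord coef n x + base_coord coef n y.
Proof.
rewrite /base_coord -lrmD -big_split /=; congr (pA n _).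
by apply: eq_bigr => a _; rewrite digitD coefD scalerDl.
Qed.

Lemma base_coordZ n c x : base_coord coef n (c *: x) = c *: base_coord coef n x.
Proof.
rewrite /base_coord -lrmZ scaler_sumr /=; congr (pA n _).
by apply: eq_bigr => a _; rewrite digitZ coefZ scalerA.
Qed.

Lemma base_coord_par n x : base_coord coef n (g * x) = pA n 'X * base_coord coef n x.
Proof.
rewrite /base_coord -lrmM /= big_ord_recl /= digit0_par coef0 scale0r add0r.
under eq_bigr => a _. rewrite digit_par. over.
rewrite big_ord_recr /= mulrDr lrmD.
rewrite -scalerAr -exprS -[_ *: 'X^(n.+1)]mulr_algr line_par addr0.
congr (pA n _); rewrite mulr_sumr; apply: eq_bigr => a _.
by rewrite -scalerAr -exprS.
Qed.

Lemma base_coord_ker n x : base_coord coef n (g ^+ n.+1 * x) = 0.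
Proof.
rewrite /base_coord big1 ?lrm0 // => a _.
by rewrite digit_parX ?coef0 ?scale0r.
Qed.

Lemma base_coord_poly n p x :
  base_coord coef n (poly_eval g p * x) = pA n p * base_coord coef n x.
Proof.
elim/poly_alg_ind: p => [|c p IH].
  by rewrite !lrm0 !mul0r -(scale0r (0 : B)) base_coordZ scale0r.
rewrite !lrmD !lrmM !lrmA /= poly_evalX !mulrDl base_coordD -mulrA.
by rewrite base_coord_par IH !mulr_algl base_coordZ mulrA.
Qed.

End Coordinates.

Section Flat.
Variables (L : zmodType) (P : L -> Prop) (chi : L -> O).
Hypothesis hO : monoid_algebra P chi.

(** The sections of the monomials of O form a basis of the truncated total
    space over the truncated line. *)
Lemma tfam_flat n : flat (tstr n).
Proof.
pose rp (b : trunc T n) := projT1 (cid (tpi_surj b)).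
have rpK b : pB n (rp b) = b by rewrite /rp; case: cid.
pose cf m := base_coord (ccoef hO m) n.
have cD m := base_coordD (ccoefD hO m) n.
have cE m x y : pB n x = pB n y -> cf m x = cf m y.
  move=> /tpi_eq[c ->]; rewrite /cf cD (base_coord_ker (ccoefZ hO m)).
  by rewrite addr0.
apply: (@flat_of_coordinates _ _ _ _ L (fun m => pB n (th_sec T (chi m)))
  (fun m b => cf m (rp b))).
- move=> m x y; rewrite -cD; apply: cE.
  by rewrite rpK lrmD !rpK.
- move=> m a y; have [p <-] := line_surj a.
  rewrite -(base_coord_poly (ccoefD hO m) (ccoefZ hO m)); apply: cE.
  by rewrite rpK lrmM rpK tstrE.
move=> b; pose z := rp b.
pose r := undup (flatten [seq csupp hO (digit a z) | a <- iota 0 n.+1]).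
have ur : uniq r by exact: undup_uniq.
have sr a : (a < n.+1)%N -> {subset csupp hO (digit a z) <= r}.
  move=> an x hx; rewrite mem_undup; apply/flattenP.
  exists (csupp hO (digit a z)) => //.
  by apply: (map_f (fun a => csupp hO (digit a z))); rewrite mem_iota.
exists r; split=> //.
  move=> m hm; rewrite /cf /base_coord big1 ?lrm0 // => a _.
  rewrite ccoef_out ?scale0r //; apply: contra hm; exact: sr.
rewrite -[LHS]rpK -/z {1}(digit_expansion n.+1 z) lrmD tpi_par addr0.
under [RHS]eq_bigr => m _.
  rewrite /cf /base_coord tstrE -lrmM (lrm_sum (poly_eval g)) mulr_suml.
  over.
rewrite /= -lrm_sum; congr (pB n _); rewrite [RHS]exchange_big /=.
apply: eq_bigr => a _.
rewrite {1}(csumE hO (digit a z)) -(csum_wide (hB := hO) chi ur (sr a _)) //.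
rewrite raddf_sum mulr_sumr; apply: eq_bigr => m _ /=.
rewrite linearZ /= -scalerAr (lrmZ (poly_eval g)) (lrmX (poly_eval g)) /=.
by rewrite poly_evalX scalerAl.
Qed.

Lemma tfam_deformation n : deformation (tfam n).
Proof. by split; [exact: tfam_flat | exact: tfam_pushout]. Qed.

End Flat.

Lemma tfam_artinian n : local_artinian (fpoint (tfam n)).
Proof.
split; rewrite /tfam /=.
  exists [seq pA n ('X^j : {poly k}) | j <- iota 0 n.+1] => a.
  have [p <-] := line_surj a.
  exists (fun j => p`_j).
  rewrite size_map size_iota.
  pose q : {poly k} := \sum_(j < n.+1) p`_j *: 'X^j.
  have -> : pA n p = pA n q.
    apply/eqP; rewrite -subr_eq0 -lrmB; apply/eqP/tpi_ker => /=.
    exists (drop_poly n.+1 p); rewrite -{1}(poly_take_drop n.+1 p).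
    have -> : take_poly n.+1 p = q by rewrite /take_poly poly_def.
    by rewrite addrC addKr mulrC.
  rewrite /q lrm_sum; apply: eq_bigr => j _.
  by rewrite lrmZ (nth_map 0%N) ?size_iota // nth_iota.
exists n.+1 => r.
have : forall r : seq (A n), (forall a, a \in r -> pt n a = 0) ->
    exists c : {poly k}, \prod_(a <- r) a = pA n ('X^(size r) * c).
  elim=> [_|a s IH h]; first by exists 1; rewrite big_nil mulr1 lrm1.
  have [|c cE] := IH; first by move=> b hb; apply: h; rewrite inE hb orbT.
  have [p pE] := line_surj a.
  have := h a (mem_head _ _); rewrite -pE lineE => /horner_eval0_ker[d dE].
  exists (d * c); rewrite big_cons cE dE -lrmM /= exprS.
  by rewrite mulrACA.
move=> H sr /H[c ->]; by rewrite sr line_par.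
Qed.

Lemma trans_pullback n :
  @is_pullback _ _ (tfam n.+1) (tfam n) (trans (line k) n) (trans T n).
Proof.
split=> [a|b|].
- by have [p <-] := line_surj a; rewrite /= transE !lineE.
- by have [p <-] := tpi_surj b; rewrite /= transE !tfibE.
split=> [a|D u v uv].
  by have [p <-] := line_surj a; rewrite /= transE !tstrE transE.
rewrite /= in u v uv *.
pose up : {lrmorphism B -> D} := u \o pB n.+1.
have [||h hE] := @factor_surjective _ _ _ _ (trans T n) u.
- by move=> y; have [x <-] := tpi_surj y; exists (pB n.+1 x); rewrite transE.
- move=> b; have [x <-] := tpi_surj b.
  rewrite transE => /tpi_ker[c ->]; rewrite lrmM lrmM.
  have -> : pB n.+1 (g ^+ n.+1) = tstr n.+1 (pA n.+1 'X^(n.+1)).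
    by rewrite tstrE (lrmX (poly_eval g)) /= poly_evalX.
  by rewrite uv transE -[X in pA n X]mulr1 line_par lrm0 mul0r.
have sT a : exists a', trans (line k) n a' = a.
  by have [p <-] := line_surj a; exists (pA n.+1 p); rewrite transE.
exists h.
  split=> // a; have [a' <-] := sT a; rewrite -uv -hE; congr (h _).
  by have [p <-] := line_surj a'; rewrite transE !tstrE transE.
move=> h' h'b _ y; have [x <-] := tpi_surj y.
by rewrite -transE h'b hE.
Qed.

End TruncatedFamilies.

(** * The linearised Arndt equations *)

Section HilbertChain.
Variables (k : fieldType) (L : zmodType) (P : L -> Prop).
Variables (e : nat) (aa : nat -> nat) (w : nat -> L).

(** The combinatorics of the generators on which the infinitesimal argument
    rests.  The separation hc_sep is the consequence of indecomposability that
    kills the parameters; the rational coordinates hc_coord on w 1, w 2 are used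
    to extend solutions to derivations. *)
Record hilbert_chain : Prop := HilbertChain {
  hc_P0 : P 0;
  hc_PD : forall m m', P m -> P m' -> P (m + m');
  hc_e : (4 <= e)%N;
  hc_P : forall i, (1 <= i <= e)%N -> P (w i);
  hc_aa : forall i, (1 < i < e)%N -> (2 <= aa i)%N;
  hc_rec : forall i, (1 < i < e)%N -> w i.-1 + w i.+1 = w i *+ aa i;
  hc_sep : forall i j l, (1 <= i <= e)%N -> (1 < j < e)%N -> (1 <= l)%N ->
    P (w i - w j *+ l) -> i = j /\ l = 1%N;
  hc_gen : forall Q : L -> Prop, Q 0 ->
    (forall i m, (1 <= i <= e)%N -> P m -> Q m -> Q (w i + m)) ->
    forall m, P m -> Q m;
  hc_coord : exists c1 c2 : L -> k,
    [/\ forall m m', c1 (m + m') = c1 m + c1 m',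
        forall m m', c2 (m + m') = c2 m + c2 m',
        c1 (w 1%N) = 1 /\ c2 (w 1%N) = 0
      & c1 (w 2%N) = 0 /\ c2 (w 2%N) = 1] }.

Hypothesis H : hilbert_chain.
Variables (O : comAlgType k) (chi : L -> O).
Hypothesis hO : monoid_algebra P chi.
Local Notation W i := (chi (w i)).
Local Notation PD := (hc_PD H).

Lemma hc_Pn i n : (1 <= i <= e)%N -> P (w i *+ n).
Proof.
move=> hi; elim: n => [|n IH]; first exact: hc_P0 H.
by rewrite mulrS; apply: PD => //; apply: hc_P.
Qed.

Lemma chiX i n : (1 <= i <= e)%N -> W i ^+ n = chi (w i *+ n).
Proof.
move=> hi; elim: n => [|n IH]; first by rewrite (chi0 hO).
by rewrite exprS IH mulrS (chiD hO) //; [apply: hc_P | apply: hc_Pn].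
Qed.

Lemma chain_multiple_inj j l l' : (1 < j < e)%N -> w j *+ l = w j *+ l' -> l = l'.
Proof.
move=> hj.
wlog le : l l' / (l <= l')%N.
  by move=> h eq; case/orP: (leq_total l l') => hl; [exact: h | exact/esym/h].
move=> eq.
have d0 : w j *+ (l' - l) = 0.
  have := mulrnBr (w j) le; by rewrite eq subrr.
have [||//||_] := @hc_sep H j j (l' - l).+1; first by lia.
  exact: hj.
  by rewrite mulrS d0 addr0 subrr; apply: hc_P0 H.
lia.
Qed.

Lemma chi_reg m b : P m -> chi m * b = 0 -> b = 0.
Proof.
move=> Pm h; apply: (ccoef_eq (hB := hO)) => m'.
rewrite ccoef0 -[m'](addrK m) -(ccoef_chiM hO PD) // h.
by rewrite ccoef0.
Qed.

Lemma chi_inj m b b' : P m -> chi m * b = chi m * b' -> b = b'.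
Proof.
move=> Pm h; apply/eqP; rewrite -subr_eq0; apply/eqP/(chi_reg Pm).
by rewrite mulrBr h subrr.
Qed.

Lemma W_rec i : (1 < i < e)%N -> W i.-1 * W i.+1 = W i ^+ aa i.
Proof.
move=> hi; rewrite -(chiD hO) ?(hc_rec H) ?chiX //; try (apply: hc_P => //); lia.
Qed.

Section Linearised.
Variables (xi : nat -> O) (sg : nat -> nat -> k) (ta : nat -> k).

(** The first-order part, at s = t = 0 and x_j = W j, of the equation
    x_(i-1) y_(i+1) = Z_i under the variations xi of x, sg of s, and ta of t. *)
Definition linearised i : Prop :=
  xi i.-1 * W i.+1 + W i.-1 * (xi i.+1 + (ta i.+1)%:A) =
  (xi i + (ta i)%:A) * W i ^+ (aa i).-1 +
  W i * (W i ^+ (aa i).-2 * xi i *+ (aa i).-1 +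
         \sum_(1 <= l < aa i) W i ^+ ((aa i).-1 - l) * (sg i l)%:A).

Hypothesis lin : forall i, (1 < i < e)%N -> linearised i.
Hypothesis ta_ends : forall j, ~~ (2 < j < e.-1)%N -> ta j = 0.

Let cf := ccoef hO.
(* the coefficient of degree w i - l w j in xi i *)
Let c i j l := cf (w i - w j *+ l) (xi i).

Lemma c_sep i j l : (1 <= i <= e)%N -> (1 < j < e)%N -> (1 <= l)%N ->
  ~ (i = j /\ l = 1%N) -> c i j l = 0.
Proof.
move=> hi hj hl h; apply: ccoef_notP => Pm; apply: h.
exact: (hc_sep H hi hj hl Pm).
Qed.

Lemma cf_chi m m' b : P m' -> cf m (chi m' * b) = cf (m - m') b.
Proof. exact: (ccoef_chiM hO PD). Qed.

Lemma cf1 m c0 : cf m (c0%:A) = c0 * (m == 0)%:R.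
Proof. by rewrite /cf ccoefZ -(chi0 hO) ccoef_chi //; apply: hc_P0 H. Qed.

(** The coefficient of degree a_i w^i - l w^j of the linearised equation i: since
    w^(i-1) + w^(i+1) = a_i w^i, each xi contributes its coefficient of degree
    w^_ - l w^j. *)
Lemma linearised_coef i j l : (1 < i < e)%N -> (1 < j < e)%N -> (1 <= l)%N ->
  c i.-1 j l + c i.+1 j l + ta i.+1 * (w i.+1 == w j *+ l)%:R =
  c i j l *+ aa i + ta i * (w i == w j *+ l)%:R +
  \sum_(1 <= l' < aa i) sg i l' * (w i *+ l' == w j *+ l)%:R.
Proof.
move=> hi hj hl.
have hi0 : (1 <= i <= e)%N by lia.
have him : (1 <= i.-1 <= e)%N by lia.
have hip : (1 <= i.+1 <= e)%N by lia.
have ha := hc_aa H hi.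
have Pi := hc_P H hi0; have Pm := hc_P H him; have Pp := hc_P H hip.
have r := hc_rec H hi.
pose m := w i *+ aa i - w j *+ l.
have mp : m - w i.+1 = w i.-1 - w j *+ l by rewrite /m -r addrAC addrK.
have mm : m - w i.-1 = w i.+1 - w j *+ l.
  by rewrite /m -r [w i.-1 + _]addrC addrAC addrK.
have mi n : (n <= aa i)%N -> m - w i *+ n = w i *+ (aa i - n) - w j *+ l.
  by move=> hn; rewrite /m mulrnBr // addrAC.
have := congr1 (cf m) (lin hi).
rewrite [xi i.-1 * _]mulrC mulrDr [(xi i + _) * _]mulrC [in RHS]mulrDr.
rewrite [in RHS]mulrDr mulr_sumr -mulrnAr mulrA -exprS.
rewrite /cf !ccoefD -!/cf !(cf_chi _ _ Pp, cf_chi _ _ Pm) !cf1 mp mm.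
have -> : (aa i).-2.+1 = (aa i).-1 by lia.
rewrite chiX // !cf_chi ?cf1; try exact: hc_Pn.
rewrite mi; last by lia.
have -> : (aa i - (aa i).-1 = 1)%N by lia.
rewrite mulr1n !subr_eq0 [cf _ (_ *+ _)](_ : _ = c i j l *+ (aa i).-1); last first.
  by rewrite -scaler_nat /cf ccoefZ mulr_natl.
rewrite ![_ + (_ + _)]addrA => ->; rewrite -!/(c _ _ _).
have -> : c i j l *+ aa i = c i j l + c i j l *+ (aa i).-1.
  by rewrite -mulrS; congr (_ *+ _); lia.
rewrite /cf ccoef_sum [X in _ + X](_ : _ =
    \sum_(1 <= l' < aa i) sg i l' * (w i *+ l' == w j *+ l)%:R); last first.
  apply: eq_big_nat => l' hl'.
  rewrite mulrA -exprS chiX // -/cf cf_chi; last exact: hc_Pn.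
  rewrite cf1 mi; last by lia.
  rewrite (_ : (aa i - _ = l')%N); last by lia.
  by rewrite subr_eq0.
by congr (_ + _); rewrite addrAC.
Qed.

Lemma w_eq i j l : (1 <= i <= e)%N -> (1 < j < e)%N -> (1 <= l)%N ->
  w i = w j *+ l -> i = j /\ l = 1%N.
Proof.
move=> hi hj hl h; apply: (hc_sep H) => //.
by rewrite h subrr; apply: hc_P0 H.
Qed.

Lemma w_eqF i j l : (1 <= i <= e)%N -> (1 < j < e)%N -> (1 <= l)%N -> i <> j ->
  (w i == w j *+ l) = false.
Proof. by move=> hi hj hl ij; apply/eqP => /(w_eq hi hj hl)[]. Qed.

Lemma sum_other i j : (1 < i < e)%N -> (1 < j < e)%N -> i <> j ->
  \sum_(1 <= l' < aa i) sg i l' * (w i *+ l' == w j *+ 1)%:R = 0.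
Proof.
move=> hi hj ij; apply: big1_seq => l'; rewrite mem_index_iota => hl'.
by rewrite eq_sym mulr1n w_eqF ?mulr0 //; lia.
Qed.

Lemma sum_same j l : (1 < j < e)%N -> (1 <= l < aa j)%N ->
  \sum_(1 <= l' < aa j) sg j l' * (w j *+ l' == w j *+ l)%:R = sg j l.
Proof.
move=> hj hl; rewrite (bigD1_seq l) ?iota_uniq ?mem_index_iota //= eqxx mulr1.
rewrite big1 ?addr0 // => l' /eqP nl.
by case: eqP => [/(chain_multiple_inj hj)|]; rewrite ?mulr0.
Qed.

(** In degree a_i w^i - l w^j the only coefficient of the xi that can survive is
    the one with i = j and l = 1.  The equations i = j - 1 and i = j + 1 give
    c + ta j = 0 and c = 0 for that coefficient c.  If j is 2 or e - 1, one of
    them is absent, but then ta j = 0 from the start, and e >= 4 leaves the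
    other.  The equation i = j then reads sg j l = 0. *)
Lemma linearised_params_eq0 j : (1 < j < e)%N ->
  ta j = 0 /\ forall l, (1 <= l < aa j)%N -> sg j l = 0.
Proof.
move=> hj; have e4 := hc_e H.
have cF i : (1 <= i <= e)%N -> i <> j -> c i j 1 = 0.
  by move=> hi ij; apply: c_sep => // -[].
have wjj : (w j == w j *+ 1) = true by rewrite mulr1n eqxx.
(* the equation i = j - 1 *)
have up : (2 < j)%N -> c j j 1 + ta j = 0.
  move=> j2; have hi : (1 < j.-1 < e)%N by lia.
  have ij : j.-1 <> j by lia.
  have := linearised_coef hi hj (leqnn 1); rewrite sum_other // prednK; last by lia.
  have hi1 : (1 <= j.-1 <= e)%N by lia.
  rewrite wjj mulr1 (w_eqF hi1 hj (leqnn 1) ij) mulr0 (cF j.-1) // (cF j.-1.-1);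
    try lia.
  by rewrite mul0rn !addr0 add0r.
(* the equation i = j + 1 *)
have dn : (j < e.-1)%N -> c j j 1 = 0.
  move=> j2; have hi : (1 < j.+1 < e)%N by lia.
  have ij : j.+1 <> j by lia.
  have := linearised_coef hi hj (leqnn 1); rewrite sum_other //=.
  have hi1 : (1 <= j.+1 <= e)%N by lia.
  have hi2 : (1 <= j.+2 <= e)%N by lia.
  have ij2 : j.+2 <> j by lia.
  rewrite (w_eqF hi1 hj (leqnn 1) ij) (w_eqF hi2 hj (leqnn 1) ij2).
  by rewrite !mulr0 (cF j.+1) // (cF j.+2) // mul0rn !addr0.
have [c0 t0] : c j j 1 = 0 /\ ta j = 0.
  have [t|nt] := boolP (2 < j < e.-1)%N.
    have c0 : c j j 1 = 0 by apply: dn; lia.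
    by split=> //; have := up; rewrite c0 add0r; apply; lia.
  have t0 := ta_ends nt; split=> //.
  have [j2|j2] := ltnP j e.-1; first exact: dn.
  by have := up; rewrite t0 addr0; apply; lia.
split=> // l hl.
have := @linearised_coef j j l hj hj; rewrite sum_same // t0 mul0r addr0.
have -> : c j j l = 0.
  have [->|l1] := eqVneq l 1%N; first exact: c0.
  by apply: c_sep => //; try lia; move=> [_ l1']; rewrite l1' in l1.
rewrite (@w_eqF j.+1) ?mulr0; try lia.
rewrite (@c_sep j.-1) ?(@c_sep j.+1); try lia.
by rewrite mul0rn !addr0 add0r => <- //; lia.
Qed.

End Linearised.

Section Derivation.
Variables (xi : nat -> O).
Hypothesis lin : forall i, (1 < i < e)%N ->
  xi i.-1 * W i.+1 + W i.-1 * xi i.+1 = (W i ^+ (aa i).-1 * xi i) *+ aa i.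

(** A derivation with value xi i on W i would be, up to the factor W 1 * W 2, of
    the form chi m |-> ell m * chi m with ell additive, hence determined by
    xi 1 and xi 2.  The linearised equations propagate W 1 W 2 xi i =
    ell (w i) W i from two consecutive indices to the next one, and this makes
    ell m * chi m divisible by W 1 * W 2 for each m generated by the w i. *)
Lemma derivation_of_solution : exists Th : {linear O -> O},
  (forall b b', Th (b * b') = Th b * b' + b * Th b') /\
  forall i, (1 <= i <= e)%N -> Th (W i) = xi i.
Proof.
have [c1 [c2 [c1D c2D [c11 c21] [c12 c22]]]] := hc_coord H.
have e4 := hc_e H.
have P1 : P (w 1%N) by apply: hc_P => //; lia.
have P2 : P (w 2%N) by apply: hc_P => //; lia.
pose V := chi (w 1%N + w 2%N).
have VE : V = W 1%N * W 2%N by rewrite /V (chiD hO).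
have Vreg : forall b b', V * b = V * b' -> b = b'.
  by move=> b b'; apply: chi_inj; apply: PD.
pose ell m := c1 m *: (xi 1%N * W 2%N) + c2 m *: (xi 2%N * W 1%N).
have ellD m m' : ell (m + m') = ell m + ell m'.
  by rewrite /ell c1D c2D !scalerDl addrACA.
have ell0 : ell 0 = 0.
  by have := ellD 0 0; rewrite addr0 -[LHS]addr0 => /addrI/esym.
have ellM m n : ell (m *+ n) = ell m *+ n.
  by elim: n => // n IH; rewrite !mulrS ellD IH.
have xiE i : (1 <= i <= e)%N -> V * xi i = ell (w i) * W i.
  elim/ltn_ind: i => -[|[|[|i]]] IH hi //.
  - by rewrite /ell c11 c21 scale1r scale0r addr0 VE mulrC -mulrA [W 2%N * _]mulrC.
  - by rewrite /ell c12 c22 scale1r scale0r add0r VE mulrC -mulrA.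
  have hi2 : (1 < i.+2 < e)%N by lia.
  have h1 := IH i.+1 ltac:(lia) ltac:(lia).
  have h2 := IH i.+2 ltac:(lia) ltac:(lia).
  have Pi : P (w i.+1) by apply: hc_P => //; lia.
  apply: (chi_inj Pi).
  have l0 := lin hi2; rewrite /= in l0.
  have wr := W_rec hi2; rewrite /= in wr.
  have er : ell (w i.+1) + ell (w i.+3) = ell (w i.+2) *+ aa i.+2.
    by rewrite -ellM -(hc_rec H hi2) ellD.
  have ap : (aa i.+2).-1.+1 = aa i.+2 by have := hc_aa H hi2; lia.
  have -> : ell (w i.+3) = ell (w i.+2) *+ aa i.+2 - ell (w i.+1).
    by rewrite -er addrC addKr.
  have -> : W i.+1 * (V * xi i.+3) =
      V * ((W i.+2 ^+ (aa i.+2).-1 * xi i.+2) *+ aa i.+2) - V * xi i.+1 * W i.+3.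
    rewrite -l0; ring.
  have -> : V * (W i.+2 ^+ (aa i.+2).-1 * xi i.+2 *+ aa i.+2) =
      ell (w i.+2) *+ aa i.+2 * (W i.+1 * W i.+3).
    rewrite wr -[in X in _ = _ * X]ap exprSr mulrnAr mulrCA h2 mulrnAl.
    by rewrite mulrCA.
  by rewrite h1; ring.
have thE m : P m -> exists th, V * th = ell m * chi m.
  elim/(hc_gen H): m / => [|i m hi Pm [th h]]; first by exists 0; rewrite ell0 mul0r mulr0.
  exists (xi i * chi m + W i * th).
  rewrite mulrDr mulrA xiE // mulrCA h ellD (chiD hO) //; last exact: hc_P.
  by ring.
have th m : {t | P m -> V * t = ell m * chi m}.
  by apply: cid; have [/thE[t ht]|] := pselect (P m); [exists t | exists 0].
have [Th ThE] := chi_linear_ext hO (fun m => projT1 (th m)).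
have ThV m : P m -> V * Th (chi m) = ell m * chi m.
  by move=> Pm; rewrite ThE //; case: (th m) => t /=; apply.
exists Th; split; last first.
  move=> i hi; apply: Vreg; rewrite xiE // ThV //; exact: hc_P.
elim/(chi_ind hO) => [m Pm||b c hb hc|c b hb] b'.
- elim/(chi_ind hO): b' => [m' Pm'||b c hb hc|c b hb].
  + apply: Vreg; rewrite -(chiD hO) // ThV; last exact: PD.
    rewrite mulrDr mulrA ThV // mulrCA ThV // ellD (chiD hO) //.
    by ring.
  + by rewrite mulr0 raddf0 !mulr0 addr0.
  + by rewrite mulrDr !raddfD /= hb hc !mulrDr; ring.
  + by rewrite -!scalerAr !linearZ /= hb -scalerAr scalerDr.
- by rewrite mul0r raddf0 !mul0r addr0.
- by rewrite mulrDl !raddfD /= hb hc !mulrDl; ring.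
- by rewrite -!scalerAl !linearZ /= hb -scalerAl scalerDr.
Qed.

End Derivation.
End HilbertChain.

(** * Lifting along the truncations *)

Section FirstOrder.
Variables (k : fieldType) (O : comAlgType k) (T : thickening O).
Local Notation B := (th_alg T).
Local Notation g := (th_par T).
Local Notation i := (th_fib T).
Variable N : nat.
Hypothesis N0 : (0 < N)%N.

(** f' agrees with f modulo the N-th power of the parameter, with d as the first
    digit of the difference. *)
Definition variation (f' f : B) (d : O) : Prop :=
  exists2 D, f' = f + g ^+ N * D & i D = d.

Lemma variation_refl f : variation f f 0.
Proof. by exists 0; rewrite ?mulr0 ?addr0 ?lrm0. Qed.

Lemma variationD f' f d h' h c :
  variation f' f d -> variation h' h c -> variation (f' + h') (f + h) (d + c).
Proof.
move=> [D -> <-] [C -> <-]; exists (D + C); last by rewrite lrmD.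
by rewrite mulrDr addrACA.
Qed.

Lemma variationM f' f d h' h c :
  variation f' f d -> variation h' h c ->
  variation (f' * h') (f * h) (d * i h + i f * c).
Proof.
move=> [D -> <-] [C -> <-]; exists (D * h + f * C + g ^+ N * (D * C)); first ring.
by rewrite !lrmD !lrmM lrmX th_fib_par expr0n (gtn_eqF N0) mul0r addr0.
Qed.

Lemma variationX f' f d n :
  variation f' f d -> variation (f' ^+ n) (f ^+ n) (i f ^+ n.-1 * d *+ n).
Proof.
move=> v; elim: n => [|n IH]; first exact: variation_refl.
have := variationM v IH; rewrite !exprS; congr variation.
case: n {IH} => [|n] /=; first by rewrite mulr0n mulr0 addr0 lrm1 mulrC.
by rewrite lrmX mulrnAr mulrA -exprS mulrC -mulrS.
Qed.

Lemma variation_sum (I : eqType) (r : seq I) (E' E : I -> B) (d : I -> O) :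
  (forall j, j \in r -> variation (E' j) (E j) (d j)) ->
  variation (\sum_(j <- r) E' j) (\sum_(j <- r) E j) (\sum_(j <- r) d j).
Proof.
elim: r => [|j r IH] h; first by rewrite !big_nil; apply: variation_refl.
rewrite !big_cons; apply: variationD; first exact: h (mem_head _ _).
by apply: IH => l hl; apply: h; rewrite inE hl orbT.
Qed.

Lemma variation_poly (p p' c : {poly k}) : p' = p + 'X^N * c ->
  variation (poly_eval g p') (poly_eval g p) (c.[0])%:A.
Proof.
move=> ->; exists (poly_eval g c); last first.
  by rewrite lrm_poly_eval th_fib_par poly_eval0.
rewrite (lrmD (poly_eval g)) (lrmM (poly_eval g)) (lrmX (poly_eval g)) /=.
by rewrite poly_evalX.
Qed.

(** Elements that agree one order further have the same variation. *)
Lemma variation_eq f' f d h' h c : variation f' f d -> variation h' h c ->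
  f = h -> (exists x, f' - h' = g ^+ N.+1 * x) -> d = c.
Proof.
move=> [D -> <-] [C -> <-] -> [x]; rewrite opprD addrACA subrr add0r -mulrBr.
rewrite exprSr -mulrA => /th_injX h1.
by apply/eqP; rewrite -subr_eq0 -lrmB h1 lrmM th_fib_par mul0r.
Qed.

End FirstOrder.

Section InfinitesimalAutomorphism.
Variables (k : fieldType) (O : comAlgType k) (T : thickening O) (n : nat).
Local Notation B := (th_alg T).
Local Notation g := (th_par T).
Local Notation Bn := (trunc T n.+1).
Local Notation pB := (tpi T n.+1).

(** The ideal generated by lambda^(n+1) in the truncation of order n + 1: it is
    a copy of O, on which the truncation acts through O. *)
Definition top_incl (y : O) : Bn := pB (g ^+ n.+1 * th_sec T y).

Lemma top_inclE z : top_incl (th_fib T z) = pB (g ^+ n.+1 * z).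
Proof.
rewrite /top_incl [in RHS](shiftP z) mulrDr lrmD mulrA -exprSr tpi_par.
by rewrite addr0.
Qed.

Lemma top_inclD y y' : top_incl (y + y') = top_incl y + top_incl y'.
Proof. by rewrite /top_incl raddfD /= mulrDr lrmD. Qed.

Lemma top_inclZ c y : top_incl (c *: y) = c *: top_incl y.
Proof. by rewrite /top_incl linearZ /= -scalerAr lrmZ. Qed.

Lemma top_inclM b y : top_incl (tfib T n.+1 b * y) = b * top_incl y.
Proof.
have [z <-] := tpi_surj b; rewrite tfibE -(th_secK T y) -lrmM !top_inclE.
by rewrite -lrmM mulrCA.
Qed.

Lemma top_incl_fib y : tfib T n.+1 (top_incl y) = 0.
Proof. by rewrite tfibE lrmM lrmX th_fib_par expr0n mul0r. Qed.

Lemma top_incl_sq y y' : top_incl y * top_incl y' = 0.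
Proof. by rewrite -top_inclM top_incl_fib mul0r -(scale0r 0) top_inclZ scale0r. Qed.

Variable Th : O -> O.
Hypothesis ThL : linear Th.
Hypothesis ThM : forall b b', Th (b * b') = Th b * b' + b * Th b'.

(** The copy of O has square zero, so a derivation of O yields an automorphism
    of the truncation that is the identity one order below. *)
Lemma infinitesimal_morphism :
  {Psi : {lrmorphism Bn -> Bn} | forall b, Psi b = b + top_incl (Th (tfib T n.+1 b))}.
Proof.
pose f b := b + top_incl (Th (tfib T n.+1 b)).
have Th1 : Th 1 = 0.
  by have := ThM 1 1; rewrite !mulr1 mul1r -[LHS]addr0 => /addrI/esym.
have fl : linear f.
  move=> c x y; rewrite /f lrmD lrmZ ThL top_inclD top_inclZ scalerDr.
  by rewrite addrACA.
have fm : monoid_morphism f.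
  split=> [|x y].
    by rewrite /f lrm1 Th1 -(scale0r 0) top_inclZ scale0r addr0.
  rewrite /f lrmM ThM top_inclD [Th _ * _]mulrC !top_inclM mulrDr !mulrDl.
  rewrite top_incl_sq addr0 -!addrA; congr (_ + _).
  by rewrite addrC [top_incl _ * y]mulrC addrC.
have [Psi PsiE] := lrmorphism_of fl fm.
by exists Psi.
Qed.

End InfinitesimalAutomorphism.

Section FormalLift.
Variables (R : realType) (a : seq nat) (w : nat -> 'rV[int]_2).
Local Notation k := R[i].
Local Notation e := (embdim a).
Local Notation aa := (coefa a).
Variables (P : 'rV[int]_2 -> Prop).
Hypothesis H : hilbert_chain k P e aa w.
Variables (OY : comAlgType k) (chi : 'rV[int]_2 -> OY).
Hypothesis hO : monoid_algebra P chi.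
Variables (X : pointed_family OY) (s : nat -> nat -> fbase X) (t : nat -> fbase X).
Variable (x : nat -> ftotal X).
Hypothesis hX : arndt_family a w chi s t x.

Variable T : thickening OY.
Local Notation g := (th_par T).
Local Notation pA n := (tpi (line k) n).
Local Notation pB n := (tpi T n).

Variables (Sv : nat -> nat -> {poly k}) (Tv : nat -> {poly k}).
Variable Xv : nat -> th_alg T.

(** The terms y_j and Z_j of the Arndt equations for the values Sv, Tv, Xv. *)
Definition model_y (j : nat) : th_alg T :=
  if t_index a j then Xv j + poly_eval g (Tv j) else Xv j.

Definition model_Z (j : nat) : th_alg T :=
  model_y j * (Xv j ^+ (aa j).-1 +
    \sum_(1 <= l < aa j) Xv j ^+ ((aa j).-1 - l) * poly_eval g (Sv j l)).

(** A solution of the Arndt equations over the line, with values in the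
    thickening, extending the coordinates of Y. *)
Record arndt_solution : Prop := ArndtSolution {
  sol_fib : forall j, (1 <= j <= e)%N -> th_fib T (Xv j) = chi (w j);
  sol_s0 : forall j l, s_index a j l -> (Sv j l).[0] = 0;
  sol_t0 : forall j, t_index a j -> (Tv j).[0] = 0;
  sol_eq : forall j, (1 < j < e)%N -> Xv j.-1 * model_y j.+1 = model_Z j }.

Hypothesis sol : arndt_solution.

(** The truncated family is the pullback of X, in such a way that the
    parameters and the coordinates take the prescribed values. *)
Definition formal_lift n (u : {lrmorphism fbase X -> trunc (line k) n})
    (F : {lrmorphism ftotal X -> trunc T n}) : Prop :=
  [/\ @is_pullback _ _ X (tfam T n) u F,
      forall j l, s_index a j l -> u (s j l) = pA n (Sv j l),
      forall j, t_index a j -> u (t j) = pA n (Tv j)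
    & forall j, (1 <= j <= e)%N -> F (x j) = pB n (Xv j)].

Lemma formal_lift0 : exists u F, @formal_lift 0 u F.
Proof.
have [Inv InvE] : exists Inv : {lrmorphism OY -> trunc T 0},
    forall z, Inv (th_fib T z) = pB 0 z.
  apply: factor_surjective; first by move=> y; exists (th_sec T y); rewrite th_secK.
  by move=> z /th_ker[c ->]; rewrite -[g]expr1 tpi_par.
have InvK b : Inv (tfib T 0 b) = b by have [z <-] := tpi_surj b; rewrite tfibE.
have tfK y : tfib T 0 (Inv y) = y by rewrite -(th_secK T y) InvE tfibE.
case: hX => -[_ s0 t0] [_ fx] [[_ [comm univ]] _ _] _ _.
pose u : {lrmorphism fbase X -> trunc (line k) 0} := scalars _ \o fpoint X.
pose F : {lrmorphism ftotal X -> trunc T 0} := Inv \o ffibre X.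
have uE b : u b = (fpoint X b : k)%:A by [].
have p0 p : p.[0] = 0 -> pA 0 p = 0.
  by move=> /horner_eval0_ker[c ->]; rewrite -['X]expr1 line_par.
have aE b : b = (tfib (line k) 0 b : k)%:A.
  have [p <-] := line_surj b; rewrite lineE.
  have -> : (p.[0])%:A = pA 0 ((p.[0])%:A : {poly k}) by rewrite lrmA.
  apply/eqP; rewrite -subr_eq0 -lrmB; apply/eqP/p0.
  by rewrite hornerD hornerN alg_polyC hornerC subrr.
exists u, F; split.
- split.
  + by move=> b; rewrite uE /= lrmA /GRing.scale /= mulr1.
  + by move=> b; rewrite /F /= tfK.
  split=> [b|D u1 v uv]; first by rewrite /F /= comm /scalars !lrmA.
  have [b|h [h1 h2] h3] := univ D u1 (scalars D).
    by rewrite uv uE lrmA.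
  pose h' : {lrmorphism trunc T 0 -> D} := h \o tfib T 0.
  exists h'.
    split=> [b|b]; first by rewrite /h' /F /= tfK h1.
    by rewrite /h' /= tstr_point /scalars lrmA {2}(aE b) lrmA.
  move=> h0 h0F _ b; pose h4 : {lrmorphism OY -> D} := h0 \o Inv.
  rewrite -{1}(InvK b); apply: (h3 h4) => [c|c]; first exact: h0F.
  by rewrite /scalars lrmA.
- by move=> j l hl; rewrite uE s0 // scale0r p0 //; apply: sol_s0.
- by move=> j hl; rewrite uE t0 // scale0r p0 //; apply: sol_t0.
- by move=> j hj; rewrite /F /= fx // -(sol_fib sol hj) InvE.
Qed.

(** Only the morphism of total spaces has to be corrected; the classifying
    morphism is kept. *)
Lemma pullback_automorphism n (u : {lrmorphism fbase X -> trunc (line k) n})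
    (F : {lrmorphism ftotal X -> trunc T n})
    (Psi Psi' : {lrmorphism trunc T n -> trunc T n}) :
  @is_pullback _ _ X (tfam T n) u F ->
  (forall b, Psi' (Psi b) = b) -> (forall b, Psi (Psi' b) = b) ->
  (forall c, Psi (tstr T n c) = tstr T n c) ->
  (forall b, tfib T n (Psi b) = tfib T n b) ->
  @is_pullback _ _ X (tfam T n) u (Psi \o F : {lrmorphism ftotal X -> trunc T n}).
Proof.
move=> [p1 p2 [p3 p4]] K K' hs hf; split=> //.
  by move=> b; rewrite /= hf p2.
split=> [b|D u1 v uv]; first by rewrite /= p3 hs.
have [h [h1 h2] h3] := p4 D u1 v uv.
pose h' : {lrmorphism trunc T n -> D} := h \o Psi'.
exists h'; first split=> b.
- by rewrite /h' /= K h1.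
- by rewrite /h' /= -{1}(hs b) K h2.
move=> h0 h01 h02 b; pose h4 : {lrmorphism trunc T n -> D} := h0 \o Psi.
rewrite -{1}(K' b); apply: (h3 h4) => c; rewrite /h4 /=; first exact: h01.
by rewrite hs h02.
Qed.

(** Versality lifts the classifying morphism by one order; the lift and the
    prescribed solution satisfy the same equations, so their difference is a
    solution of the linearised equations.  The parameters agree by
    linearised_params_eq0, and the coordinates agree after composition with the
    infinitesimal automorphism given by minus the derivation. *)
Lemma formal_lift_step n : (exists u F, @formal_lift n u F) ->
  exists u F, @formal_lift n.+1 u F.
Proof.
case: hX => -[_ s0 t0] [_ fx] [_ versalX _] eqX _.
move=> [u0 [F0 [pb0 us0 ut0 Fx0]]].
have trS (b : trunc (line k) n) : exists c, trans (line k) n c = b.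
  by have [p pE] := line_surj b; exists (pA n.+1 p); rewrite transE.
have [u [F [pb uu0 FF0]]] := versalX (tfam T n.+1) (tfam T n)
  (tfam_deformation T hO n.+1) (tfam_deformation T hO n)
  (tfam_artinian T n.+1) (tfam_artinian T n) _ _ (trans_pullback T n)
  trS u0 F0 pb0.
have Fs b : F (fstruct X b) = tstr T n.+1 (u b) by case: pb => _ _ [].
(* representatives of the values taken by s, t and x on the versal lift, with
   their differences from the prescribed ones divided by lambda^(n+1) *)
have /choice[ps psE] : forall jl : nat * nat, exists pc : {poly k} * {poly k},
    s_index a jl.1 jl.2 -> pA n.+1 pc.1 = u (s jl.1 jl.2) /\
      pc.1 = Sv jl.1 jl.2 + 'X^(n.+1) * pc.2.
  move=> [j l] /=; have [sjl|] := boolP (s_index a j l); last by exists (0, 0).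
  have [p pE] := line_surj (u (s j l)).
  have /(@tpi_eq _ _ (line k))[c cE] : pA n p = pA n (Sv j l).
    by rewrite -us0 // -uu0 /= -pE transE.
  by exists (p, c).
have /choice[qs qsE] : forall j, exists pc : {poly k} * {poly k}, t_index a j ->
    pA n.+1 pc.1 = u (t j) /\ pc.1 = Tv j + 'X^(n.+1) * pc.2.
  move=> j; have [tj|] := boolP (t_index a j); last by exists (0, 0).
  have [p pE] := line_surj (u (t j)).
  have /(@tpi_eq _ _ (line k))[c cE] : pA n p = pA n (Tv j).
    by rewrite -ut0 // -uu0 /= -pE transE.
  by exists (p, c).
have /choice[zs zsE] : forall j, exists zc : th_alg T * th_alg T,
    (1 <= j <= e)%N ->
    pB n.+1 zc.1 = F (x j) /\ zc.1 = Xv j + g ^+ n.+1 * zc.2.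
  move=> j; have [xj|] := boolP (1 <= j <= e)%N; last by exists (0, 0).
  have [z zE] := tpi_surj (F (x j)).
  have /tpi_eq[c cE] : pB n z = pB n (Xv j) by rewrite -Fx0 // -FF0 -zE /= transE.
  by exists (z, c).
pose sg j l : k := (ps (j, l)).2.[0].
pose ta j : k := if t_index a j then (qs j).2.[0] else 0.
pose xi j : OY := th_fib T (zs j).2.
pose y' j := if t_index a j then (zs j).1 + poly_eval g (qs j).1 else (zs j).1.
have vx j : (1 <= j <= e)%N -> variation n.+1 (zs j).1 (Xv j) (xi j).
  by move=> hj; have [_ ->] := zsE j hj; exists (zs j).2.
have vy j : (1 <= j <= e)%N ->
    variation n.+1 (y' j) (model_y j) (xi j + (ta j)%:A).
  move=> hj; rewrite /y' /model_y /ta; case: ifP => tj; last first.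
    by rewrite scale0r addr0; apply: vx.
  apply: variationD; first exact: vx.
  by apply: variation_poly; case: (qsE j tj).
have yE j : (1 <= j <= e)%N -> pB n.+1 (y' j) = F (arndt_y a t x j).
  move=> hj; have [zE _] := zsE j hj; rewrite /y' /arndt_y.
  case: ifP => // tj; have [qE _] := qsE j tj.
  by rewrite !lrmD zE Fs -qE tstrE.
have iy j : (1 <= j <= e)%N -> th_fib T (model_y j) = chi (w j).
  move=> hj; rewrite /model_y; case: ifP => tj; last exact: sol_fib.
  by rewrite lrmD lrm_poly_eval th_fib_par poly_eval0 sol_t0 // scale0r addr0
     sol_fib.
have lin j : (1 < j < e)%N -> linearised aa w chi xi sg ta j.
  move=> hj; have hj0 : (1 <= j <= e)%N by lia.
  have hjm : (1 <= j.-1 <= e)%N by lia.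
  have hjp : (1 <= j.+1 <= e)%N by lia.
  have v1 := variationM (ltn0Sn n) (vx _ hjm) (vy _ hjp).
  pose Z' := y' j * ((zs j).1 ^+ (aa j).-1 + \sum_(1 <= l < aa j)
     (zs j).1 ^+ ((aa j).-1 - l) * poly_eval g (ps (j, l)).1).
  have v2 : variation n.+1 Z' (model_Z j)
     ((xi j + (ta j)%:A) * chi (w j) ^+ (aa j).-1 +
      chi (w j) * (chi (w j) ^+ (aa j).-2 * xi j *+ (aa j).-1 +
         \sum_(1 <= l < aa j) chi (w j) ^+ ((aa j).-1 - l) * (sg j l)%:A)).
    have hs l : (1 <= l < aa j)%N -> s_index a j l by move=> hl; rewrite /s_index hj.
    have v3 : variation n.+1
        (\sum_(1 <= l < aa j) (zs j).1 ^+ ((aa j).-1 - l) * poly_eval g (ps (j, l)).1)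
        (\sum_(1 <= l < aa j) Xv j ^+ ((aa j).-1 - l) * poly_eval g (Sv j l))
        (\sum_(1 <= l < aa j) chi (w j) ^+ ((aa j).-1 - l) * (sg j l)%:A).
      apply: variation_sum => l; rewrite mem_index_iota => hl.
      have [_ pE] := psE (j, l) (hs l hl).
      have := variationM (ltn0Sn n) (variationX (ltn0Sn n) ((aa j).-1 - l) (vx _ hj0))
          (variation_poly T pE).
      rewrite lrm_poly_eval th_fib_par poly_eval0 sol_s0 ?hs // scale0r mulr0.
      by rewrite add0r lrmX sol_fib.
    have := variationM (ltn0Sn n) (vy _ hj0)
       (variationD (variationX (ltn0Sn n) (aa j).-1 (vx _ hj0)) v3).
    have s0v : th_fib T (\sum_(1 <= l < aa j)
        Xv j ^+ ((aa j).-1 - l) * poly_eval g (Sv j l)) = 0.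
      rewrite lrm_sum big1_seq // => l /andP[_].
      rewrite mem_index_iota => /hs hl.
      by rewrite lrmM lrm_poly_eval th_fib_par poly_eval0 sol_s0 // scale0r mulr0.
    by rewrite iy // lrmD s0v addr0 lrmX sol_fib.
  have := variation_eq v1 v2 (sol_eq sol hj); rewrite iy // sol_fib //; apply.
  apply/tpi_ker; rewrite lrmB /Z' !lrmM !yE //.
  have [-> _] := zsE _ hjm; have [zE _] := zsE _ hj0.
  have := eqX j hj => /(congr1 F); rewrite lrmB lrmM lrm0 => /eqP.
  rewrite subr_eq0 => /eqP ->; rewrite /arndt_Z lrmM -mulrBr.
  rewrite !lrmD !lrmX zE !lrm_sum (_ : _ - _ = 0) ?mulr0 //.
  apply/eqP; rewrite subr_eq0; apply/eqP; congr (_ + _).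
  apply: eq_big_nat => l hl; have [pE _] := psE (j, l) ltac:(rewrite /s_index hj; exact: hl).
  by rewrite !lrmM !lrmX zE Fs -pE tstrE.
have ta_out j : ~~ (2 < j < e.-1)%N -> ta j = 0 by rewrite /ta /t_index => /negPf ->.
have params := linearised_params_eq0 H hO lin ta_out.
have lin0 j : (1 < j < e)%N ->
    xi j.-1 * chi (w j.+1) + chi (w j.-1) * xi j.+1 =
    (chi (w j) ^+ (aa j).-1 * xi j) *+ aa j.
  move=> hj; have := lin j hj; rewrite /linearised.
  have ta0 i : ta i = 0.
    have [hi|/ta_out//] := boolP (2 < i < e.-1)%N.
    by have [] := params i ltac:(lia).
  have [_ sg0] := params j hj.
  rewrite !ta0 !scale0r !addr0 big1_seq ?addr0; last first.
    by move=> l; rewrite mem_index_iota => /sg0 ->; rewrite scale0r mulr0.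
  move=> ->; rewrite mulrnAr mulrA -exprS mulrC.
  have a2 := hc_aa H hj.
  have -> : (aa j).-2.+1 = (aa j).-1 by lia.
  by rewrite -mulrS; congr (_ *+ _); lia.
have [Th [ThM Thx]] := derivation_of_solution H hO lin0.
pose Th' y : OY := - Th y.
have lTh' : linear Th' by move=> c y z; rewrite /Th' linearP opprD scalerN.
have Th'M b b' : Th' (b * b') = Th' b * b' + b * Th' b'.
  by rewrite /Th' ThM opprD mulNr mulrN.
have Th1 : Th 1 = 0.
  by have := ThM 1 1; rewrite !mulr1 mul1r -[LHS]addr0 => /addrI/esym.
have [Psi PsiE] := infinitesimal_morphism T n lTh' Th'M.
have [Psi' Psi'E] := infinitesimal_morphism T n (linearP Th) ThM.
have fPsi b : tfib T n.+1 (Psi b) = tfib T n.+1 b.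
  by rewrite PsiE lrmD top_incl_fib addr0.
have fPsi' b : tfib T n.+1 (Psi' b) = tfib T n.+1 b.
  by rewrite Psi'E lrmD top_incl_fib addr0.
have t_inclN y : top_incl T n (- y) = - top_incl T n y.
  by rewrite -scaleN1r top_inclZ scaleN1r.
exists u, (Psi \o F : {lrmorphism ftotal X -> trunc T n.+1}); split.
- apply: (@pullback_automorphism n.+1 u F Psi Psi') => //.
  + by move=> b; rewrite Psi'E fPsi PsiE /Th' t_inclN subrK.
  + by move=> b; rewrite PsiE fPsi' Psi'E /Th' t_inclN addrK.
  move=> c; rewrite PsiE tstr_point /scalars.
  have -> : Th' ((tfib (line k) n.+1 c)%:A) = 0.
    by rewrite /Th' linearZ /= Th1 scaler0 oppr0.
  by rewrite -(scale0r 0) top_inclZ scale0r addr0.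
- move=> j l hl; have [hj hl'] := andP hl.
  have [pE1 pE2] := psE (j, l) hl.
  have [_ /(_ l hl')/horner_eval0_ker[c cE]] := params j hj.
  by rewrite -pE1 pE2 cE lrmD mulrA -exprSr line_par addr0.
- move=> j hj; have [pE1 pE2] := qsE j hj.
  have [] := params j; first by move: hj; rewrite /t_index; lia.
  rewrite /ta hj => /horner_eval0_ker[c cE] _.
  by rewrite -pE1 pE2 cE lrmD mulrA -exprSr line_par addr0.
move=> j hj; have [zE1 zE2] := zsE j hj.
rewrite /= -zE1 PsiE tfibE {1}zE2 lrmD -top_inclE -/(xi j) zE2 lrmD.
rewrite lrmM lrmX th_fib_par expr0n mul0r addr0 sol_fib // /Th' Thx //.
by rewrite t_inclN addrK.
Qed.

Lemma formal_lift_exists n : exists u F, @formal_lift n u F.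
Proof.
by elim: n => [|n]; [exact: formal_lift0 | exact: formal_lift_step].
Qed.

End FormalLift.

(** * Weights *)

Section Weights.
Variables (k : numFieldType).

(** A grading by natural numbers is encoded by the action of the scalar 2, that
    is of one element of a one-parameter group: as the powers of 2 are distinct,
    its eigenvalues determine the weights. *)
Definition weight_vector (V : lmodType k) (th : V -> V) (l : nat) (v : V) : Prop :=
  th v = 2%:R ^+ l *: v.

Definition weight_sum (V : lmodType k) (th : V -> V) (v : V) : Prop :=
  exists2 r : seq (nat * V),
    (forall p, p \in r -> weight_vector th p.1 p.2) & v = \sum_(p <- r) p.2.

Lemma two_pow_inj m n : (2%:R : k) ^+ m = 2%:R ^+ n -> m = n.
Proof. by rewrite -!natrX => /eqP; rewrite eqr_nat => /eqP/expnI; apply. Qed.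

Section OneSpace.
Variables (V : lmodType k) (th : {linear V -> V}).
Local Notation wv := (weight_vector th).

Lemma wv0 l : wv l 0.
Proof. by rewrite /weight_vector raddf0 scaler0. Qed.

Lemma wvD l v v' : wv l v -> wv l v' -> wv l (v + v').
Proof. by rewrite /weight_vector raddfD /= scalerDr => -> ->. Qed.

Lemma wvZ l c v : wv l v -> wv l (c *: v).
Proof. by rewrite /weight_vector linearZ /= => ->; rewrite !scalerA mulrC. Qed.

Lemma wv_sum l I (r : seq I) (Q : pred I) (E : I -> V) :
  (forall j, Q j -> wv l (E j)) -> wv l (\sum_(j <- r | Q j) E j).
Proof. move=> h; elim/big_ind: _ => //; [exact: wv0 | exact: wvD]. Qed.

(** Eigenvectors for distinct eigenvalues: apply th - 2^N, which kills the last
    one. *)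
Lemma weight_independence N (c : nat -> V) : (forall l, wv l (c l)) ->
  \sum_(l < N) c l = 0 -> forall l, (l < N)%N -> c l = 0.
Proof.
elim: N => [|N IH] in c *; first by [].
move=> cw s0.
have cN l : (l < N)%N -> c l = 0.
  pose d l := (2%:R ^+ l - 2%:R ^+ N) *: c l.
  have dw l' : wv l' (d l') by apply: wvZ.
  have /IH : \sum_(l' < N) d l' = 0.
    transitivity (th (\sum_(l' < N.+1) c l') - 2%:R ^+ N *: \sum_(l' < N.+1) c l').
      rewrite raddf_sum scaler_sumr /= -sumrB big_ord_recr /= cw subrr addr0.
      by apply: eq_bigr => l' _; rewrite cw -scalerBl.
    by rewrite s0 raddf0 scaler0 subrr.
  move=> /(_ dw l) h lN; have /eqP := h lN.
  rewrite scaler_eq0 => /orP[|/eqP //].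
  by rewrite subr_eq0 => /eqP/two_pow_inj lE; rewrite lE ltnn in lN.
move=> l; rewrite ltnS leq_eqVlt => /orP[/eqP ->|]; last exact: cN.
by move: s0; rewrite big_ord_recr /= big1 ?add0r // => j _; apply: cN.
Qed.

Lemma weight_group (r : seq (nat * V)) N : (forall p, p \in r -> p.1 < N)%N ->
  \sum_(p <- r) p.2 = \sum_(l < N) \sum_(p <- r | p.1 == l) p.2.
Proof.
move=> rN; rewrite (exchange_big_dep predT) //= big_seq [RHS]big_seq.
apply: eq_bigr => p /rN pN; rewrite (bigD1 (Ordinal pN)) //= big1 ?addr0 //.
by move=> l /andP[/eqP h /eqP[]]; apply: val_inj.
Qed.

Lemma bound_exists (r : seq (nat * V)) :
  exists N, forall p, p \in r -> (p.1 < N)%N.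
Proof.
elim: r => [|p r [N h]]; first by exists 0%N.
exists (maxn p.1.+1 N) => p'; rewrite inE => /orP[/eqP ->|/h pN]; rewrite leq_max.
  by rewrite leqnn.
by rewrite pN orbT.
Qed.

Lemma weight_components_unique (r r' : seq (nat * V)) :
  (forall p, p \in r -> wv p.1 p.2) -> (forall p, p \in r' -> wv p.1 p.2) ->
  \sum_(p <- r) p.2 = \sum_(p <- r') p.2 ->
  forall l, \sum_(p <- r | p.1 == l) p.2 = \sum_(p <- r' | p.1 == l) p.2.
Proof.
move=> rw rw' eq l.
have [N hN] := bound_exists r; have [N' hN'] := bound_exists r'.
pose M := (N + N' + l.+1)%N.
have h p : p \in r -> (p.1 < M)%N by move/hN; rewrite /M; lia.
have h' p : p \in r' -> (p.1 < M)%N by move/hN'; rewrite /M; lia.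
pose c l := \sum_(p <- r | p.1 == l) p.2 - \sum_(p <- r' | p.1 == l) p.2.
have cw l' : wv l' (c l').
  apply: wvD.
    rewrite big_seq_cond; apply: wv_sum => p /andP[pr /eqP <-]; exact: rw.
  rewrite -scaleN1r; apply: wvZ.
  rewrite big_seq_cond; apply: wv_sum => p /andP[pr /eqP <-]; exact: rw'.
have c0 : \sum_(l' < M) c l' = 0.
  by rewrite sumrB -weight_group // -weight_group // eq subrr.
have := weight_independence cw c0 (l := l) ltac:(rewrite /M; lia).
by move/eqP; rewrite subr_eq0 => /eqP.
Qed.

Hypothesis graded : forall v, weight_sum th v.

Let wdec v := cid2 (graded v).
(** The component of weight l, read off from some decomposition; by
    weight_components_unique the choice does not matter. *)
Definition wproj l v := \sum_(p <- projT1 (wdec v) | p.1 == l) p.2.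

Lemma wprojE v r l : (forall p, p \in r -> wv p.1 p.2) ->
  v = \sum_(p <- r) p.2 -> wproj l v = \sum_(p <- r | p.1 == l) p.2.
Proof.
move=> rw vE; rewrite /wproj; case: (wdec v) => r0 /= r0w r0E.
by apply: weight_components_unique => //; rewrite -vE.
Qed.

Lemma wproj_wv l v : wv l (wproj l v).
Proof.
rewrite /wproj; case: (wdec v) => r rw _ /=.
by rewrite big_seq_cond; apply: wv_sum => p /andP[pr /eqP <-]; apply: rw.
Qed.

Lemma wproj_id l v : wv l v -> wproj l v = v.
Proof.
move=> h; rewrite (@wprojE _ [:: (l, v)]) ?big_seq1 //.
  by rewrite big_cons big_nil /= eqxx addr0.
by move=> p; rewrite inE => /eqP ->.
Qed.

Lemma wproj_other l l' v : wv l v -> l' <> l -> wproj l' v = 0.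
Proof.
move=> h ll; rewrite (@wprojE _ [:: (l, v)]) ?big_seq1 //.
  by rewrite big_cons big_nil /=; case: eqP => // /esym.
by move=> p; rewrite inE => /eqP ->.
Qed.

Lemma wprojD l v v' : wproj l (v + v') = wproj l v + wproj l v'.
Proof.
have [r rw rE] := graded v; have [r' rw' rE'] := graded v'.
rewrite (wprojE l rw rE) (wprojE l rw' rE') (@wprojE _ (r ++ r')).
- by rewrite big_cat.
- by move=> p; rewrite mem_cat => /orP[/rw|/rw'].
- by rewrite big_cat rE rE'.
Qed.

Lemma wproj0 l : wproj l 0 = 0.
Proof. by have := wprojD l 0 0; rewrite addr0 -[LHS]addr0 => /addrI/esym. Qed.

Lemma wproj_bound v : exists N, forall M, (N <= M)%N ->
  v = \sum_(l < M) wproj l v.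
Proof.
have [r rw rE] := graded v; have [N h] := bound_exists r.
exists N => M NM; rewrite {1}rE (weight_group (N := M)); last first.
  by move=> p /h hp; apply: leq_trans hp NM.
by apply: eq_bigr => l _; rewrite (wprojE l rw rE).
Qed.

Lemma wproj_sum l I (r : seq I) (Q : pred I) (E : I -> V) :
  wproj l (\sum_(j <- r | Q j) E j) = \sum_(j <- r | Q j) wproj l (E j).
Proof. exact: (big_morph (wproj l) (wprojD l) (wproj0 l)). Qed.

Lemma wproj_eq0 v : (forall l, wproj l v = 0) -> v = 0.
Proof.
by move=> h; have [N /(_ N (leqnn N)) ->] := wproj_bound v; apply: big1.
Qed.

End OneSpace.

Lemma wproj_morph (V V' : lmodType k) (th : {linear V -> V})
    (th' : {linear V' -> V'}) (g : forall v, weight_sum th v)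
    (g' : forall v, weight_sum th' v) (phi : {linear V -> V'}) l :
  (forall v, phi (th v) = th' (phi v)) ->
  forall v, phi (wproj g l v) = wproj g' l (phi v).
Proof.
move=> com v; have [N /(_ (N + l.+1)%N (leq_addr _ _)) vE] := wproj_bound g v.
have pE : phi v = \sum_(l' < N + l.+1) phi (wproj g l' v).
  by rewrite {1}vE; apply: raddf_sum.
rewrite pE wproj_sum.
have lN : (l < N + l.+1)%N by lia.
rewrite (bigD1 (Ordinal lN)) //= big1 ?addr0.
  apply/esym/wproj_id.
  by rewrite /weight_vector -com (wproj_wv g l v) linearZ.
move=> l' /eqP ll; apply: (@wproj_other _ _ _ l').
  by rewrite /weight_vector -com (wproj_wv g l' v) linearZ.
by move=> h; apply: ll; apply: val_inj.
Qed.

Section Algebra.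
Variables (B : comAlgType k) (th : {lrmorphism B -> B}).
Local Notation wv := (weight_vector th).

Lemma wvM l l' b b' : wv l b -> wv l' b' -> wv (l + l')%N (b * b').
Proof.
rewrite /weight_vector lrmM => -> ->.
by rewrite -scalerAl -scalerAr scalerA exprD.
Qed.

Lemma wv1 c : wv 0 c%:A.
Proof. by rewrite /weight_vector lrmA scale1r. Qed.

Lemma wvX l n b : wv l b -> wv (l * n)%N (b ^+ n).
Proof.
move=> h; elim: n => [|n IH]; first by have := wv1 1; rewrite scale1r muln0.
by rewrite exprS mulnS; apply: wvM.
Qed.

Lemma weight_sum_wv l b : wv l b -> weight_sum th b.
Proof.
move=> h; exists [:: (l, b)]; rewrite ?big_seq1 // => p.
by rewrite inE => /eqP ->.
Qed.

Lemma weight_sumD b b' : weight_sum th b -> weight_sum th b' ->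
  weight_sum th (b + b').
Proof.
move=> [r rw ->] [r' rw' ->]; exists (r ++ r'); last by rewrite big_cat.
by move=> p; rewrite mem_cat => /orP[/rw|/rw'].
Qed.

Lemma weight_sumM b b' : weight_sum th b -> weight_sum th b' ->
  weight_sum th (b * b').
Proof.
move=> [r rw ->] [r' rw' ->].
exists [seq ((p.1 + p'.1)%N, p.2 * p'.2) | p <- r, p' <- r'].
  move=> p /allpairsP[[p1 p2] /= [/rw h1 /rw' h2 ->]] /=; exact: wvM.
rewrite big_allpairs_dep /= mulr_suml; apply: eq_bigr => p _.
by rewrite mulr_sumr.
Qed.

Hypothesis graded : forall b, weight_sum th b.

(** Components commute with multiplication by a homogeneous element; a
    multiple of y has no component of weight less than d, which is the reason
    for total_separated. *)
Lemma wproj_mul d y l b : wv d y ->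
  wproj graded l (y * b) = if (d <= l)%N then y * wproj graded (l - d)%N b else 0.
Proof.
move=> yd; have [N bE] := wproj_bound graded b.
have wl l' : wv (d + l')%N (y * wproj graded l' b).
  by apply: wvM => //; apply: wproj_wv.
rewrite {1}(bE _ (leq_addr l.+1 N)) mulr_sumr wproj_sum.
case: leqP => dl.
  have lN : (l - d < N + l.+1)%N by lia.
  rewrite (bigD1 (Ordinal lN)) //= big1 ?addr0.
    by apply: wproj_id; have := wl (l - d)%N; rewrite subnKC.
  move=> l' /eqP ll; apply: wproj_other (wl l') _ => h; apply: ll.
  by apply: val_inj => /=; lia.
by rewrite big1 // => l' _; apply: wproj_other (wl l') _; lia.
Qed.

End Algebra.
End Weights.

(** * From the formal to the global family *)

Section PolynomialEvaluation.
Variables (k : fieldType) (B D : comAlgType k) (u : {lrmorphism B -> D}) (y : D).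

(** B[T] -> D with T sent to y.  With B the total space over S and T sent to
    lambda, its kernel and its image decide whether D is the pullback of B to
    the line. *)
Definition ev (G : {poly B}) : D := (map_poly u G).[y].

Lemma ev0 : ev 0 = 0.
Proof. by rewrite /ev map_poly0 horner0. Qed.

Lemma evD G G' : ev (G + G') = ev G + ev G'.
Proof. by rewrite /ev rmorphD hornerD. Qed.

Lemma evM G G' : ev (G * G') = ev G * ev G'.
Proof. by rewrite /ev rmorphM hornerM. Qed.

Lemma evC b : ev b%:P = u b.
Proof. by rewrite /ev map_polyC hornerC. Qed.

Lemma evX : ev 'X = y.
Proof. by rewrite /ev map_polyX hornerX. Qed.

Lemma ev_sum I (r : seq I) (Q : pred I) (E : I -> {poly B}) :
  ev (\sum_(j <- r | Q j) E j) = \sum_(j <- r | Q j) ev (E j).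
Proof. exact: (big_morph ev evD ev0). Qed.

Lemma evXn n : ev 'X^n = y ^+ n.
Proof. by rewrite /ev map_polyXn hornerXn. Qed.

Lemma ev_split G : ev G = u G`_0 + y * ev (drop_poly 1 G).
Proof.
rewrite -{1}(poly_take_drop 1 G) evD evM evXn expr1 mulrC [drop_poly _ _]lock.
rewrite /take_poly poly_def big_ord1 expr0 -mul_polyC mulr1 evC.
by rewrite -lock mulrC.
Qed.

End PolynomialEvaluation.

Lemma line_separated (k : fieldType) (p p' : {poly k}) :
  (forall n, tpi (line k) n p = tpi (line k) n p') -> p = p'.
Proof.
move=> h; apply/eqP; rewrite -subr_eq0; set d := p - p'.
have /line_ker[c dE] : tpi (line k) (size d) d = 0 by rewrite lrmB h subrr.
apply: contraT => d0; have := leqnn (size d); rewrite {1}dE.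
have c0 : c != 0 by apply: contraNneq d0 => c0; rewrite dE c0 mulr0.
by rewrite size_monicM ?monicXn // size_polyXn; have := size_poly_gt0 c; lia.
Qed.

Section Globalisation.
Variables (R : realType) (a : seq nat) (w : nat -> 'rV[int]_2).
Local Notation k := R[i].
Local Notation e := (embdim a).
Local Notation aa := (coefa a).
Variables (P : 'rV[int]_2 -> Prop).
Hypothesis H : hilbert_chain k P e aa w.
Variables (OY : comAlgType k) (chi : 'rV[int]_2 -> OY).
Hypothesis hO : monoid_algebra P chi.
Variables (X : pointed_family OY) (s : nat -> nat -> fbase X) (t : nat -> fbase X).
Variable (x : nat -> ftotal X).
Hypothesis hX : arndt_family a w chi s t x.

Variable T : thickening OY.
Local Notation g := (th_par T).
Local Notation B := (th_alg T).
Variables (Sv : nat -> nat -> {poly k}) (Tv : nat -> {poly k}).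
Variable Xv : nat -> B.
Hypothesis sol : arndt_solution a w chi Sv Tv Xv.

Variables (wt : nat -> nat) (dg : nat) (th : {lrmorphism B -> B}).
Hypothesis dg_gt0 : (0 < dg)%N.
Hypothesis th_graded : forall z, weight_sum th z.
Hypothesis th_g : weight_vector th dg g.
Hypothesis th_X : forall j, (1 <= j <= e)%N -> weight_vector th (wt j) (Xv j).

(** The value of a parameter of weight l at the point lambda of the line, where
    lambda has weight dg.  The exponent is positive since the values vanish at
    the origin. *)
Definition homogeneous_value (l : nat) (p : {poly k}) : Prop :=
  exists c m, p = c *: 'X^(m.+1) /\ (c = 0 \/ (m.+1 * dg = l)%N).

Hypothesis S_hom : forall j l, s_index a j l -> homogeneous_value (wt j * l) (Sv j l).
Hypothesis T_hom : forall j, t_index a j -> homogeneous_value (wt j) (Tv j).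

Let base_gen (b : fbase X) : Prop :=
  (exists j l, s_index a j l /\ b = s j l) \/ (exists2 j, t_index a j & b = t j).

Let base_generated : alg_generated base_gen. Proof. by case: hX => [[? _ _] _ _ _ _]. Qed.

Let total_gen (b : ftotal X) : Prop :=
  (exists2 j, (1 <= j <= e)%N & b = x j) \/ (exists b0, b = fstruct X b0).

Let total_generated : alg_generated total_gen. Proof. by case: hX => _ [? _] _ _ _. Qed.

Lemma total_separated (z z' : B) :
  (forall n, tpi T n z = tpi T n z') -> z = z'.
Proof.
move=> h; apply/eqP; rewrite -subr_eq0; set d := z - z'; apply/eqP.
apply: (wproj_eq0 (graded := th_graded)) => l.
have /tpi_ker[c ->] : tpi T l d = 0 by rewrite lrmB h subrr.
rewrite (wproj_mul th_graded _ _ (wvX l.+1 th_g)) leqNgt.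
by have -> : (l < dg * l.+1)%N by nia.
Qed.

Local Notation lifts u F := (formal_lift a s t x Sv Tv Xv u F).

Let lift_n n := formal_lift_exists H hO hX sol n.

(** A polynomial in lambda is determined by its truncations, and each generator
    of the base has one inducing all its truncated values; so has every element
    of the base. *)
Lemma base_morphism_exists : exists f : {lrmorphism fbase X -> {poly k}},
  forall b n (u : {lrmorphism fbase X -> trunc (line k) n})
    (F : {lrmorphism ftotal X -> trunc T n}), lifts u F -> u b = tpi (line k) n (f b).
Proof.
pose good b p := forall n (u : {lrmorphism fbase X -> trunc (line k) n}) (F : {lrmorphism ftotal X -> trunc T n}),
  lifts u F -> u b = tpi (line k) n p.
have ex b : exists p, good b p.
  elim/base_generated: b => [c|b b' [p h] [p' h']|b b' [p h] [p' h']|b].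
  - by exists (c%:A) => n u F _; rewrite !lrmA.
  - by exists (p + p') => n u F hl; rewrite !lrmD (h _ _ _ hl) (h' _ _ _ hl).
  - by exists (p * p') => n u F hl; rewrite !lrmM (h _ _ _ hl) (h' _ _ _ hl).
  - case=> [[j [l [hj ->]]]|[j hj ->]].
      by exists (Sv j l) => n u F [_ + _ _]; apply.
    by exists (Tv j) => n u F [_ _ + _]; apply.
have uni b p p' : good b p -> good b p' -> p = p'.
  move=> h h'; apply: line_separated => n.
  by have [u [F hl]] := lift_n n; rewrite -(h _ _ _ hl) -(h' _ _ _ hl).
have /choice[f0 f0E] := ex.
have fl : linear f0.
  move=> c b b'; apply: uni (f0E _) _ => n u F hl.
  by rewrite !lrmD !lrmZ (f0E b _ _ _ hl) (f0E b' _ _ _ hl).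
have fm : monoid_morphism f0.
  split=> [|b b']; apply: uni (f0E _) _ => n u F hl; first by rewrite !lrm1.
  by rewrite !lrmM (f0E b _ _ _ hl) (f0E b' _ _ _ hl).
have [f fE] := lrmorphism_of fl fm.
by exists f => b n u F hl; rewrite fE; apply: f0E hl.
Qed.

Variable f : {lrmorphism fbase X -> {poly k}}.
Hypothesis fE : forall b n (u : {lrmorphism fbase X -> trunc (line k) n})
    (F : {lrmorphism ftotal X -> trunc T n}),
  lifts u F -> u b = tpi (line k) n (f b).

Lemma base_morphism_s j l : s_index a j l -> f (s j l) = Sv j l.
Proof.
move=> hj; apply: line_separated => n; have [u [F hl]] := lift_n n.
by rewrite -(fE _ hl); case: hl => _ + _ _; apply.
Qed.

Lemma base_morphism_t j : t_index a j -> f (t j) = Tv j.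
Proof.
move=> hj; apply: line_separated => n; have [u [F hl]] := lift_n n.
by rewrite -(fE _ hl); case: hl => _ _ + _; apply.
Qed.

(** As for the base, the thickening being separated thanks to its grading. *)
Lemma total_morphism_exists : exists F : {lrmorphism ftotal X -> B},
  [/\ forall b, F (fstruct X b) = poly_eval g (f b),
      forall j, (1 <= j <= e)%N -> F (x j) = Xv j
    & forall b n (u : {lrmorphism fbase X -> trunc (line k) n})
        (F' : {lrmorphism ftotal X -> trunc T n}), lifts u F' ->
        F' b = tpi T n (F b)].
Proof.
pose good b z := forall n (u : {lrmorphism fbase X -> trunc (line k) n}) (F : {lrmorphism ftotal X -> trunc T n}),
  lifts u F -> F b = tpi T n z.
have str b : good (fstruct X b) (poly_eval g (f b)).
  move=> n u F hl; have [[_ _ [comm _]] _ _ _] := hl.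
  by rewrite comm /= (fE _ hl) tstrE.
have gx j : (1 <= j <= e)%N -> good (x j) (Xv j).
  by move=> hj n u F [_ _ _]; apply.
have ex b : exists p, good b p.
  elim/total_generated: b => [c|b b' [p h] [p' h']|b b' [p h] [p' h']|b].
  - by exists (c%:A) => n u F _; rewrite !lrmA.
  - by exists (p + p') => n u F hl; rewrite !lrmD (h _ _ _ hl) (h' _ _ _ hl).
  - by exists (p * p') => n u F hl; rewrite !lrmM (h _ _ _ hl) (h' _ _ _ hl).
  - case=> [[j hj ->]|[b0 ->]]; first by exists (Xv j); apply: gx.
    by exists (poly_eval g (f b0)); apply: str.
have uni b p p' : good b p -> good b p' -> p = p'.
  move=> h h'; apply: total_separated => n.
  by have [u [F hl]] := lift_n n; rewrite -(h _ _ _ hl) -(h' _ _ _ hl).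
have /choice[f0 f0E] := ex.
have fl : linear f0.
  move=> c b b'; apply: uni (f0E _) _ => n u F hl.
  by rewrite !lrmD !lrmZ (f0E b _ _ _ hl) (f0E b' _ _ _ hl).
have fm : monoid_morphism f0.
  split=> [|b b']; apply: uni (f0E _) _ => n u F hl; first by rewrite !lrm1.
  by rewrite !lrmM (f0E b _ _ _ hl) (f0E b' _ _ _ hl).
have [F FE] := lrmorphism_of fl fm.
exists F; split=> [b|j hj|b n u F' hl]; rewrite FE.
- exact: uni (f0E _) (str b).
- exact: uni (f0E _) (gx j hj).
- exact: f0E hl.
Qed.

Variable F : {lrmorphism ftotal X -> B}.
Hypothesis F_str : forall b, F (fstruct X b) = poly_eval g (f b).
Hypothesis F_x : forall j, (1 <= j <= e)%N -> F (x j) = Xv j.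
Hypothesis F_lift : forall b n (u : {lrmorphism fbase X -> trunc (line k) n})
    (F' : {lrmorphism ftotal X -> trunc T n}),
  lifts u F' -> F' b = tpi T n (F b).

Lemma f_point b : (f b).[0] = fpoint X b.
Proof.
have [u [F' hl]] := lift_n 0; have [[p1 _ _] _ _ _] := hl.
by rewrite -p1 /= (fE _ hl) lineE.
Qed.

Lemma F_fibre b : th_fib T (F b) = ffibre X b.
Proof.
have [u [F' hl]] := lift_n 0; have [[_ p2 _] _ _ _] := hl.
by rewrite -p2 /= (F_lift _ hl) tfibE.
Qed.

Lemma ffibre_surjective y : exists b, ffibre X b = y.
Proof.
case: hX => _ [_ fx] _ _ _.
elim/(chi_ind hO): y => [m Pm||b b' [c <-] [c' <-]|c b [d <-]].
- elim/(hc_gen H): m / Pm => [|i m hi Pm [b bE]].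
    by exists 1; rewrite lrm1 (chi0 hO).
  exists (x i * b); by rewrite lrmM bE fx // (chiD hO) //; apply: (hc_P H).
- by exists 0; rewrite lrm0.
- by exists (c + c'); rewrite lrmD.
- by exists (c *: d); rewrite lrmZ.
Qed.

(** X has special fibre O_Y by the universal property of a pushout, tested
    against the quotient of the total space by the ideal of the parameters:
    it provides a morphism from O_Y to that quotient, so an element vanishing
    in O_Y lies in the ideal. *)
Lemma ffibre_kernel b : ffibre X b = 0 ->
  exists2 r : seq (fbase X * ftotal X), (forall p, p \in r -> base_gen p.1) &
    b = \sum_(p <- r) fstruct X p.1 * p.2.
Proof.
case: hX => -[_ s0 t0] _ [[_ [comm univ]] _ _] _ _.
pose J b := exists2 r : seq (fbase X * ftotal X),
  (forall p, p \in r -> base_gen p.1) & b = \sum_(p <- r) fstruct X p.1 * p.2.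
have g0 c : base_gen c -> fpoint X c = 0.
  by case=> [[j [l [hj ->]]]|[j hj ->]]; [apply: s0 | apply: t0].
have J0 : J 0 by exists [::]; rewrite ?big_nil.
have JD c c' : J c -> J c' -> J (c + c').
  move=> [r rg ->] [r' rg' ->]; exists (r ++ r'); last by rewrite big_cat.
  by move=> p; rewrite mem_cat => /orP[/rg|/rg'].
have JM c c' : J c' -> J (c * c').
  move=> [r rg ->]; exists [seq (p.1, c * p.2) | p <- r].
    by move=> p /mapP[p' /rg hp ->].
  by rewrite big_map mulr_sumr; apply: eq_bigr => p _; rewrite mulrCA.
have Jpr : is_proper_ideal J.
  split=> // -[r rg] /(congr1 (ffibre X)).
  rewrite lrm1 lrm_sum big1_seq; first by move/eqP; rewrite oner_eq0.
  move=> p /andP[_ /rg/g0 pg].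
  by rewrite lrmM comm pg lrm0 mul0r.
have [Q [pi [_ kpi]]] := quotient_algebra Jpr.
have strJ c : J (fstruct X c - (fpoint X c : k)%:A).
  elim/base_generated: c => [c|c c' h h'|c c' h h'|c hc].
  - by rewrite !lrmA /GRing.scale /= mulr1 subrr.
  - rewrite !lrmD scalerDl opprD addrACA; exact: JD.
  - rewrite !lrmM -(mulr_algl (fpoint X c * _)).
    have -> : fstruct X c * fstruct X c' - ((fpoint X c * fpoint X c' : k)%:A) * 1 =
      fstruct X c * (fstruct X c' - (fpoint X c' : k)%:A) +
      (fpoint X c' : k)%:A * (fstruct X c - (fpoint X c : k)%:A).
      have -> : (fpoint X c * fpoint X c' : k)%:A =
         (fpoint X c : k)%:A * (fpoint X c' : k)%:A :> ftotal X.
        by rewrite mulr_algl scalerA.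
      by ring.
    by apply: JD; apply: JM.
  - rewrite g0 // scale0r subr0; exists [:: (c, 1)].
      by move=> p; rewrite inE => /eqP ->.
    by rewrite big_seq1 mulr1.
have [c|h [h1 _] _] := univ Q pi (scalars Q).
  transitivity (pi (fpoint X c : k)%:A); last by rewrite lrmA.
  apply/eqP; rewrite -subr_eq0 -lrmB; apply/eqP/kpi; exact: strJ.
by move=> b0; apply/kpi; rewrite -h1 b0 lrm0.
Qed.

Variables (f2 : {lrmorphism fbase X -> fbase X}).
Variables (F2 : {lrmorphism ftotal X -> ftotal X}).
Hypothesis F2_str : forall b, F2 (fstruct X b) = fstruct X (f2 b).
Hypothesis F2_x : forall j, (1 <= j <= e)%N -> weight_vector F2 (wt j) (x j).
Hypothesis f2_s : forall j l, s_index a j l -> weight_vector f2 (wt j * l) (s j l).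
Hypothesis f2_t : forall j, t_index a j -> weight_vector f2 (wt j) (t j).

Local Notation wv := (weight_vector F2).

Lemma base_gen_weight c : base_gen c ->
  exists2 l, weight_vector f2 l c & homogeneous_value l (f c).
Proof.
case=> [[j [l [hj ->]]]|[j hj ->]].
  exists (wt j * l)%N; first exact: f2_s.
  by rewrite base_morphism_s //; apply: S_hom.
exists (wt j); first exact: f2_t.
by rewrite base_morphism_t //; apply: T_hom.
Qed.

Lemma str_weight l c : weight_vector f2 l c -> wv l (fstruct X c).
Proof. by rewrite /weight_vector F2_str => ->; rewrite lrmZ. Qed.

Lemma total_graded b : weight_sum F2 b.
Proof.
have gc c : weight_sum F2 c%:A by apply: weight_sum_wv (wv1 _ c).
elim/total_generated: b => [c|b b' h h'|b b' h h'|b []].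
- exact: gc.
- exact: weight_sumD.
- exact: weight_sumM.
- by move=> [j hj ->]; apply: weight_sum_wv (F2_x hj).
move=> [c ->]; elim/base_generated: c => [c|c c' h h'|c c' h h'|c hc].
- by rewrite lrmA; apply: gc.
- by rewrite lrmD; apply: weight_sumD.
- by rewrite lrmM; apply: weight_sumM.
have [l h _] := base_gen_weight hc.
exact: weight_sum_wv (str_weight h).
Qed.

Lemma homogeneous_value_weight l p : homogeneous_value l p ->
  weight_vector th l (poly_eval g p).
Proof.
move=> [c [m [-> h]]]; rewrite (lrmZ (poly_eval g)) (lrmX (poly_eval g)) /= poly_evalX.
case: h => [->|<-]; first by rewrite scale0r; apply: wv0.
by apply: wvZ; rewrite mulnC; apply: wvX.
Qed.

Lemma F_equivariant b : F (F2 b) = th (F b).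
Proof.
have bs c : poly_eval g (f (f2 c)) = th (poly_eval g (f c)).
  elim/base_generated: c => [c|c c' h h'|c c' h h'|c hc].
  - by rewrite !lrmA.
  - by rewrite !lrmD /= h h'.
  - by rewrite !lrmM /= h h'.
  have [l h hv] := base_gen_weight hc.
  by rewrite h lrmZ (lrmZ (poly_eval g)) (homogeneous_value_weight hv).
elim/total_generated: b => [c|b b' h h'|b b' h h'|b []].
- by rewrite !lrmA.
- by rewrite !lrmD h h'.
- by rewrite !lrmM h h'.
- by move=> [j hj ->]; rewrite F2_x // lrmZ F_x // th_X.
by move=> [c ->]; rewrite F2_str !F_str bs.
Qed.

Lemma F_weight l b : wv l b -> weight_vector th l (F b).
Proof. by rewrite /weight_vector -F_equivariant => ->; rewrite lrmZ. Qed.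

(** Homogeneous of weight K, the variable having the weight dg of lambda. *)
Definition homog (K : nat) (G : {poly ftotal X}) : Prop :=
  forall m, if (m * dg <= K)%N then wv (K - m * dg) G`_m else G`_m = 0.

Lemma homog0 K : homog K 0.
Proof. by move=> m; rewrite coef0; case: ifP => // _; apply: wv0. Qed.

Lemma homogD K G G' : homog K G -> homog K G' -> homog K (G + G').
Proof.
move=> h h' m; rewrite coefD; move: (h m) (h' m); case: ifP => _.
  exact: wvD.
by move=> -> ->; rewrite addr0.
Qed.

Lemma homog_drop K G : (dg <= K)%N -> homog K G -> homog (K - dg) (drop_poly 1 G).
Proof.
move=> dK h m; have := h m.+1; rewrite coef_drop_poly addn1 mulSn.
have -> : (dg + m * dg <= K)%N = (m * dg <= K - dg)%N by rewrite leq_subRL.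
by rewrite subnDA.
Qed.

(** A cone over the line and X, to be factored through the toric family. *)
Definition compatible (D : comAlgType k) (u : {lrmorphism ftotal X -> D})
    (v : {lrmorphism {poly k} -> D}) : Prop :=
  forall b, u (fstruct X b) = v (f b).

(** A homogeneous element c vanishing on the special fibre is a combination of
    parameters, whose values on the line are multiples of lambda.  So c becomes
    lambda times an expression G in lambda of smaller weight, the same G for
    all compatible pairs u, v. *)
Lemma kernel_divisible K c : wv K c -> ffibre X c = 0 ->
  exists G : {poly ftotal X}, (if (dg <= K)%N then homog (K - dg) G else G = 0) /\
    forall (D : comAlgType k) u v, @compatible D u v -> u c = v 'X * ev u (v 'X) G.
Proof.
move=> cK /ffibre_kernel[r rg cE].
have {}cE : c = \sum_(p <- r) wproj total_graded K (fstruct X p.1 * p.2).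
  by rewrite -wproj_sum -cE wproj_id.
rewrite {}cE; elim: r rg => [|p r IH] rg.
  exists 0; split; first by case: ifP => _ //; apply: homog0.
  by move=> D u v _; rewrite big_nil lrm0 ev0 mulr0.
have [|G [GK GE]] := IH; first by move=> p' hp; apply: rg; rewrite inE hp orbT.
have [l lw [c0 [m [fv hm]]]] := base_gen_weight (rg _ (mem_head _ _)).
pose q := if (l <= K)%N then c0 *: wproj total_graded (K - l)%N p.2 else 0.
exists ('X^m * q%:P + G); split.
  have hq : if (dg <= K)%N then homog (K - dg) ('X^m * q%:P) else 'X^m * q%:P = 0.
    rewrite /q; case: (leqP l K) => [lK|_]; last first.
      by rewrite polyC0 mulr0; case: ifP => // _; apply: homog0.
    case: hm => [->|lE].
      by rewrite scale0r polyC0 mulr0; case: ifP => // _; apply: homog0.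
    have dK : (dg <= K)%N by apply: leq_trans lK; rewrite -lE leq_pmull.
    rewrite dK => m'; rewrite coefMC coefXn.
    have [->|_] := eqVneq m' m; last first.
      by rewrite mul0r; case: ifP => // _; apply: wv0.
    rewrite mul1r; have -> : (m * dg <= K - dg)%N by rewrite leq_subRL // -mulSn lE.
    rewrite -subnDA -mulSn lE; apply: wvZ; exact: wproj_wv.
  by move: GK hq; case: ifP => _; [move=> h h'; apply: homogD | move=> -> ->; rewrite addr0].
move=> D u v uv; rewrite big_cons lrmD (GE D u v uv) evD mulrDr; congr (_ + _).
rewrite (wproj_mul total_graded _ _ (str_weight lw)) evM evXn evC mulrA -exprS.
rewrite /q; case: ifP => _; last by rewrite !lrm0 mulr0.
by rewrite lrmM uv fv !lrmZ lrmX -scalerAl -scalerAr.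
Qed.

Lemma compatible_F : @compatible B F (poly_eval g).
Proof. exact: F_str. Qed.

(** Induction on the weight: a relation G over the toric total space has constant
    coefficient vanishing on the special fibre, hence equals lambda times a
    relation of smaller weight; lambda is a nonzerodivisor of the toric total
    space, so the latter is a relation there too, and holds universally by
    induction. *)
Lemma homog_kernel K G : homog K G -> ev F g G = 0 ->
  forall (D : comAlgType k) u v, @compatible D u v -> ev u (v 'X) G = 0.
Proof.
elim/ltn_ind: K G => K IH G hG G0 D u v uv.
have c0 : ffibre X G`_0 = 0.
  rewrite -F_fibre; have := congr1 (th_fib T) G0.
  by rewrite ev_split lrmD lrmM th_fib_par mul0r addr0 lrm0.
have cw : wv K G`_0 by have := hG 0%N; rewrite mul0n subn0.
have [G' [hG' G'E]] := kernel_divisible cw c0.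
have spl (D' : comAlgType k) u' v' : @compatible D' u' v' ->
    ev u' (v' 'X) G = v' 'X * ev u' (v' 'X) (G' + drop_poly 1 G).
  by move=> h; rewrite ev_split (G'E _ _ _ h) evD mulrDr.
have F0 : ev F g (G' + drop_poly 1 G) = 0.
  apply: th_reg; have := spl B F (poly_eval g) compatible_F.
  by rewrite /= poly_evalX G0 => <-.
rewrite (spl _ _ _ uv); move: hG'; case: leqP => dK hG'; last first.
  rewrite hG' add0r (_ : drop_poly 1 G = 0) ?ev0 ?mulr0 //.
  apply/polyP => m; rewrite coef_drop_poly coef0 addn1.
  have := hG m.+1; rewrite mulSn leqNgt.
  by have -> : (K < dg + m * dg)%N by apply: leq_trans dK (leq_addr _ _).
rewrite (IH (K - dg)%N) ?mulr0 //; first by lia.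
by apply: homogD => //; apply: homog_drop.
Qed.

Lemma homog_sum_exists (G : {poly ftotal X}) :
  exists2 r : seq (nat * {poly ftotal X}), (forall p, p \in r -> homog p.1 p.2) &
    G = \sum_(p <- r) p.2.
Proof.
elim/poly_ind: G => [|G c [r rh ->]]; first by exists [::]; rewrite ?big_nil.
have [r' rw cE] := total_graded c.
exists ([seq ((p.1 + dg)%N, p.2 * 'X) | p <- r] ++ [seq (p.1, p.2%:P) | p <- r']).
  move=> p; rewrite mem_cat => /orP[/mapP[p' /rh hp ->]|/mapP[p' /rw hp ->]] m /=.
    rewrite coefMX; case: m => [|m] /=; first exact: wv0.
    have := hp m; rewrite mulSn.
    have -> : (dg + m * dg <= p'.1 + dg)%N = (m * dg <= p'.1)%N by lia.
    by have -> : (p'.1 + dg - (dg + m * dg) = p'.1 - m * dg)%N by lia.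
  rewrite coefC; case: m => [|m]; first by rewrite mul0n subn0.
  by case: ifP => // _; apply: wv0.
rewrite big_cat !big_map /= mulr_suml; congr (_ + _).
by rewrite cE rmorph_sum.
Qed.

Lemma ev_F_weight K G : homog K G -> weight_vector th K (ev F g G).
Proof.
elim/ltn_ind: K G => K IH G hG.
rewrite ev_split; apply: wvD.
  by apply: F_weight; have := hG 0%N; rewrite mul0n subn0.
have [dK|dK] := leqP dg K.
  have -> : K = (dg + (K - dg))%N by lia.
  apply: wvM => //; apply: IH; [lia | exact: homog_drop].
rewrite (_ : drop_poly 1 G = 0) ?ev0 ?mulr0; first exact: wv0.
apply/polyP => m; rewrite coef_drop_poly coef0 addn1.
have := hG m.+1; rewrite mulSn leqNgt.
by have -> : (K < dg + m * dg)%N by apply: leq_trans dK (leq_addr _ _).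
Qed.

Lemma ev_kernel G : ev F g G = 0 ->
  forall (D : comAlgType k) u v, @compatible D u v -> ev u (v 'X) G = 0.
Proof.
have [r rh ->] := homog_sum_exists G.
move=> G0 D u v uv.
have comp K : ev u (v 'X) (\sum_(p <- r | p.1 == K) p.2) = 0.
  apply: (@homog_kernel K) => //.
    rewrite big_seq_cond; elim/big_ind: _ => [||p /andP[pr /eqP <-]].
    - exact: homog0.
    - exact: homogD.
    - exact: rh.
  pose rF := [seq (p.1, ev F g p.2) | p <- r].
  have rFw p : p \in rF -> weight_vector th p.1 p.2.
    by move=> /mapP[p' /rh hp ->]; apply: ev_F_weight.
  have rF0 : \sum_(p <- rF) p.2 = \sum_(p <- [::] : seq (nat * B)) p.2.
    by rewrite big_map big_nil -ev_sum.
  have nilw p : p \in ([::] : seq (nat * B)) -> weight_vector th p.1 p.2 by [].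
  have := weight_components_unique rFw nilw rF0 K.
  by rewrite big_nil big_map ev_sum.
have [N hN] := bound_exists [seq (p.1, ev u (v 'X) p.2) | p <- r].
rewrite ev_sum; have := weight_group hN; rewrite big_map => ->.
by apply: big1 => K _; rewrite big_map -ev_sum.
Qed.

(** Induction on the weight: z agrees on the special fibre with the image of some
    b, so that z - F b is lambda times an element of smaller weight. *)
Lemma ev_surjective z : exists G, ev F g G = z.
Proof.
have hom K : forall z, weight_vector th K z -> exists G, ev F g G = z.
  elim/ltn_ind: K => K IH {}z zK.
  have [b bE] := ffibre_surjective (th_fib T z).
  have [z' zE] : exists z', z - F b = g * z'.
    by apply: th_ker; rewrite lrmB F_fibre bE subrr.
  have {}zE : z = F b + g * z' by rewrite -zE addrC subrK.
  have zK' : z = F (wproj total_graded K b) + wproj th_graded K (g * z').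
    rewrite (@wproj_morph _ _ _ _ _ total_graded th_graded F K F_equivariant).
    by rewrite -wprojD -zE wproj_id.
  move: zK'; rewrite (wproj_mul th_graded _ _ th_g); case: leqP => dK zK'.
    have [|G GE] := IH (K - dg)%N _ (wproj th_graded (K - dg)%N z') (wproj_wv _ _ _).
      by lia.
    exists ((wproj total_graded K b)%:P + 'X * G).
    by rewrite evD evM evC evX GE -zK'.
  by exists (wproj total_graded K b)%:P; rewrite evC zK' addr0.
have [N /(_ N (leqnn N)) ->] := wproj_bound th_graded z.
elim/big_ind: _ => [|z1 z2 [G1 <-] [G2 <-]|l _].
- by exists 0; rewrite ev0.
- by exists (G1 + G2); rewrite evD.
- exact: hom (wproj_wv _ _ _).
Qed.

(** By ev_surjective and ev_kernel, O_Z is the quotient of the polynomial ring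
    over the total space of X by relations that hold in every compatible
    algebra. *)
Lemma line_pullback :
  @is_pullback _ _ X (line_family g (th_fib T)) f F.
Proof.
split=> [b|b|]; first exact: f_point.
  exact: F_fibre.
split=> [b|D u v uv]; first exact: F_str.
have /choice[rp rpE] := ev_surjective.
pose y := v 'X.
have key G : ev u y (rp (ev F g G)) = ev u y G.
  have := @ev_kernel (rp (ev F g G) - G) _ D u v uv.
  rewrite !evD -![- G]mulN1r !evM -polyC1 -polyCN !evC !lrmN !lrm1 !mulN1r rpE subrr.
  by move=> /(_ erefl)/eqP; rewrite subr_eq0 => /eqP.
pose h0 z := ev u y (rp z).
have h0E G : h0 (ev F g G) = ev u y G by exact: key.
have fl : linear h0.
  move=> c z z'; have [G <-] := ev_surjective z; have [G' <-] := ev_surjective z'.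
  have -> : c *: ev F g G + ev F g G' = ev F g ((c%:A)%:P * G + G').
    by rewrite evD evM evC lrmA mulr_algl.
  by rewrite !h0E evD evM evC lrmA mulr_algl.
have fm : monoid_morphism h0.
  split=> [|z z'].
    by rewrite -(lrm1 F) -(evC F g) h0E evC lrm1.
  have [G <-] := ev_surjective z; have [G' <-] := ev_surjective z'.
  by rewrite -evM !h0E evM.
have [h hE] := lrmorphism_of fl fm.
have hF b : h (F b) = u b by rewrite hE -(evC F g) h0E evC.
have hg : h g = y by rewrite hE -(evX F g) h0E evX.
exists h.
  split=> // p.
  pose hp : {lrmorphism {poly k} -> D} := h \o (poly_eval g).
  apply: (lr_line_ext (v := hp) (v' := v)).
  by rewrite /hp /= poly_evalX hg.
move=> h' h'F h'v z; have [G <-] := ev_surjective z.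
have h'g : h' g = y by rewrite /y -h'v /= poly_evalX.
elim/poly_ind: G => [|G c IH]; first by rewrite ev0 !lrm0.
by rewrite evD evM evX evC !lrmD !lrmM IH h'F hF h'g hg.
Qed.

End Globalisation.

Lemma torus_char_two (R : realType) (m : 'rV[int]_2) (l : nat) :
  0 <= m 0 0 -> 0 <= m 0 1 -> l%:Z = m 0 0 + m 0 1 ->
  torus_char 2%:R 2%:R m = (2%:R : R[i]) ^+ l.
Proof.
rewrite /torus_char; case: (m 0 0) => // p _; case: (m 0 1) => // p' _.
by rewrite -PoszD => -[->]; rewrite -!exprnP exprD.
Qed.

(** The torus action on X supplies its grading, through the element (2, 2),
    which acts on the coordinate x_j with the weight of the sum of the two
    coordinates of w^j. *)
Theorem arndt_pullback (R : realType) (a : seq nat) (w : nat -> 'rV[int]_2)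
  (P : 'rV[int]_2 -> Prop)
  (H : hilbert_chain R[i] P (embdim a) (coefa a) w)
  (OY : comAlgType R[i]) (chi : 'rV[int]_2 -> OY) (hO : monoid_algebra P chi)
  (X : pointed_family OY) (s : nat -> nat -> fbase X) (t : nat -> fbase X)
  (x : nat -> ftotal X) (hX : arndt_family a w chi s t x)
  (T : thickening OY) (Sv : nat -> nat -> {poly R[i]}) (Tv : nat -> {poly R[i]})
  (Xv : nat -> th_alg T) (sol : arndt_solution a w chi Sv Tv Xv)
  (wt : nat -> nat) (dg : nat) (th : {lrmorphism th_alg T -> th_alg T})
  (wtE : forall j, (1 <= j <= embdim a)%N ->
     [/\ 0 <= w j 0 0, 0 <= w j 0 1 & (wt j)%:Z = w j 0 0 + w j 0 1])
  (dg_gt0 : (0 < dg)%N)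
  (th_graded : forall z, weight_sum th z)
  (th_g : weight_vector th dg (th_par T))
  (th_X : forall j, (1 <= j <= embdim a)%N -> weight_vector th (wt j) (Xv j))
  (S_hom : forall j l, s_index a j l -> homogeneous_value dg (wt j * l) (Sv j l))
  (T_hom : forall j, t_index a j -> homogeneous_value dg (wt j) (Tv j)) :
  exists (f : {lrmorphism fbase X -> {poly R[i]}})
         (F : {lrmorphism ftotal X -> th_alg T}),
    [/\ @is_pullback _ _ X (line_family (th_par T) (th_fib T)) f F,
        forall j l, s_index a j l -> f (s j l) = Sv j l
      & forall j, t_index a j -> f (t j) = Tv j].
Proof.
have [f fE] := base_morphism_exists H hO hX sol.
have [F [F_str F_x F_lift]] := total_morphism_exists H hO hX sol dg_gt0 th_graded th_g fE.
exists f, F; split.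
- have two0 : (2%:R : R[i]) != 0 by rewrite pnatr_eq0.
  have [_ _ _ _ tor] := hX.
  have [f2 [F2 [F2s F2x f2s f2t]]] := tor _ _ two0 two0.
  have tc j : (1 <= j <= embdim a)%N ->
      torus_char 2%:R 2%:R (w j) = (2%:R : R[i]) ^+ wt j.
    by move=> /wtE[h1 h2 h3]; apply: torus_char_two.
  apply: (line_pullback H hO hX sol dg_gt0 th_graded th_g th_X S_hom T_hom fE F_str
    F_x F_lift F2s (f2 := f2) (F2 := F2)).
  + by move=> j hj; rewrite /weight_vector F2x // tc.
  + move=> j l hj; rewrite /weight_vector f2s // tc ?exprM //.
    by case/andP: hj => hj _; lia.
  + move=> j hj; rewrite /weight_vector f2t // tc //.
    by move: hj; rewrite /t_index; lia.
- by move=> j l hj; apply: (base_morphism_s H hO hX sol fE).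
- by move=> j hj; apply: (base_morphism_t H hO hX sol fE).
Qed.

(** * Monomials of the cyclic quotient and their generators *)

Section Rows.
Variable K : nzRingType.

Lemma row2E (x y : K) : (rowv 2 [:: x; y] 0 0 = x) * (rowv 2 [:: x; y] 0 1 = y).
Proof. by rewrite !mxE. Qed.

Lemma row2P (v : 'rV[K]_2) : v = rowv 2 [:: v 0 0; v 0 1].
Proof.
apply/rowP => j; rewrite mxE; case: j => -[|[|]] // h /=; congr (v _ _);
  exact: val_inj.
Qed.

Lemma row2_eq (v v' : 'rV[K]_2) : v 0 0 = v' 0 0 -> v 0 1 = v' 0 1 -> v = v'.
Proof. by move=> h h'; rewrite (row2P v) (row2P v') h h'. Qed.

Lemma row3E (x y z : K) : ((rowv 3 [:: x; y; z] 0 0 = x) *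
  (rowv 3 [:: x; y; z] 0 1 = y) * (rowv 3 [:: x; y; z] 0 2%:R = z))%type.
Proof. by rewrite !mxE. Qed.

Lemma row3P (v : 'rV[K]_3) : v = rowv 3 [:: v 0 0; v 0 1; v 0 2%:R].
Proof.
apply/rowP => j; rewrite mxE; case: j => -[|[|[|]]] // h /=; congr (v _ _);
  exact: val_inj.
Qed.

Lemma row3_eq (v v' : 'rV[K]_3) :
  v 0 0 = v' 0 0 -> v 0 1 = v' 0 1 -> v 0 2%:R = v' 0 2%:R -> v = v'.
Proof. by move=> h h' h2; rewrite (row3P v) (row3P v') h h' h2. Qed.
End Rows.

Section Lattice.
Variables (R : realType) (n q : nat).
Local Notation monY := (monY R n q).
Local Notation lattM := (lattM R n q).

Lemma pairing2 (v : 'rV[R]_2) m :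
  pairing v m = v 0 0 * (m 0 0)%:~R + v 0 1 * (m 0 1)%:~R.
Proof.
rewrite /pairing big_ord_recl big_ord1; congr (_ + v _ _ * (m _ _)%:~R); exact: val_inj.
Qed.

Lemma pairing3 (v : 'rV[R]_3) m : pairing v m =
  v 0 0 * (m 0 0)%:~R + v 0 1 * (m 0 1)%:~R + v 0 2%:R * (m 0 2%:R)%:~R.
Proof.
rewrite /pairing !big_ord_recl big_ord0 addr0 addrA.
by congr (_ + v _ _ * (m _ _)%:~R + v _ _ * (m _ _)%:~R); apply: val_inj.
Qed.

Lemma pairingDr r (v : 'rV[R]_r) m m' : pairing v (m + m') = pairing v m + pairing v m'.
Proof.
by rewrite /pairing -big_split; apply: eq_bigr => j _; rewrite mxE rmorphD mulrDr.
Qed.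

Lemma pairing0r r (v : 'rV[R]_r) : pairing v 0 = 0.
Proof. by rewrite /pairing big1 // => j _; rewrite mxE mulr0. Qed.

Lemma pairingDl r (v v' : 'rV[R]_r) m : pairing (v + v') m = pairing v m + pairing v' m.
Proof.
by rewrite /pairing -big_split; apply: eq_bigr => j _; rewrite mxE mulrDl.
Qed.

Lemma pairingZl r c (v : 'rV[R]_r) m : pairing (c *: v) m = c * pairing v m.
Proof.
by rewrite /pairing mulr_sumr; apply: eq_bigr => j _; rewrite mxE mulrA.
Qed.

Lemma pairing_sum r I (s : seq I) (c : I -> 'rV[R]_r) m :
  pairing (\sum_(j <- s) c j) m = \sum_(j <- s) pairing (c j) m.
Proof.
apply: (big_morph (fun v => pairing v m)) => [v v'|]; first exact: pairingDl.
by rewrite /pairing big1 // => j _; rewrite mxE mul0r.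
Qed.

Lemma dual_coneP r (s : seq 'rV[R]_r) m :
  dual_cone (cone s) m <-> forall v, v \in s -> 0 <= pairing v m.
Proof.
split=> [h v vs|h v [c c0 ->]].
  apply: h; exists (fun j => if j == index v s then 1 else 0).
    by move=> j; case: ifP.
  have lt : (index v s < size s)%N by rewrite index_mem.
  rewrite (bigD1 (Ordinal lt)) //= eqxx scale1r nth_index // big1 ?addr0 //.
  move=> j /eqP ne; case: eqP => [je|]; last by rewrite scale0r.
  by case: ne; apply: val_inj.
rewrite pairing_sum; apply: sumr_ge0 => j _; rewrite pairingZl.
by apply: mulr_ge0 => //; apply: h; apply: mem_nth.
Qed.

Lemma sigmaP (v : 'rV[R]_2) : sigma v <-> 0 <= v 0 0 /\ 0 <= v 0 1.
Proof.
split=> [[c c0 ->]|[h0 h1]].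
  by rewrite !big_ord_recl big_ord0 !mxE /= !mulr1 !mulr0 !addr0 add0r.
exists (fun j => if j is 0%N then v 0 0 else v 0 1); first by case.
by apply: row2_eq; rewrite !big_ord_recl big_ord0 !mxE /= !mulr1 !mulr0 !addr0 ?add0r.
Qed.

Lemma lattM0 : lattM 0.
Proof. by move=> v _; rewrite pairing0r. Qed.

Lemma lattMD m m' : lattM m -> lattM m' -> lattM (m + m').
Proof. by move=> h h' v hv; rewrite pairingDr rpredD ?h ?h'. Qed.

Lemma monYE m : monY m <-> [/\ lattM m, 0 <= m 0 0 & 0 <= m 0 1].
Proof.
have dc : dual_cone (@sigma R) m <-> (0 <= m 0 0 /\ 0 <= m 0 1).
  rewrite /sigma dual_coneP; split=> [h|[h0 h1] v].
    have := h (rowv 2 [:: 1; 0]); have := h (rowv 2 [:: 0; 1]).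
    rewrite !inE !eqxx orbT /= !pairing2 !row2E !mul1r !mul0r addr0 add0r !ler0z.
    by move=> /(_ isT) ? /(_ isT).
  by rewrite !inE => /orP[] /eqP ->; rewrite pairing2 !row2E !mul1r !mul0r
    ?addr0 ?add0r ler0z.
by rewrite /Defs.monY dc; split=> [[? []]|[]].
Qed.

Lemma monY0 : monY 0.
Proof. by apply/monYE; rewrite !mxE; split=> //; apply: lattM0. Qed.

Lemma monYD m m' : monY m -> monY m' -> monY (m + m').
Proof.
move=> /monYE[? ? ?] /monYE[? ? ?]; apply/monYE; rewrite !mxE.
by split; [apply: lattMD | apply: addr_ge0 | apply: addr_ge0].
Qed.

Lemma monYn m l : monY m -> monY (m *+ l).
Proof. by move=> h; elim: l => [|l IH]; [apply: monY0 | rewrite mulrS; apply: monYD]. Qed.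

Lemma monY_sum0 m m' : monY m -> monY m' -> m + m' = 0 -> m = 0 /\ m' = 0.
Proof.
move=> /monYE[_ a0 a1] /monYE[_ b0 b1] h.
have h0 : m 0 0 + m' 0 0 = 0 by have := congr1 (fun v : 'rV_2 => v 0 0) h; rewrite !mxE.
have h1 : m 0 1 + m' 0 1 = 0 by have := congr1 (fun v : 'rV_2 => v 0 1) h; rewrite !mxE.
move/eqP: h0; rewrite paddr_eq0 // => /andP[/eqP ma /eqP ma'].
move/eqP: h1; rewrite paddr_eq0 // => /andP[/eqP mb /eqP mb'].
by split; apply: row2_eq; rewrite mxE.
Qed.

(** The weight of the monomial m under the torus element (2, 2). *)
Definition total_degree (m : 'rV[int]_2) : nat := absz (m 0 0 + m 0 1).

Lemma total_degreeD m m' : monY m -> monY m' -> total_degree (m + m') = (total_degree m + total_degree m')%N.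
Proof.
move=> /monYE[_ h0 h1] /monYE[_ h0' h1']; rewrite /total_degree !mxE.
move: (m 0 0) (m 0 1) (m' 0 0) (m' 0 1) h0 h1 h0' h1' => [] // e1 [] // e2 [] // e3 [] // e4.
by rewrite -!PoszD /= => *; lia.
Qed.

Lemma total_degree_n m l : monY m -> total_degree (m *+ l) = (total_degree m * l)%N.
Proof.
move=> hm; elim: l => [|l IH]; first by rewrite mulr0n muln0 /total_degree !mxE.
by rewrite mulrS total_degreeD ?IH ?mulnS //; apply: monYn.
Qed.

End Lattice.

Section ConvexSequence.
Variables (e : nat) (aa : nat -> nat) (f : nat -> int).
Hypothesis e1 : (1 < e)%N.
Hypothesis frec : forall i, (1 < i < e)%N -> f i.-1 + f i.+1 = f i *+ aa i.
Hypothesis aa2 : forall i, (1 < i < e)%N -> (2 <= aa i)%N.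

(** As a_i >= 2, the recurrence makes f convex where it is nonnegative. *)
Lemma convex_step i : (1 < i < e)%N -> 0 <= f i -> f i - f i.-1 <= f i.+1 - f i.
Proof.
move=> hi fi; have := frec hi; have := aa2 hi.
move: (aa i) => [|[|m]] // _; rewrite 2!mulrS => h.
have := mulrn_wge0 m fi; lia.
Qed.

Hypothesis f1 : f 1%N = 0.
Hypothesis fe : 0 < f e.
Hypothesis f0 : forall i, (1 <= i <= e)%N -> 0 <= f i.

Lemma convex_increasing i : (1 <= i < e)%N -> f i < f i.+1.
Proof.
have f2 : 0 < f 2%N.
  rewrite lt0r f0 ?andbT; last by lia.
  apply/eqP => f20.
  (* two consecutive zeros force f = 0 up to f e *)
  have z j : (1 <= j <= e)%N -> f j = 0.
    elim/ltn_ind: j => -[|[|[|j]]] IH hj //.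
    have := @frec j.+2 ltac:(lia); rewrite /= (IH j.+1) ?(IH j.+2) ?mul0rn; try lia.
  by move: fe; rewrite z ?ltxx //; lia.
elim: i => // -[|i] IH hi; first by rewrite f1.
have fi : 0 <= f i.+2 by apply: f0; lia.
have := IH ltac:(lia); have := @convex_step i.+2 ltac:(lia) fi.
by rewrite /=; lia.
Qed.

Lemma convex_positive i : (1 < i <= e)%N -> 0 < f i.
Proof.
case: i => [|i] // hi; apply: le_lt_trans (@convex_increasing i ltac:(lia)).
by apply: f0; lia.
Qed.

Lemma convex_inj i j : (1 <= i <= e)%N -> (1 <= j <= e)%N -> f i = f j -> i = j.
Proof.
have mono i' j' : (1 <= i')%N -> (i' < j' <= e)%N -> f i' < f j'.
  move=> hi'; elim: j' => // j' IH hj'.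
  have h := @convex_increasing j' ltac:(lia).
  have [<-|ne] := eqVneq i' j'; first by apply: convex_increasing; lia.
  by apply: lt_trans h; apply: IH; lia.
move=> hi hj fij; case: (ltngtP i j) => // h.
  by have := mono i j ltac:(lia) ltac:(lia); rewrite fij ltxx.
by have := mono j i ltac:(lia) ltac:(lia); rewrite fij ltxx.
Qed.

End ConvexSequence.

(** From a zero on, f is f h.+1 times the increasing solution starting with
    0, 1. *)
Lemma linear_recurrence_multiple (e h : nat) (aa : nat -> nat) (f : nat -> int) :
  (forall i, (h < i < e)%N -> f i.-1 + f i.+1 = f i *+ aa i) ->
  (forall i, (h < i < e)%N -> (2 <= aa i)%N) -> f h = 0 ->
  forall i, (h < i <= e)%N -> exists2 c : int, 0 < c & f i = f h.+1 * c.
Proof.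
move=> frec aa2 fh.
have key m : (h + m < e)%N -> exists c c' : int,
    [/\ f (h + m)%N = f h.+1 * c, f (h + m).+1 = f h.+1 * c', 0 <= c & c < c'].
  elim: m => [|m IH] hm.
    by exists 0, 1; rewrite addn0 fh mulr0 mulr1.
  have [c [c' [fc fc' c0 cc']]] := IH ltac:(lia).
  rewrite addnS in hm *.
  exists c', (c' *+ aa (h + m).+1 - c); split=> //; last 2 first.
  - lia.
  - have := @aa2 (h + m).+1 ltac:(lia); move: (aa _) => [|[|b]] // _.
    have := @mulrn_wge0 _ c' b ltac:(lia); rewrite 2!mulrS; lia.
  have := @frec (h + m).+1 ltac:(lia); rewrite /= fc fc' => hr.
  by rewrite mulrBr mulrnAr -hr addrC addKr.
move=> i hi; have [c [c' [_ fc' c0 cc']]] := key (i - h).-1 ltac:(lia).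
exists c'; first lia.
by rewrite -fc'; congr f; lia.
Qed.

(** The recurrence is symmetric, so the previous lemma applies on both sides of
    the zero, with the first values d and -d. *)
Lemma two_sided_sequence (e h : nat) (aa : nat -> nat) (f : nat -> int) :
  (forall i, (1 < i < e)%N -> f i.-1 + f i.+1 = f i *+ aa i) ->
  (forall i, (1 < i < e)%N -> (2 <= aa i)%N) -> (1 < h < e)%N ->
  f h = 0 -> 0 < f e ->
  let d := f h.+1 in
  [/\ 0 < d, f h.-1 = - d, forall i, (h < i <= e)%N -> 0 < f i,
      forall i, (1 <= i < h)%N -> f i < 0
    & forall i, (1 <= i <= e)%N -> exists c, f i = d * c].
Proof.
move=> frec aa2 hh fh fe d.
have right i : (h < i <= e)%N -> exists2 c : int, 0 < c & f i = d * c.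
  by apply: (linear_recurrence_multiple (aa := aa)) => // j hj;
    [apply: frec; lia | apply: aa2; lia].
have fm : f h.-1 = - d.
  by apply/eqP; rewrite -addr_eq0 frec // fh mul0rn.
have left i : (1 <= i < h)%N -> exists2 c : int, 0 < c & f i = - d * c.
  move=> hi.
  (* reflection j |-> 2h - j about the zero *)
  have := @linear_recurrence_multiple (h + h).-1 h (fun j => aa (h + h - j)%N)
    (fun j => f (h + h - j)%N) _ _ _ (h + h - i)%N.
  have -> : (h + h - (h + h - i) = i)%N by lia.
  have -> : (h + h - h.+1 = h.-1)%N by lia.
  rewrite fm; apply=> [j hj|j hj||].
  - have := @frec (h + h - j)%N ltac:(lia) => <-.
    by rewrite addrC; congr (f _ + f _); lia.
  - by apply: aa2; lia.
  - by rewrite addnK.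
  - lia.
have d0 : 0 < d.
  have [c c0 fc] := right e ltac:(lia).
  by move: fe; rewrite fc pmulr_lgt0.
split=> // [i hi|i hi|i hi].
- by have [c c0 ->] := right i hi; apply: mulr_gt0.
- by have [c c0 ->] := left i hi; rewrite mulNr oppr_lt0; apply: mulr_gt0.
case: (ltngtP i h) => ih; last by exists 0; rewrite ih fh mulr0.
  by have [c _ ->] := left i ltac:(lia); exists (- c); rewrite mulrN mulNr.
by have [c _ ->] := right i ltac:(lia); exists c.
Qed.

Section HilbertBasis.
Variables (R : realType) (n q : nat).
Hypothesis hn : (3 <= n)%N.
Hypothesis hnq : coprime n q.
Hypothesis hq : (0 < q < n - 1)%N.
Variables (a : seq nat) (w : nat -> 'rV[int]_2).
Hypothesis ha : hj_expansion n q a.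
Hypothesis hw : hilbert_basis R n q a w.
Local Notation e := (embdim a).
Local Notation aa := (coefa a).
Local Notation monY := (monY R n q).

(** A single a_2 would give n = a_2 (n - q), so that n - q divides the coprime
    integers n and q. *)
Lemma embdim_ge4 : (4 <= e)%N.
Proof.
case: ha => _; rewrite /embdim; case: a => [|c [|c' s]] //=.
  move=> /esym/eqP; rewrite mulf_eq0 invr_eq0 pnatr_eq0 -natrB; last by lia.
  by rewrite pnatr_eq0; lia.
rewrite -natrB; last by lia.
have nq0 : ((n - q)%:R : rat) != 0 by rewrite pnatr_eq0; lia.
move/(congr1 (fun z => z * (n - q)%:R)); rewrite mulfVK // -natrM => /eqP.
rewrite eqr_nat => /eqP cn.
have dn : (n - q %| n)%N by apply/dvdnP; exists c.
have dq : (n - q %| q)%N.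
  have qE : (q = n - (n - q))%N by lia.
  by rewrite [X in (_ %| X)%N]qE dvdn_sub.
have := dvdn_gcd (n - q) n q; rewrite dn dq (eqP hnq) dvdn1; lia.
Qed.

Lemma coefa_ge2 i : (1 < i < e)%N -> (2 <= aa i)%N.
Proof.
clear hn hnq hq.
move=> hi; case: ha => /all_nthP h _; apply: h.
by move: hi; rewrite /embdim; lia.
Qed.

Lemma w_indecomposable i : (1 <= i <= e)%N -> indecomposable R n q (w i).
Proof. by case: hw => h _ _ _ hi; apply/h; exists i. Qed.

Lemma w_monY i : (1 <= i <= e)%N -> monY (w i).
Proof. by move/w_indecomposable => []. Qed.

Lemma w_neq0 i : (1 <= i <= e)%N -> w i <> 0.
Proof. by move/w_indecomposable => []. Qed.

Lemma w_ge0 i : (1 <= i <= e)%N -> 0 <= w i 0 0 /\ 0 <= w i 0 1.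
Proof. by move/w_monY/monYE => []. Qed.

Lemma w_first : (w 1%N 0 0 = n%:Z) * (w 1%N 0 1 = 0).
Proof. by case: hw => _ -> _ _; rewrite !row2E. Qed.

Lemma w_last : (w e 0 0 = 0) * (w e 0 1 = n%:Z).
Proof. by case: hw => _ _ -> _; rewrite !row2E. Qed.

Lemma w_recurrence i : (1 < i < e)%N -> w i.-1 + w i.+1 = w i *+ aa i.
Proof. by case: hw => _ _ _ h /h. Qed.

Lemma w_recurrence_coord i j : (1 < i < e)%N ->
  w i.-1 0 j + w i.+1 0 j = w i 0 j *+ aa i.
Proof.
by move=> /w_recurrence /(congr1 (fun v : 'rV_2 => v 0 j)); rewrite mxE mulmxnE.
Qed.

Lemma w_snd_inj i j : (1 <= i <= e)%N -> (1 <= j <= e)%N ->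
  w i 0 1 = w j 0 1 -> i = j.
Proof.
have e4 := embdim_ge4.
apply: (convex_inj (f := fun i => w i 0 1) (aa := aa)) => [|l hl|l hl|||l hl].
- by lia.
- exact: w_recurrence_coord.
- exact: coefa_ge2.
- by rewrite w_first.
- by rewrite w_last; lia.
- by have [] := w_ge0 hl.
Qed.

Lemma w_inj i j : (1 <= i <= e)%N -> (1 <= j <= e)%N -> w i = w j -> i = j.
Proof. by move=> hi hj wij; apply: w_snd_inj => //; rewrite wij. Qed.

Lemma w_snd_gt0 i : (1 < i <= e)%N -> 0 < w i 0 1.
Proof.
have e4 := embdim_ge4.
apply: (convex_positive (f := fun i => w i 0 1) (aa := aa)) => [|l hl|l hl|||l hl].
- by lia.
- exact: w_recurrence_coord.
- exact: coefa_ge2.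
- by rewrite w_first.
- by rewrite w_last; lia.
- by have [] := w_ge0 hl.
Qed.

Lemma w_fst_gt0 i : (1 <= i < e)%N -> 0 < w i 0 0.
Proof.
have e4 := embdim_ge4; move=> hi.
have := @convex_positive e (fun i => aa (e.+1 - i)%N) (fun i => w (e.+1 - i)%N 0 0).
have -> : w i 0 0 = w (e.+1 - (e.+1 - i))%N 0 0 by congr (w _ 0 0); lia.
move=> /(_ _ _ _ _ _ _ (e.+1 - i)%N) H; apply: (H) => [|l hl|l hl|||l hl|]; rewrite ?subn1 /=.
- by lia.
- have := @w_recurrence_coord (e.+1 - l)%N 0 ltac:(lia) => <-.
  by rewrite addrC; congr (w _ _ _ + w _ _ _); lia.
- by apply: coefa_ge2; lia.
- by rewrite w_last.
- have -> : (e.+1 - e = 1)%N by lia.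
  by rewrite w_first; lia.
- by have [] := @w_ge0 (e.+1 - l)%N ltac:(lia).
- by lia.
Qed.

(** If w i - l w j were in the monoid, w i would be the sum of w j and a further
    element, which indecomposability excludes unless that element is 0. *)
Lemma w_separated i j l : (1 <= i <= e)%N -> (1 < j < e)%N -> (1 <= l)%N ->
  monY (w i - w j *+ l) -> i = j /\ l = 1%N.
Proof.
move=> hi hj; case: l => // l _ Pm.
have hj' : (1 <= j <= e)%N by lia.
have Pj := w_monY hj'; have wj0 := w_neq0 hj'.
have [_ _ /(_ (w j) (w j *+ l + (w i - w j *+ l.+1)))] := w_indecomposable hi.
case=> // [||h].
- by apply: monYD => //; apply: monYn.
- by rewrite addrA -mulrS addrC subrK.
have [l0 m0] := monY_sum0 (monYn l Pj) Pm h.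
have {l0} l0 : l = 0%N.
  case: l l0 {Pm h m0} => // l; rewrite mulrS => l0.
  by have [] := monY_sum0 Pj (monYn l Pj) l0.
move/eqP: m0; rewrite l0 mulr1n subr_eq0 => /eqP wij.
by split=> //; apply: w_inj.
Qed.

(** Induction on the sum of the coordinates: an element is indecomposable, hence
    some w i, or a sum of two elements of smaller degree. *)
Lemma w_generate (Q : 'rV[int]_2 -> Prop) : Q 0 ->
  (forall i m, (1 <= i <= e)%N -> monY m -> Q m -> Q (w i + m)) ->
  forall m, monY m -> Q m.
Proof.
clear hn hnq hq ha => Q0 QD.
have key N m : monY m -> (m 0 0 + m 0 1 < N%:Z) ->
    forall m', monY m' -> Q m' -> Q (m + m').
  elim: N m => [|N IH] m Pm mN m' Pm' Qm'.
    by move/monYE: Pm => [_ ? ?]; lia.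
  have [->|m0] := pselect (m = 0); first by rewrite add0r.
  have [ind|nind] := pselect (indecomposable R n q m).
    by case: hw => h _ _ _; move/h: ind => [i hi ->]; apply: QD.
  have [m1 [m2 [P1 P2 mE n1 n2]]] : exists m1 m2,
      [/\ monY m1, monY m2, m = m1 + m2, m1 <> 0 & m2 <> 0].
    apply: contrapT => no; apply: nind; split=> // m1 m2 P1 P2 mE.
    have [->|n1] := pselect (m1 = 0); first by left.
    have [->|n2] := pselect (m2 = 0); first by right.
    by case: no; exists m1, m2.
  have pos m3 : monY m3 -> m3 <> 0 -> 0 < m3 0 0 + m3 0 1.
    move=> /monYE[_ c0 c1] ne; rewrite lt0r addr_ge0 // andbT.
    apply/eqP => s0; apply: ne.
    move/eqP: s0; rewrite paddr_eq0 // => /andP[/eqP s0 /eqP s1].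
    by apply: row2_eq; rewrite mxE.
  have p1 := pos _ P1 n1; have p2 := pos _ P2 n2.
  have {}mN : (m1 0 0 + m2 0 0) + (m1 0 1 + m2 0 1) < N.+1%:Z.
    by move: mN; rewrite mE !mxE.
  have q2 : Q (m2 + m') by apply: IH => //; lia.
  by rewrite mE -addrA; apply: IH => //; [lia | exact: monYD].
move=> m Pm; rewrite -[m]addr0; apply: (key (absz (m 0 0 + m 0 1)).+1) => //.
  by lia.
exact: monY0.
Qed.

Lemma w_chain : hilbert_chain R[i] monY e aa w.
Proof.
have e4 := embdim_ge4; split.
- exact: monY0.
- exact: monYD.
- exact: e4.
- exact: w_monY.
- exact: coefa_ge2.
- exact: w_recurrence.
- exact: w_separated.
- exact: w_generate.
pose A : R[i] := (w 2%N 0 0)%:~R; pose B : R[i] := (w 2%N 0 1)%:~R.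
have B0 : B != 0 by rewrite intr_eq0; have := @w_snd_gt0 2 ltac:(lia); lia.
have n0 : (n%:R : R[i]) != 0 by rewrite pnatr_eq0; lia.
(* the coordinates with respect to the basis w 1 = (n, 0), w 2 of the plane *)
exists (fun m : 'rV[int]_2 => ((m 0 0)%:~R - (m 0 1)%:~R * A / B) / n%:R).
exists (fun m : 'rV[int]_2 => (m 0 1)%:~R / B).
split=> [m m'|m m'||].
- by rewrite !mxE !rmorphD /=; field; rewrite B0 n0.
- by rewrite mxE rmorphD mulrDl.
- by rewrite !w_first mulr0z !mul0r subr0 divff.
by rewrite -/A -/B; split; field; rewrite ?B0 ?n0.
Qed.

End HilbertBasis.

(** * Coordinates attached to a segment *)

Section Chart.
Variables (R : realType) (n q : nat).
Local Notation monY := (monY R n q).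
Local Notation lattM := (lattM R n q).
Local Notation lattN := (@lattN R n q).

(** The dual lattice M in the coordinates adapted to the chart: psi x y is the
    element m with pairings x with u and y with o.  The points o + beta u and
    o + gamma u span the two rays of sigma, so that their pairings with m are
    positive multiples of the coordinates of m. *)
Record chart_coordinates (o u : 'rV[R]_2) (beta gamma : R)
    (psi : int -> int -> 'rV[int]_2) : Prop := ChartCoordinates {
  cc_add : forall x y x' y', psi (x + x') (y + y') = psi x y + psi x' y';
  cc_latt : forall x y, lattM (psi x y);
  cc_u : forall x y, pairing u (psi x y) = x%:~R;
  cc_o : forall x y, pairing o (psi x y) = y%:~R;
  cc_surj : forall m, lattM m -> exists x y, m = psi x y;
  cc_fst : forall x y, exists2 z : R, 0 < z &
    beta * x%:~R + y%:~R = z * (psi x y 0 0)%:~R;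
  cc_snd : forall x y, exists2 z : R, 0 < z &
    gamma * x%:~R + y%:~R = z * (psi x y 0 1)%:~R }.

Lemma lattNZ (c : int) v : lattN v -> lattN (c%:~R *: v).
Proof.
move=> [x [y [z ->]]]; exists (c * x), (c * y), (c * z).
by apply: row2_eq; rewrite !mxE /= !rmorphM /=; ring.
Qed.

Lemma lattND v v' : lattN v -> lattN v' -> lattN (v + v').
Proof.
move=> [x [y [z ->]]] [x' [y' [z' ->]]]; exists (x + x'), (y + y'), (z + z').
by apply: row2_eq; rewrite !mxE /= !rmorphD /=; ring.
Qed.

Lemma lattNB v v' : lattN v -> lattN v' -> lattN (v - v').
Proof.
move=> h h'; apply: lattND => //; have := lattNZ (-1) h'.
by rewrite rmorphN1 scaleN1r.
Qed.

Lemma lattN_unit (x y : int) : lattN (rowv 2 [:: x%:~R; y%:~R]).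
Proof. by exists x, y, 0; rewrite scale0r addr0. Qed.

Variables (w1 wh we : 'rV[int]_2) (o u : 'rV[R]_2) (beta gamma : R).
Hypothesis n0 : (0 < n)%N.
Hypothesis w1E : w1 = rowv 2 [:: n%:Z; 0].
Hypothesis weE : we = rowv 2 [:: 0; n%:Z].
Hypothesis wh_latt : lattM wh.
Hypothesis chart : segment_chart n q w1 wh we o u beta gamma.
Hypothesis le_bg : beta <= gamma.

Lemma chart_o : lattN o /\ pairing o wh = 1.
Proof. by case: chart => h _ _ _; apply/h; exists 0; rewrite scale0r addr0. Qed.

Lemma chart_u : lattN u /\ pairing u wh = 0.
Proof.
have [No o1] := chart_o; case: chart => h _ _ _.
have [Nou ou1] : lattN (o + u) /\ pairing (o + u) wh = 1.
  by apply/h; exists 1; rewrite scale1r.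
split; first by have := lattNB Nou No; rewrite addrC addKr.
by move: ou1; rewrite pairingDl o1 -[RHS]addr0 => /addrI.
Qed.

(** If v pairs with wh to z, then v - (z - 1) o is a lattice point of the line
    of the chart. *)
Lemma chart_span v : lattN v -> exists x y : int, v = x%:~R *: o + y%:~R *: u.
Proof.
move=> Nv; have [No o1] := chart_o; case: chart => h _ _ _.
have /intrP[z zE] := wh_latt Nv.
have /h[j jE] : lattN (v - (z - 1)%:~R *: o) /\ pairing (v - (z - 1)%:~R *: o) wh = 1.
  split; first by apply: lattNB => //; apply: lattNZ.
  by rewrite pairingDl -scaleNr pairingZl o1 zE rmorphB /=; ring.
exists z, j; rewrite -(subrK ((z - 1)%:~R *: o) v) jE rmorphB /= scalerBl scale1r.
by rewrite addrAC addrCA subrr addr0.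
Qed.

(** u is nonzero, for otherwise every parameter would give the point o of sigma,
    whereas the parameters of the points of sigma are bounded. *)
Lemma chart_free x y : x *: o + y *: u = 0 -> x = 0 /\ y = 0.
Proof.
move=> h; have [_ o1] := chart_o; have [_ u0] := chart_u.
have x0 : x = 0.
  have := congr1 (fun v => pairing v wh) h.
  rewrite pairingDl !pairingZl o1 u0 mulr0 mulr1 addr0 => ->.
  by rewrite /pairing big1 // => j _; rewrite mxE mul0r.
split=> //; move/eqP: h; rewrite x0 scale0r add0r scaler_eq0 => /orP[/eqP //|/eqP uz].
case: chart => _ hs _ _.
have : sigma (o + beta *: u) by apply/hs; rewrite lexx le_bg.
rewrite uz scaler0 addr0 => so.
have := (hs (gamma + 1)).1; rewrite uz scaler0 addr0 => /(_ so) /andP[_].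
by rewrite gerDl ler10.
Qed.

(** A point of sigma on one of the axes, nonzero because wh takes the value 1 on
    it. *)
Lemma chart_ray (x : R) (j0 : bool) : beta <= x <= gamma ->
  (o + x *: u) 0 (if j0 then 0 else 1) = 0 ->
  exists2 z : R, 0 < z & forall m,
    pairing (o + x *: u) m = z * (m 0 (if j0 then 1 else 0))%:~R.
Proof.
move=> hx z0; case: chart => _ hs _ _.
have /sigmaP[s0 s1] : sigma (o + x *: u) by apply/hs.
have [_ o1] := chart_o; have [_ u0] := chart_u.
have v1 : pairing (o + x *: u) wh = 1 by rewrite pairingDl pairingZl o1 u0 mulr0 addr0.
move: z0 s0 s1 v1; set v := o + x *: u.
case: j0 => z0 s0 s1 v1.
  exists (v 0 1); last by move=> m; rewrite pairing2 z0 mul0r add0r.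
  rewrite lt0r s1 andbT; apply/eqP => vz; move: v1; rewrite pairing2 z0 vz !mul0r addr0.
  by move/eqP; rewrite eq_sym oner_eq0.
exists (v 0 0); last by move=> m; rewrite pairing2 z0 mul0r addr0.
rewrite lt0r s0 andbT; apply/eqP => vz; move: v1; rewrite pairing2 z0 vz !mul0r addr0.
by move/eqP; rewrite eq_sym oner_eq0.
Qed.

Lemma chart_coordinates_exist :
  exists psi, chart_coordinates o u beta gamma psi.
Proof.
have nz : (n%:Z == 0) = false by apply/negbTE; lia.
have [k1 [j1 e1]] := chart_span (lattN_unit 1 0).
have [k2 [j2 e2]] := chart_span (lattN_unit 0 1).
have [No _] := chart_o; have [Nu _] := chart_u.
pose psi x y : 'rV[int]_2 := rowv 2 [:: k1 * y + j1 * x; k2 * y + j2 * x].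
have decomp (v : 'rV[R]_2) :
    v = (v 0 0 * k1%:~R + v 0 1 * k2%:~R) *: o +
        (v 0 0 * j1%:~R + v 0 1 * j2%:~R) *: u.
  transitivity (v 0 0 *: rowv 2 [:: 1%:~R; 0%:~R] + v 0 1 *: rowv 2 [:: 0%:~R; 1%:~R]).
    by apply: row2_eq; rewrite !mxE /= ?rmorph1 ?rmorph0; ring.
  rewrite e1 e2 !scalerDr !scalerA !scalerDl.
  by rewrite addrACA.
have pE (v : 'rV[R]_2) x y : pairing v (psi x y) =
    (v 0 0 * k1%:~R + v 0 1 * k2%:~R) * y%:~R + (v 0 0 * j1%:~R + v 0 1 * j2%:~R) * x%:~R.
  by rewrite pairing2 !row2E !rmorphD !rmorphM /=; ring.
have uniq2 c1 c2 d1 d2 : c1 *: o + c2 *: u = d1 *: o + d2 *: u -> c1 = d1 /\ c2 = d2.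
  move=> h; have [|h1 h2] := @chart_free (c1 - d1) (c2 - d2).
    by rewrite !scalerBl addrACA -opprD h subrr.
  by split; apply/eqP; rewrite -subr_eq0 ?h1 ?h2.
have po x y : pairing o (psi x y) = y%:~R.
  have [|h1 h2] := uniq2 (o 0 0 * k1%:~R + o 0 1 * k2%:~R)
      (o 0 0 * j1%:~R + o 0 1 * j2%:~R) 1 0.
    by rewrite -decomp scale1r scale0r addr0.
  by rewrite pE h1 h2 mul1r mul0r addr0.
have pu x y : pairing u (psi x y) = x%:~R.
  have [|h1 h2] := uniq2 (u 0 0 * k1%:~R + u 0 1 * k2%:~R)
      (u 0 0 * j1%:~R + u 0 1 * j2%:~R) 0 1.
    by rewrite -decomp scale1r scale0r add0r.
  by rewrite pE h1 h2 mul1r mul0r add0r.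
exists psi; split=> //.
- by move=> x y x' y'; apply: row2_eq; rewrite !mxE /=; ring.
- move=> x y v /chart_span[c [d ->]].
  by rewrite pairingDl !pairingZl po pu -!rmorphM -rmorphD /= intr_int.
- move=> m mM; have /intrP[x xE] := mM _ Nu; have /intrP[y yE] := mM _ No.
  exists x, y.
  have cmp k j (v : 'rV[R]_2) : v = k%:~R *: o + j%:~R *: u ->
      pairing v m = (k * y + j * x)%:~R.
    by move=> ->; rewrite pairingDl !pairingZl xE yE rmorphD !rmorphM.
  apply: row2_eq; rewrite row2E.
    have := cmp _ _ _ e1; rewrite pairing2 !row2E rmorph1 rmorph0 mul1r mul0r addr0.
    by move/eqP; rewrite eqr_int => /eqP.
  have := cmp _ _ _ e2; rewrite pairing2 !row2E rmorph1 rmorph0 mul1r mul0r add0r.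
  by move/eqP; rewrite eqr_int => /eqP.
- move=> x y; case: (chart) => _ _ hb _.
  have [||z z0 zE] := @chart_ray beta false; first by rewrite lexx le_bg.
    move/eqP: hb; rewrite weE pairing2 !row2E mulr0 add0r mulf_eq0.
    by rewrite intr_eq0 nz orbF => /eqP.
  exists z => //; rewrite -zE pairingDl pairingZl po pu.
  by rewrite addrC.
move=> x y; case: (chart) => _ _ _ hb.
have [||z z0 zE] := @chart_ray gamma true; first by rewrite lexx le_bg.
  move/eqP: hb; rewrite w1E pairing2 !row2E mulr0 addr0 mulf_eq0.
  by rewrite intr_eq0 nz orbF => /eqP.
exists z => //; rewrite -zE pairingDl pairingZl po pu.
by rewrite addrC.
Qed.

End Chart.

(** * The toric total space as a thickening *)

Section ToricFamily.
Variables (R : realType) (n q : nat).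
Local Notation k := R[i].
Local Notation monY := (monY R n q).
Local Notation lattM := (lattM R n q).
Variables (OY : comAlgType k) (chi : 'rV[int]_2 -> OY).
Hypothesis hY : monoid_algebra monY chi.
Variables (o u : 'rV[R]_2) (beta gamma : R) (psi : int -> int -> 'rV[int]_2).
Hypothesis cc : chart_coordinates n q o u beta gamma psi.

Lemma psi_inj x y x' y' : psi x y = psi x' y' -> x = x' /\ y = y'.
Proof.
move=> h; split; apply/eqP; rewrite -(eqr_int R).
  by rewrite -(cc_u cc x y) h (cc_u cc).
by rewrite -(cc_o cc x y) h (cc_o cc).
Qed.

Lemma psi0 : psi 0 0 = 0.
Proof. by have := cc_add cc 0 0 0 0; rewrite !addr0 -[LHS]addr0 => /addrI/esym. Qed.

Lemma psiMn x y m : psi (x *+ m) (y *+ m) = psi x y *+ m.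
Proof. by elim: m => [|m IH]; rewrite ?psi0 // !mulrS (cc_add cc) IH. Qed.

Lemma psi_monY x y : monY (psi x y) <->
  0 <= beta * x%:~R + y%:~R /\ 0 <= gamma * x%:~R + y%:~R.
Proof.
rewrite monYE; have [z z0 ->] := cc_fst cc x y; have [z' z0' ->] := cc_snd cc x y.
rewrite !pmulr_rge0 // !ler0z; split=> [[]//|[h h']].
by split=> //; apply: cc_latt cc _ _.
Qed.

(** The coordinates inverse to psi; the floor is the identity here, because the
    pairings of elements of M with u and o are integers. *)
Definition al (m : 'rV[int]_2) : int := Num.floor (pairing u m).
Definition be (m : 'rV[int]_2) : int := Num.floor (pairing o m).

Lemma al_psi x y : al (psi x y) = x.
Proof. by rewrite /al (cc_u cc) intrKfloor. Qed.

Lemma be_psi x y : be (psi x y) = y.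
Proof. by rewrite /be (cc_o cc) intrKfloor. Qed.

Lemma psiK m : lattM m -> psi (al m) (be m) = m.
Proof. by move=> /(cc_surj cc)[x [y ->]]; rewrite al_psi be_psi. Qed.

Variables (p : nat) (gamma0 gamma1 : R) (x0 y0 : int).
Hypothesis p0 : (0 < p)%N.
Hypothesis le_bg0 : beta <= gamma0.
Hypothesis ge0_g1 : 0 <= gamma1.
Hypothesis g01 : gamma0 + gamma1 = gamma.
Variables (OZ : comAlgType k) (chi' : 'rV[int]_3 -> OZ) (i : {lrmorphism OZ -> OY}).
Local Notation Q := ((beta, gamma0), (0, gamma1)).
Hypothesis hZ : toric_embedding o u p Q n q chi chi' i.
Local Notation P3 := (dual_cone (sigma' p Q)).
Local Notation c3 x y z := (rowv 3 [:: x : int; y : int; z : int]).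

Lemma P3E x y z : P3 (c3 x y z) <->
  [/\ 0 <= beta * x%:~R + y%:~R :> R, 0 <= gamma0 * x%:~R + y%:~R :> R,
      (0 <= z) & 0 <= gamma1 / p%:R * x%:~R + z%:~R :> R].
Proof.
rewrite /sigma' dual_coneP /=; split=> [h|[h1 h2 h3 h4] v].
  split.
  - have := h (rowv 3 [:: beta; 1; 0]); rewrite !inE eqxx => /(_ isT).
    by rewrite pairing3 !row3E mul1r mul0r addr0.
  - have := h (rowv 3 [:: gamma0; 1; 0]); rewrite !inE eqxx orbT => /(_ isT).
    by rewrite pairing3 !row3E mul1r mul0r addr0.
  - have := h (rowv 3 [:: 0 / p%:R; 0; 1]); rewrite !inE eqxx !orbT => /(_ isT).
    by rewrite pairing3 !row3E mul1r !mul0r !add0r ler0z.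
  - have := h (rowv 3 [:: gamma1 / p%:R; 0; 1]); rewrite !inE eqxx !orbT => /(_ isT).
    by rewrite pairing3 !row3E mul1r mul0r addr0.
rewrite !inE => /or4P[] /eqP ->; rewrite pairing3 !row3E ?mul1r ?mul0r ?addr0 ?add0r //.
by rewrite ler0z.
Qed.

Lemma P3_0 : P3 0. Proof. by move=> v _; rewrite pairing0r. Qed.
Lemma P3_D m m' : P3 m -> P3 m' -> P3 (m + m').
Proof. by move=> h h' v hv; rewrite pairingDr addr_ge0 ?h ?h'. Qed.

Lemma P3_n m l : P3 m -> P3 (m *+ l).
Proof.
by move=> hm; elim: l => [|l IH]; [apply: P3_0 | rewrite mulrS; apply: P3_D].
Qed.

Lemma chi'_algebra : monoid_algebra P3 chi'. Proof. by case: hZ. Qed.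

(** The exponent of the restriction of the monomial m' to Y. *)
Definition psi3 (m' : 'rV[int]_3) := psi (m' 0 0) (m' 0 1 + m' 0 2%:R *+ p).

Lemma psi3E x y z : psi3 (c3 x y z) = psi x (y + z *+ p).
Proof. by rewrite /psi3 !row3E. Qed.

Lemma psi3D m m' : psi3 (m + m') = psi3 m + psi3 m'.
Proof. by rewrite /psi3 -(cc_add cc) !mxE mulrnDl addrACA. Qed.

Lemma i_chi' m' : P3 m' -> i (chi' m') = chi (psi3 m').
Proof.
case: hZ => _ h hm; apply: h => //; first exact: cc_latt cc _ _.
move=> j; rewrite pairingDl pairingZl (cc_u cc) (cc_o cc) pairing3 !row3E.
by rewrite rmorphD rmorphMn /= -mulr_natl; ring.
Qed.

Lemma psi3_monY m' : P3 m' -> monY (psi3 m').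
Proof.
rewrite [m' in P3 m']row3P => /P3E[h1 h2 h3 h4]; apply/psi_monY.
have pp : (p%:R : R) != 0 by rewrite pnatr_eq0 -lt0n.
rewrite rmorphD rmorphMn /=; split.
  by rewrite addrA addr_ge0 // mulrn_wge0 // ler0z.
rewrite -g01 mulrDl addrACA; apply: addr_ge0 => //.
suff -> : gamma1 * (m' 0 0)%:~R + (m' 0 2%:R)%:~R *+ p =
  p%:R * (gamma1 / p%:R * (m' 0 0)%:~R + (m' 0 2%:R)%:~R) by apply: mulr_ge0.
by rewrite -mulr_natl; field.
Qed.

(** Two linear lifts of exponents from Y to Z.  The lift lpos stays in the monoid
    for x >= 0, and lneg does so for x <= 0 if x0, y0 are chosen suitably: in the
    applications they turn one of the facet inequalities into an equality. *)
Definition lneg (x y : int) := c3 x (y - (x0 * x + y0 * y) *+ p) (x0 * x + y0 * y).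
Definition lpos (x y : int) := c3 x y 0.

Hypothesis lneg_P3 : forall x y, x <= 0 -> 0 <= beta * x%:~R + y%:~R ->
  0 <= gamma * x%:~R + y%:~R -> P3 (lneg x y).

Lemma lpos_P3 x y : 0 <= x -> 0 <= beta * x%:~R + y%:~R -> P3 (lpos x y).
Proof.
move=> x1 h; apply/P3E; split=> //.
  apply: le_trans h _; rewrite lerD2r; apply: ler_wpM2r => //; rewrite ler0z //.
by rewrite addr0 mulr_ge0 ?ler0z // divr_ge0.
Qed.

Lemma lnegD x y x' y' : lneg (x + x') (y + y') = lneg x y + lneg x' y'.
Proof.
have E : x0 * (x + x') + y0 * (y + y') = (x0 * x + y0 * y) + (x0 * x' + y0 * y') by ring.
by rewrite /lneg E; apply: row3_eq; rewrite !mxE /= // mulrnDl; ring.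
Qed.

Lemma lposD x y x' y' : lpos (x + x') (y + y') = lpos x y + lpos x' y'.
Proof. by apply: row3_eq; rewrite !mxE /=. Qed.

(** The cone is glued from two linear pieces along x = 0, and a monomial is
    lifted by the piece to which its exponent belongs. *)
Definition lift_exp (m : 'rV[int]_2) : 'rV[int]_3 :=
  if 0 <= al m then lpos (al m) (be m) else lneg (al m) (be m).

Lemma psi3_lneg x y : psi3 (lneg x y) = psi x y.
Proof. by rewrite psi3E subrK. Qed.

Lemma psi3_lpos x y : psi3 (lpos x y) = psi x y.
Proof. by rewrite psi3E mul0rn addr0. Qed.

Lemma monY_ineq m : monY m -> 0 <= beta * (al m)%:~R + (be m)%:~R /\
  0 <= gamma * (al m)%:~R + (be m)%:~R.
Proof. by move=> hm; apply/psi_monY; rewrite psiK //; case/monYE: hm. Qed.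

Lemma lift_P3 m : monY m -> P3 (lift_exp m).
Proof.
move=> /monY_ineq[h1 h2]; rewrite /lift_exp; case: leP => h; first exact: lpos_P3.
by apply: lneg_P3 => //; apply: ltW.
Qed.

Lemma lift_psi3 m : monY m -> psi3 (lift_exp m) = m.
Proof.
move=> /monYE[hm _ _]; rewrite /lift_exp.
by case: ifP => _; rewrite (psi3_lneg, psi3_lpos) psiK.
Qed.

Local Notation tT := (chi' (c3 0 0 1)).
Local Notation tU := (chi' (c3 0 1 0)).
Definition par : OZ := chi' (rowv 3 [:: 0; 0; 1]) - chi' (rowv 3 [:: 0; p%:Z; 0]).

Lemma P3_T : P3 (c3 0 0 1).
Proof. by apply/P3E; rewrite !mulr0 !add0r. Qed.

Lemma P3_y y : 0 <= y -> P3 (c3 0 y 0).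
Proof. by move=> h; apply/P3E; rewrite !mulr0 !add0r !ler0z. Qed.

Lemma c3_n x y z m : c3 x y z *+ m = c3 (x *+ m) (y *+ m) (z *+ m).
Proof. by apply: row3_eq; rewrite mulmxnE !row3E. Qed.

Lemma chi'_n m l : P3 m -> chi' (m *+ l) = chi' m ^+ l.
Proof.
move=> hm; elim: l => [|l IH]; first by rewrite mulr0n (chi0 chi'_algebra).
by rewrite mulrS exprS (chiD chi'_algebra) ?IH //; apply: P3_n.
Qed.

Lemma parE : par = tT - tU ^+ p.
Proof.
rewrite /par -chi'_n; last exact: P3_y.
by rewrite c3_n !mul0rn natz.
Qed.

(** Monomials with the same restriction to Y differ by powers of V / U^p, where
    V and U^p are the two terms of lambda. *)
Lemma same_image_divisible_le x y y' z z' : P3 (c3 x y z) -> P3 (c3 x y' z') ->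
  y + z *+ p = y' + z' *+ p -> z' <= z ->
  exists c, chi' (c3 x y z) - chi' (c3 x y' z') = par * c.
Proof.
move=> h h' e le_z; pose l := absz (z - z').
have zE : z = z' + l%:Z by rewrite /l; lia.
have yE : y' = y + l%:Z *+ p.
  by move: e; rewrite zE mulrnDl addrCA addrC => /addIr/esym; rewrite addrC.
have hb : P3 (c3 x y z').
  by move/P3E: h => [? ? ? ?]; move/P3E: h' => [? ? ? ?]; apply/P3E.
have -> : c3 x y z = c3 x y z' + c3 0 0 1 *+ l.
  by rewrite c3_n; apply: row3_eq; rewrite !mxE /= ?mul0rn ?addr0 // zE natz.
have -> : c3 x y' z' = c3 x y z' + c3 0 p%:Z 0 *+ l.
  rewrite c3_n; apply: row3_eq; rewrite !mxE /= ?mul0rn ?addr0 // yE.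
  by rewrite -!natz -!mulrnA mulnC.
rewrite !(chiD chi'_algebra) //; try exact: P3_n P3_T; try exact: P3_n (P3_y _).
rewrite !chi'_n; try exact: P3_T; try exact: P3_y.
rewrite -mulrBr subrXX mulrCA; eexists; reflexivity.
Qed.

Lemma same_image_divisible m m' : P3 m -> P3 m' -> psi3 m = psi3 m' ->
  exists c, chi' m - chi' m' = par * c.
Proof.
rewrite (row3P m) (row3P m') => h h'; rewrite !psi3E => /psi_inj[ex e].
rewrite ex in h *.
have [le_z|/ltW le_z] := lerP (m' 0 2%:R) (m 0 2%:R).
  exact: same_image_divisible_le.
have [c cE] := same_image_divisible_le h' h (esym e) le_z.
by exists (- c); rewrite mulrN -cE opprB.
Qed.

Lemma i_par : i par = 0.
Proof.
rewrite /par lrmB !i_chi'; [|exact: P3_y|exact: P3_T].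
by rewrite !psi3E mul0rn addr0 add0r natz subrr.
Qed.

Definition sec := projT1 (chi_linear_ext hY (fun m => chi' (lift_exp m))).

Lemma sec_chi m : monY m -> sec (chi m) = chi' (lift_exp m).
Proof. by rewrite /sec; case: chi_linear_ext => F /= h /h. Qed.

Lemma secK y : i (sec y) = y.
Proof.
elim/(chi_ind hY): y => [m hm||b b' h h'|c b h].
- by rewrite sec_chi // i_chi' ?lift_psi3 //; apply: lift_P3.
- by rewrite raddf0 lrm0.
- by rewrite raddfD lrmD h h'.
- by rewrite linearZ /= lrmZ h.
Qed.

(** Both b and the section of its restriction have the same restriction, and it
    suffices to compare them monomial by monomial. *)
Lemma sec_divisible b : exists c, b - sec (i b) = par * c.
Proof.
elim/(chi_ind chi'_algebra): b => [m hm||b b' [c h] [c' h']|c b [d h]].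
- rewrite i_chi' // sec_chi; last exact: psi3_monY.
  have hm' := psi3_monY hm.
  by apply: same_image_divisible; rewrite ?lift_psi3 //; apply: lift_P3.
- by exists 0; rewrite lrm0 raddf0 subrr mulr0.
- by exists (c + c'); rewrite lrmD raddfD /= mulrDr -h -h' opprD addrACA.
- by exists (c *: d); rewrite lrmZ linearZ /= -scalerBr h scalerAr.
Qed.

Lemma par_ker b : i b = 0 -> exists c, b = par * c.
Proof.
by move=> h; have [c] := sec_divisible b; rewrite h raddf0 subr0 => ->; exists c.
Qed.

(** If V b = U^p b, the coefficients of b are constant along the direction
    V / U^p, which leaves every finite set. *)
Lemma par_reg b : par * b = 0 -> b = 0.
Proof.
rewrite /par mulrBl => /eqP; rewrite subr_eq0 => /eqP h.
pose r1 : 'rV[int]_3 := rowv 3 [:: 0; 0; 1]; pose r0 : 'rV[int]_3 := rowv 3 [:: 0; p%:Z; 0].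
pose cf m := ccoef chi'_algebra m b.
have step m : cf m = cf (m + (r1 - r0)).
  have := congr1 (ccoef chi'_algebra (m + r1)) h.
  rewrite !(ccoef_chiM chi'_algebra P3_D); [|exact: P3_y|exact: P3_T].
  by rewrite addrK -addrA.
have steps m N : cf m = cf (m + (r1 - r0) *+ N).
  elim: N => [|N ->]; first by rewrite addr0.
  by rewrite mulrSr addrA -step.
have [M hM] : exists M : int, forall x, x \in csupp chi'_algebra b -> x 0 2%:R < M.
  elim: (csupp chi'_algebra b) => [|x r [M hM]]; first by exists 0.
  exists (Num.max M (x 0 2%:R + 1)) => y; rewrite inE lt_max => /orP[/eqP ->|/hM ->//].
  by rewrite ltrDl ltr01 orbT.
apply: (ccoef_eq (hB := chi'_algebra)) => m; rewrite ccoef0 -/(cf m).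
pose mz : int := (m : 'rV[int]_3) 0 2%:R.
pose N := absz (M - mz); rewrite (steps m N).
apply: ccoef_out; apply/negP => /hM lt.
have {lt} : mz + N%:Z < M.
  by move: lt; rewrite mxE mulmxnE !mxE /= subr0 natz.
rewrite /N; lia.
Qed.

Definition toric_thickening : thickening OY :=
  Thickening secK i_par par_ker par_reg.

(** The weight of a monomial on Z is that of its restriction to Y; both terms of
    lambda then have the same weight. *)
Lemma weight_endo_exists : exists th : {lrmorphism OZ -> OZ},
  forall m', P3 m' -> weight_vector th (total_degree (psi3 m')) (chi' m').
Proof.
pose ps (m' : 'rV[int]_3) : OZ := (2%:R : k) ^+ total_degree (psi3 m') *: chi' m'.
have ps0 : ps 0 = 1.
  by rewrite /ps /psi3 !mxE mul0rn addr0 psi0 /total_degree !mxE (chi0 chi'_algebra) scale1r.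
have psD m m' : P3 m -> P3 m' -> ps (m + m') = ps m * ps m'.
  move=> hm hm'; rewrite /ps psi3D (total_degreeD (psi3_monY hm) (psi3_monY hm')).
  by rewrite (chiD chi'_algebra) // exprD -scalerAl -scalerAr scalerA.
have [th thE] := chi_lrmorphism_ext chi'_algebra P3_D P3_0 ps0 psD.
by exists th => m' hm; rewrite /weight_vector thE.
Qed.

Variable th : {lrmorphism OZ -> OZ}.
Hypothesis thE : forall m', P3 m' -> weight_vector th (total_degree (psi3 m')) (chi' m').

Lemma th_graded z : weight_sum th z.
Proof.
elim/(chi_ind chi'_algebra): z => [m hm||b b' h h'|c b h].
- exact: weight_sum_wv (thE hm).
- by exists [::]; rewrite ?big_nil.
- exact: weight_sumD.
- rewrite -mulr_algl; apply: weight_sumM => //.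
  exact: weight_sum_wv (wv1 _ c).
Qed.

Lemma psi01_monY : monY (psi 0 1).
Proof. by apply/psi_monY; rewrite !mulr0 !add0r; split; apply: ler01. Qed.

Lemma th_par_weight : weight_vector th (p * total_degree (psi 0 1)) par.
Proof.
have E : psi 0 (p%:Z) = psi 0 1 *+ p by rewrite -psiMn mul0rn natz.
have E2 : (p * total_degree (psi 0 1))%N = total_degree (psi 0 p%:Z).
  by rewrite E (total_degree_n p psi01_monY) mulnC.
rewrite /par E2; apply: wvD.
  by have := thE P3_T; rewrite psi3E add0r natz.
rewrite -scaleN1r; apply: wvZ.
by have := thE (P3_y (y := p%:Z) isT); rewrite psi3E mul0rn addr0.
Qed.

Lemma th_chi'_lift m : monY m -> weight_vector th (total_degree m) (chi' (lift_exp m)).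
Proof. by move=> hm; rewrite -{1}(lift_psi3 hm); apply/thE/lift_P3. Qed.

End ToricFamily.

(** The polynomial with coefficients s^(pl) = binomial (D, l) lam^l and
    s^(m) = 0 for p not dividing m is a binomial power, times the power of U
    needed to reach degree N. *)
Lemma binomial_fill (B : comNzRingType) (U lam : B) (p D N : nat) :
  (0 < p)%N -> (p * D <= N)%N ->
  \sum_(0 <= l < N.+1) U ^+ (N - l) *
     (if (p %| l)%N then lam ^+ (l %/ p) *+ 'C(D, l %/ p) else 0) =
  U ^+ (N - p * D) * (U ^+ p + lam) ^+ D.
Proof.
move=> p0 pD; rewrite exprDn mulr_sumr.
have bE l : (if (p %| l)%N then lam ^+ (l %/ p) *+ 'C(D, l %/ p) else 0) =
    \sum_(m < D.+1 | (p * m == l)%N) lam ^+ m *+ 'C(D, m).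
  case: ifP => [/dvdnP[m ->]|nd]; last first.
    rewrite big1 // => m /eqP ml; by rewrite -ml dvdn_mulr in nd.
  rewrite mulnK //.
  have cE (m' : 'I_D.+1) : (p * m' == m * p)%N = (m' == m :> nat).
    by rewrite mulnC eqn_pmul2r.
  under eq_bigl do rewrite cE.
  have [mD|mD] := ltnP m D.+1.
    by rewrite (big_pred1 (Ordinal mD)) // => m'; rewrite -val_eqE.
  rewrite bin_small // mulr0n big1 // => m' /eqP m'E.
  by have := ltn_ord m'; rewrite m'E ltnNge mD.
under eq_bigr do rewrite bE mulr_sumr.
rewrite big_mkord (exchange_big_dep predT) //=; apply: eq_bigr => m _.
have pm : (p * m < N.+1)%N.
  by rewrite ltnS; apply: leq_trans pD; rewrite leq_mul2l -ltnS ltn_ord orbT.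
rewrite (big_pred1 (Ordinal pm)) => [|l]; last by rewrite eq_sym.
rewrite -[in RHS]exprM mulrnAr mulrnAr mulrA -exprD; congr (U ^+ _ * _ *+ _).
have := ltn_ord m; rewrite ltnS => mD.
have : (p * m <= p * D)%N by rewrite leq_mul2l mD orbT.
rewrite /= mulnBr; lia.
Qed.

(** * The neighbours of the chosen generator *)

Section Neighbours.
Variables (R : realType) (n q : nat).
Hypothesis hn : (3 <= n)%N.
Hypothesis hnq : coprime n q.
Hypothesis hq : (0 < q < n - 1)%N.
Variables (a : seq nat) (w : nat -> 'rV[int]_2).
Hypothesis ha : hj_expansion n q a.
Hypothesis hw : hilbert_basis R n q a w.
Local Notation e := (embdim a).
Local Notation aa := (coefa a).
Local Notation monY := (monY R n q).
Variables (o u : 'rV[R]_2) (beta gamma : R) (psi : int -> int -> 'rV[int]_2).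
Hypothesis cc : chart_coordinates n q o u beta gamma psi.
Hypothesis le_bg : beta <= gamma.
Variable h : nat.
Hypothesis hh : (1 < h < e)%N.
Hypothesis hpsi : w h = psi 0 1.
Local Notation A i := (al u (w i)).
Local Notation B i := (be o (w i)).

Lemma w_psi i : (1 <= i <= e)%N -> w i = psi (A i) (B i).
Proof. by move=> hi; rewrite (psiK cc) //; case: (w_monY hw hi). Qed.

Lemma w_psi_recurrence i : (1 < i < e)%N ->
  A i.-1 + A i.+1 = A i *+ aa i /\ B i.-1 + B i.+1 = B i *+ aa i.
Proof.
clear hn hnq hq ha le_bg hh hpsi => hi; have := w_recurrence hw hi.
have h0 : (1 <= i <= e)%N by lia.
have hm : (1 <= i.-1 <= e)%N by lia.
have hp : (1 <= i.+1 <= e)%N by lia.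
rewrite {1}(w_psi hm) {1}(w_psi hp) {1}(w_psi h0).
rewrite -(psiMn cc) -(cc_add cc); exact: (psi_inj cc).
Qed.

Lemma A_mid : A h = 0. Proof. by rewrite hpsi (al_psi cc). Qed.
Lemma B_mid : B h = 1. Proof. by rewrite hpsi (be_psi cc). Qed.

Lemma A_last : 0 < A e.
Proof.
have e4 := embdim_ge4 hn hnq hq ha.
have wE := @w_psi e ltac:(lia).
have [z z0] := cc_fst cc (A e) (B e); have [z' z0'] := cc_snd cc (A e) (B e).
rewrite -wE !(w_last hw) mulr0 => h2 h1.
have h3 : 0 < (gamma - beta) * (A e)%:~R.
  rewrite mulrBl; have -> : gamma * (A e)%:~R - beta * (A e)%:~R =
     (gamma * (A e)%:~R + (B e)%:~R) - (beta * (A e)%:~R + (B e)%:~R) by ring.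
  by rewrite h1 h2 subr0 mulr_gt0 // ltr0z; lia.
rewrite ltNge; apply/negP => Ae; move: h3; rewrite ltNge => /negP[].
by apply: mulr_ge0_le0; rewrite ?subr_ge0 // lerz0.
Qed.

(** The A i satisfy the recurrence and vanish at h, so they are multiples of
    A h.+1 with constant signs on both sides of h.  Since the w i generate the
    monoid and the monoid contains some psi 1 y, that common divisor is 1. *)
Lemma A_sequence : [/\ A h.+1 = 1, A h.-1 = -1,
    forall i, (h < i <= e)%N -> 0 < A i & forall i, (1 <= i < h)%N -> A i < 0].
Proof.
have [d0 dm dp dn dv] := two_sided_sequence (f := fun i => A i)
  (fun i hi => (w_psi_recurrence hi).1) (coefa_ge2 ha) hh A_mid A_last.
have d1 : A h.+1 = 1.
  (* y is large enough for psi 1 y to lie in the monoid *)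
  pose y := Num.ceil (`|beta| + `|gamma|).
  have yP : `|beta| + `|gamma| <= y%:~R :> R by apply: ceil_ge.
  have Pm : monY (psi 1 y).
    apply/(psi_monY cc); rewrite !mulr1; split.
      have := ler_norm (- beta); rewrite normrN; have := normr_ge0 gamma; lra.
    have := ler_norm (- gamma); rewrite normrN; have := normr_ge0 beta; lra.
  have gen : forall m, monY m -> exists c, al u m = A h.+1 * c.
    apply: (w_generate hw (Q := fun m => exists c, al u m = A h.+1 * c)).
      by exists 0; rewrite -(psi0 cc) (al_psi cc) mulr0.
    move=> i m hi hm [c cE]; have [c' c'E] := dv i hi.
    exists (c' + c); rewrite (w_psi hi) -(psiK cc (m := m)); last by case: hm.
    by rewrite -(cc_add cc) (al_psi cc) c'E cE mulrDr.
  have [c] := gen _ Pm; rewrite (al_psi cc) => cE.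
  have : (absz (A h.+1) %| 1)%N.
    apply/dvdnP; exists (absz c); rewrite -abszM mulrC -cE //.
  by rewrite dvdn1; lia.
by split=> //; rewrite dm d1.
Qed.

Lemma B_neighbours : B h.-1 + B h.+1 = (aa h)%:Z.
Proof. by have [_ ->] := w_psi_recurrence hh; rewrite B_mid natz. Qed.

Lemma w_prev : w h.-1 = psi (-1) (B h.-1).
Proof. by rewrite {1}w_psi; [case: A_sequence => _ -> | lia]. Qed.

Lemma w_next : w h.+1 = psi 1 (B h.+1).
Proof. by rewrite {1}w_psi; [case: A_sequence => -> | lia]. Qed.

(** B h.-1 is the least integer b >= gamma, that is the least b for which
    psi (-1) b lies in the monoid: otherwise w h.-1 - w h would be in the
    monoid. *)
Lemma B_prev_bounds : gamma <= (B h.-1)%:~R < gamma + 1.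
Proof.
have Pm : monY (w h.-1) by apply: (w_monY hw); lia.
apply/andP; split.
  by move: Pm; rewrite w_prev => /(psi_monY cc)[_]; rewrite (be_psi cc) mulrN1; lra.
rewrite ltNge; apply/negP => hB.
have wE : w h.-1 - w h *+ 1 = psi (-1) (B h.-1 - 1).
  by rewrite mulr1n hpsi {1}w_prev; apply/eqP; rewrite subr_eq -(cc_add cc) addr0 subrK.
have [] := @w_separated _ _ _ hn hnq hq _ _ ha hw h.-1 h 1 ltac:(lia) hh isT; last lia.
rewrite wE; apply/(psi_monY cc); rewrite !mulrN1 intrB.
split; last by lra.
by rewrite addrC subr_ge0; apply: le_trans le_bg _; rewrite lerBrDr.
Qed.

Lemma B_next_bounds : - beta <= (B h.+1)%:~R < - beta + 1.
Proof.
have Pm : monY (w h.+1) by apply: (w_monY hw); lia.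
apply/andP; split.
  by move: Pm; rewrite w_next => /(psi_monY cc)[]; rewrite (be_psi cc) mulr1; lra.
rewrite ltNge; apply/negP => hB.
have wE : w h.+1 - w h *+ 1 = psi 1 (B h.+1 - 1).
  by rewrite mulr1n hpsi {1}w_next; apply/eqP; rewrite subr_eq -(cc_add cc) addr0 subrK.
have [] := @w_separated _ _ _ hn hnq hq _ _ ha hw h.+1 h 1 ltac:(lia) hh isT; last lia.
rewrite wE; apply/(psi_monY cc); rewrite !mulr1 intrB.
have b0 : 0 <= beta + ((B h.+1)%:~R - 1%:~R) by lra.
by split=> //; apply: le_trans b0 _; rewrite lerD2r.
Qed.

(** Equality would mean that w h.-1 lies on the ray of w 1. *)
Lemma B_prev_strict : (2 < h)%N -> gamma < (B h.-1)%:~R.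
Proof.
move=> h2; have /andP[le _] := B_prev_bounds; rewrite lt_neqAle le andbT.
apply/eqP => gE; have [z z0] := cc_snd cc (-1) (B h.-1).
rewrite -w_prev -gE mulrN1 addNr => /esym/eqP.
rewrite mulf_eq0 gt_eqF //= intr_eq0.
by have := @w_snd_gt0 _ _ _ hn hnq hq _ _ ha hw h.-1 ltac:(lia); lia.
Qed.

(** Equality would mean that w h.+1 lies on the ray of w e. *)
Lemma B_next_strict : (h < e.-1)%N -> - beta < (B h.+1)%:~R.
Proof.
move=> h2; have /andP[le _] := B_next_bounds; rewrite lt_neqAle le andbT.
apply/eqP => gE; have [z z0] := cc_fst cc 1 (B h.+1).
rewrite -w_next -gE mulr1 subrr => /esym/eqP.
rewrite mulf_eq0 gt_eqF //= intr_eq0.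
by have := @w_fst_gt0 _ _ _ hn hnq hq _ _ ha hw h.+1 ltac:(lia); lia.
Qed.

(** The segment lies between the integers - B h.+1 and B h.-1, whose distance is
    a_h, and since e >= 4 at least one of its ends is in the interior. *)
Lemma length_lt_coefa : gamma - beta < (aa h)%:R.
Proof.
have e4 := embdim_ge4 hn hnq hq ha.
have /andP[g1 _] := B_prev_bounds; have /andP[b1 _] := B_next_bounds.
have -> : (aa h)%:R = (B h.-1)%:~R + (B h.+1)%:~R :> R.
  by rewrite -rmorphD B_neighbours.
have [h2|h2] := ltnP 2 h; first by have := B_prev_strict h2; lra.
by have := B_next_strict ltac:(lia); lra.
Qed.

End Neighbours.

(** * The toric family solves the Arndt equations *)

Section ToricPullback.
Variables (R : realType) (n q : nat).
Hypothesis hn : (3 <= n)%N.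
Hypothesis hnq : coprime n q.
Hypothesis hq : (0 < q < n - 1)%N.
Variables (a : seq nat) (w : nat -> 'rV[int]_2).
Hypothesis ha : hj_expansion n q a.
Hypothesis hw : hilbert_basis R n q a w.
Local Notation e := (embdim a).
Local Notation aa := (coefa a).
Local Notation monY := (monY R n q).
Local Notation k := R[i].
Variables (OY : comAlgType k) (chi : 'rV[int]_2 -> OY).
Hypothesis hY : monoid_algebra monY chi.
Variables (X : pointed_family OY) (s : nat -> nat -> fbase X) (t : nat -> fbase X).
Variable (x : nat -> ftotal X).
Hypothesis hX : arndt_family a w chi s t x.
Variables (o u : 'rV[R]_2) (beta gamma : R) (psi : int -> int -> 'rV[int]_2).
Hypothesis cc : chart_coordinates n q o u beta gamma psi.
Hypothesis le_bg : beta <= gamma.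
Variable h : nat.
Hypothesis hh : (1 < h < e)%N.
Hypothesis hpsi : w h = psi 0 1.
Local Notation A i := (al u (w i)).
Local Notation B i := (be o (w i)).

(* The two kinds of families are treated at once: bar is false for the first
   kind, with p and D = d, and true for the second, with p = 1 and
   D = d - 1. *)
Variables (p D : nat) (bar : bool) (gamma0 gamma1 : R) (x0 : int).
Local Notation y0 := (bar%:Z).
Hypothesis p0 : (0 < p)%N.
Hypothesis le_bg0 : beta <= gamma0.
Hypothesis ge0_g1 : 0 <= gamma1.
Hypothesis g01 : gamma0 + gamma1 = gamma.
Variables (OZ : comAlgType k) (chi' : 'rV[int]_3 -> OZ) (i : {lrmorphism OZ -> OY}).
Local Notation Q := ((beta, gamma0), (0, gamma1)).
Hypothesis hZ : toric_embedding o u p Q n q chi chi' i.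
Local Notation P3 := (dual_cone (sigma' p Q)).
Local Notation c3 x y z := (rowv 3 [:: x : int; y : int; z : int]).
Hypothesis lneg_P3 : forall x y, x <= 0 -> 0 <= beta * x%:~R + y%:~R ->
  0 <= gamma * x%:~R + y%:~R -> P3 (lneg p x0 y0 x y).
Hypothesis bar_p : bar -> p = 1%N.
Hypothesis bar_t : bar -> t_index a h.
Hypothesis hD : (p * D < aa h)%N.
(** The lift lneg of w h.-1 has D more factors V than that of w h. *)
Hypothesis hx0 : y0 * B h.-1 - x0 = D%:Z + y0.

Definition s_value (j l : nat) : {poly k} :=
  if (j == h) && (p %| l)%N then 'C(D, l %/ p)%:R *: 'X^(l %/ p) else 0.
Definition t_value (j : nat) : {poly k} := if bar && (j == h) then 'X else 0.

Let T := toric_thickening hY cc p0 le_bg0 ge0_g1 g01 hZ lneg_P3.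
Definition x_value (j : nat) : th_alg T := chi' (lift_exp o u p x0 y0 (w j)).
Local Notation lam := (par p chi').
Local Notation U := (chi' (c3 0 1 0)).
Local Notation V := (chi' (c3 0 0 1)).

Let hO3 : monoid_algebra P3 chi' := chi'_algebra hZ.

Let A_pos j : (h < j <= e)%N -> 0 < A j.
Proof. by case: (A_sequence hn hnq hq ha hw cc le_bg hh hpsi) => _ _ + _; apply. Qed.
Let A_neg j : (1 <= j < h)%N -> A j < 0.
Proof. by case: (A_sequence hn hnq hq ha hw cc le_bg hh hpsi) => _ _ _; apply. Qed.

Definition neg_exp j := lneg p x0 y0 (A j) (B j).
Definition pos_exp j := lpos (A j) (B j).

Lemma x_value_neg j : (1 <= j < h)%N -> x_value j = chi' (neg_exp j).
Proof. by move=> /A_neg; rewrite /x_value /lift_exp ltNge => /negPf ->. Qed.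

Lemma x_value_pos j : (h <= j <= e)%N -> x_value j = chi' (pos_exp j).
Proof.
rewrite leq_eqVlt => /andP[/orP[/eqP <-|hj] je].
  by rewrite /x_value /lift_exp /pos_exp (A_mid cc hpsi) lexx.
by rewrite /x_value /lift_exp ltW // A_pos // hj.
Qed.

Lemma pos_exp_mid : pos_exp h = c3 0 1 0.
Proof. by rewrite /pos_exp /lpos (A_mid cc hpsi) (B_mid cc hpsi). Qed.

Lemma x_value_mid : x_value h = U.
Proof. by rewrite x_value_pos ?pos_exp_mid //; lia. Qed.

(** The lifts of w h by lneg and lpos are V and U if bar holds. *)
Lemma neg_exp_mid : chi' (neg_exp h) = if bar then U + lam else U.
Proof.
rewrite /neg_exp /lneg (A_mid cc hpsi) (B_mid cc hpsi) mulr0 add0r mulr1.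
case: (boolP bar) => [/bar_p pE|_] /=; last by rewrite mul0rn subr0.
by rewrite (parE hZ) pE expr1 [RHS]addrC subrK mulr1n subrr.
Qed.

Lemma neg_P3 j : (1 <= j <= h)%N -> P3 (neg_exp j).
Proof.
move=> hj; have hj' : (1 <= j <= e)%N by lia.
have [h1 h2] := monY_ineq cc (w_monY hw hj').
apply: lneg_P3 => //.
case: (ltngtP j h) => jh; last by rewrite jh (A_mid cc hpsi).
  by apply/ltW/A_neg; lia.
by exfalso; lia.
Qed.

Lemma pos_P3 j : (h <= j <= e)%N -> P3 (pos_exp j).
Proof.
move=> hj; have hj' : (1 <= j <= e)%N by lia.
have [h1 h2] := monY_ineq cc (w_monY hw hj').
apply: (lpos_P3 le_bg0 ge0_g1) => //.
case: (ltngtP h j) => jh; last by rewrite -jh (A_mid cc hpsi).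
  by apply/ltW/A_pos; lia.
by exfalso; lia.
Qed.

(** The equation i involves x_h only for i = h or i = h + 1, where it must be
    lifted by lpos, and y_h only for i = h - 1 or i = h, where it must be
    lifted by lneg; t_h is the difference. *)
Lemma model_yE j : (1 <= j <= e)%N ->
  model_y a t_value x_value j = chi' (if (j <= h)%N then neg_exp j else pos_exp j).
Proof.
move=> hj; rewrite /model_y.
have [->|jh] := eqVneq j h.
  rewrite leqnn neg_exp_mid x_value_mid /t_value eqxx andbT.
  case: bar bar_t => [/(_ isT) ->|_]; first by rewrite poly_evalX.
  by case: ifP => _ //; rewrite (lrm0 (poly_eval _)) addr0.
have -> : t_value j = 0 by rewrite /t_value (negPf jh) andbF.
rewrite (lrm0 (poly_eval _)) addr0 if_same.
by case: leqP => jh'; [apply: x_value_neg | apply: x_value_pos]; lia.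
Qed.

Let wrec j (hj : (1 < j < e)%N) := w_psi_recurrence hw cc hj.

(** Linear lifts preserve w^(j-1) + w^(j+1) = a_j w^j, so that away from h the
    equations hold with all s equal to 0. *)
Lemma neg_exp_recurrence j : (1 < j < e)%N ->
  neg_exp j.-1 + neg_exp j.+1 = neg_exp j + neg_exp j *+ (aa j).-1.
Proof.
move=> hj; have [rA rB] := wrec hj; have ha2 := coefa_ge2 ha hj.
have lM m : lneg p x0 y0 (A j *+ m) (B j *+ m) = neg_exp j *+ m.
  elim: m => [|m IH]; last by rewrite !mulrS lnegD IH.
  by apply: row3_eq; rewrite !mxE /= ?mulr0 ?addr0 ?mul0rn ?subr0.
rewrite /neg_exp -lnegD rA rB lM -mulrS; congr (_ *+ _); lia.
Qed.

Lemma pos_exp_recurrence j : (1 < j < e)%N ->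
  pos_exp j.-1 + pos_exp j.+1 = pos_exp j + pos_exp j *+ (aa j).-1.
Proof.
move=> hj; have [rA rB] := wrec hj; have ha2 := coefa_ge2 ha hj.
have lM m : lpos (A j *+ m) (B j *+ m) = pos_exp j *+ m.
  elim: m => [|m IH]; last by rewrite !mulrS lposD IH.
  by apply: row3_eq; rewrite !mxE.
rewrite /pos_exp -lposD rA rB lM -mulrS; congr (_ *+ _); lia.
Qed.

(** In the equation h the two lifts meet, and D factors U^p are replaced by V. *)
Lemma mixed_recurrence : neg_exp h.-1 + pos_exp h.+1 =
  neg_exp h + (c3 0 1 0 *+ ((aa h).-1 - p * D) + c3 0 0 1 *+ D).
Proof.
have [A1 Am _ _] := A_sequence hn hnq hq ha hw cc le_bg hh hpsi.
have Bs := B_neighbours hw cc hh hpsi.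
rewrite /neg_exp /pos_exp /lneg /lpos A1 Am (A_mid cc hpsi) (B_mid cc hpsi) !c3_n.
have dE : x0 * -1 + y0 * B h.-1 = D%:Z + y0 by rewrite -hx0; ring.
rewrite dE mulr0 add0r mulr1.
have ha2 := coefa_ge2 ha hh.
have coord2 (b b' y : int) N : (p * D <= N)%N -> b + b' = N.+1%:Z ->
    b - (D%:Z + y) *+ p + b' = 1 - y *+ p + 1 *+ (N - p * D).
  move=> pD bE; have -> : b' = N.+1%:Z - b by rewrite -bE addrC addKr.
  rewrite -[(_ + _) *+ p]mulr_natr -[y *+ p]mulr_natr !natz -subzn // PoszM.
  by rewrite -addn1 PoszD; ring.
apply: row3_eq; rewrite !mxE /=.
- by rewrite !mul0rn addNr !addr0.
- rewrite mul0rn addr0; apply: coord2; first by lia.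
  by rewrite Bs; congr (Posz _); lia.
- by rewrite mul0rn add0r addr0 natz addrC.
Qed.

Lemma s_value_eval l : poly_eval lam (s_value h l) =
  if (p %| l)%N then lam ^+ (l %/ p) *+ 'C(D, l %/ p) else 0.
Proof.
rewrite /s_value eqxx /=; case: ifP => _; last exact: (lrm0 (poly_eval _)).
by rewrite (lrmZ (poly_eval _)) (lrmX (poly_eval _)) /= poly_evalX scaler_nat.
Qed.

(** At j = h the equation says x_(h-1) y_(h+1) = y_h U^(a_h - 1 - pD) V^D, and
    V = U^p + lambda. *)
Lemma model_equation j : (1 < j < e)%N ->
  x_value j.-1 * model_y a t_value x_value j.+1 = model_Z a s_value t_value x_value j.
Proof.
move=> hj; rewrite /model_Z !model_yE; try lia.
have neq0 : j <> h -> \sum_(1 <= l < aa j) x_value j ^+ ((aa j).-1 - l) *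
    poly_eval (th_par T) (s_value j l) = 0.
  move=> /eqP/negPf jh; apply: big1 => l _.
  by rewrite /s_value jh (lrm0 (poly_eval _)) mulr0.
have chiP m m' : P3 m -> P3 m' -> chi' m * chi' m' = chi' (m + m').
  by move=> hm hm'; rewrite (chiD hO3).
case: (ltngtP j h) => jh.
- rewrite neq0 ?addr0; last by lia.
  have Pj : P3 (neg_exp j) by apply: neg_P3; lia.
  have Pm : P3 (neg_exp j.-1) by apply: neg_P3; lia.
  have Pp : P3 (neg_exp j.+1) by apply: neg_P3; lia.
  rewrite !x_value_neg; try lia.
  rewrite -(chi'_n hZ _ Pj) !chiP // ?neg_exp_recurrence //.
  exact: P3_n.
- rewrite neq0 ?addr0; last by lia.
  have Pj : P3 (pos_exp j) by apply: pos_P3; lia.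
  have Pm : P3 (pos_exp j.-1) by apply: pos_P3; lia.
  have Pp : P3 (pos_exp j.+1) by apply: pos_P3; lia.
  rewrite !x_value_pos; try lia.
  rewrite -(chi'_n hZ _ Pj) !chiP // ?pos_exp_recurrence //.
  exact: P3_n.
rewrite jh; have ha2 := coefa_ge2 ha hh.
have Pj : P3 (neg_exp h) by apply: neg_P3; lia.
have Pm : P3 (neg_exp h.-1) by apply: neg_P3; lia.
have Pp : P3 (pos_exp h.+1) by apply: pos_P3; lia.
have PU : P3 (c3 0 1 0) by apply: (P3_y (gamma0 := gamma0)).
have PV : P3 (c3 0 0 1) by apply: (P3_T (gamma0 := gamma0)).
rewrite x_value_neg; last by lia.
rewrite chiP // mixed_recurrence -!chiP //; try (by apply: P3_n); last first.
  by apply: P3_D; apply: P3_n.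
rewrite x_value_mid !(chi'_n hZ) //; congr (_ * _).
have aE : ((aa h).-1.+1 = aa h)%N by lia.
have lamE : V = U ^+ p + lam by rewrite (parE hZ) addrC subrK.
rewrite lamE -binomial_fill //; last by lia.
rewrite aE big_ltn; last by lia.
rewrite dvdn0 div0n expr0 bin0 mulr1n mulr1 subn0; congr (_ + _).
by apply: eq_bigr => l _; rewrite s_value_eval.
Qed.

Lemma toric_arndt_solution : arndt_solution a w chi s_value t_value x_value.
Proof.
split=> [j hj|j l hj|j hj|]; last exact: model_equation.
- have hm := w_monY hw hj.
  rewrite /x_value /= (i_chi' cc hZ); last exact: (lift_P3 cc le_bg0 ge0_g1 lneg_P3).
  by rewrite (lift_psi3 cc).
- rewrite /s_value; case: ifP => [/andP[_ /dvdnP[m lE]]|_]; last by rewrite horner0.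
  case/andP: hj => _ /andP[l0 _].
  have m0 : (0 < m)%N by move: l0; rewrite lE; case: m {lE}.
  by rewrite lE mulnK // hornerZ hornerXn expr0n gtn_eqF // mulr0.
- rewrite /t_value; case: ifP => _; [exact: hornerX | exact: horner0].
Qed.

Lemma toric_arndt_pullback :
  exists (f : {lrmorphism fbase X -> {poly k}}) (F : {lrmorphism ftotal X -> OZ}),
    [/\ @is_pullback _ _ X (toric_family p chi' i) f F,
        forall j l, s_index a j l -> f (s j l) = s_value j l
      & forall j, t_index a j -> f (t j) = t_value j].
Proof.
have [th thE] := weight_endo_exists cc p0 g01 hZ.
pose wt j := total_degree (w j).
apply: (arndt_pullback (w_chain hn hnq hq ha hw) hY hX (T := T)
  toric_arndt_solution (wt := wt) (dg := (p * wt h)%N) (th := th)).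
- move=> j hj; have [h0 h1] := w_ge0 hw hj; split=> //.
  by rewrite /wt /total_degree gez0_abs // addr_ge0.
- rewrite muln_gt0 p0 /wt /total_degree absz_gt0 gt_eqF //.
  have hh1 : (1 <= h <= e)%N by lia.
  have [h0 _] := w_ge0 hw hh1; apply: ltr_wpDl => //.
  by apply: (w_snd_gt0 hn hnq hq ha hw); lia.
- exact: (th_graded hZ thE).
- rewrite /wt hpsi; exact: (th_par_weight cc thE).
- move=> j hj; apply: (th_chi'_lift cc le_bg0 ge0_g1 lneg_P3 thE).
  exact: (w_monY hw hj).
- move=> j l hj; rewrite /s_value; case: ifP => [/andP[/eqP -> /dvdnP[m lE]]|_].
    case/andP: hj => _ /andP[l0 _].
    have m0 : (0 < m)%N by move: l0; rewrite lE; case: m {lE}.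
    exists ('C(D, l %/ p)%:R), m.-1; rewrite lE mulnK // prednK //; split=> //.
    by right; rewrite mulnA mulnC.
  by exists 0, 0%N; rewrite scale0r; split=> //; left.
- move=> j hj; rewrite /t_value; case: ifP => [/andP[/bar_p pE /eqP ->]|_].
    by exists 1, 0%N; rewrite scale1r pE !mul1n; split=> //; right.
  by exists 0, 0%N; rewrite scale0r; split=> //; left.
Qed.

End ToricPullback.

(** * The two families of decompositions *)

Lemma num_lattice_points_interval (R : realType) (beta gamma : R) (lo : int) (N : nat) :
  (forall j : int, (beta <= j%:~R <= gamma) = (lo <= j < lo + N%:Z)) ->
  num_lattice_points beta gamma = N.
Proof.
move=> h; rewrite /num_lattice_points; apply: card_fset_set.
apply/card_set_bijP; exists (fun j : int => absz (j - lo)); split=> [j|j j'|m] /=.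
- by rewrite h; lia.
- rewrite !inE /= !h; lia.
move=> mN; exists (lo + m%:Z); last by lia.
by rewrite /= h; lia.
Qed.

(** The element w h is the one with pairing 0 with u and 1 with o. *)
Lemma chart_at_base (R : realType) (n q : nat) (w1 wh we : 'rV[int]_2)
  (o u : 'rV[R]_2) (beta gamma : R) :
  (0 < n)%N -> w1 = rowv 2 [:: n%:Z; 0] -> we = rowv 2 [:: 0; n%:Z] ->
  lattM R n q wh -> segment_chart n q w1 wh we o u beta gamma -> beta <= gamma ->
  exists2 psi, chart_coordinates n q o u beta gamma psi & wh = psi 0 1.
Proof.
move=> n0 w1E weE hM chart le_bg.
have [psi cc] := chart_coordinates_exist n0 w1E weE hM chart le_bg.
exists psi => //; have [x [y whE]] := cc_surj cc hM.
have [_ o1] := chart_o chart; have [_ u0] := chart_u chart.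
move: u0; rewrite whE (cc_u cc) => /eqP; rewrite intr_eq0 => /eqP ->.
move: o1; rewrite whE (cc_o cc) => /eqP; rewrite -[1]/(1%:~R) eqr_int => /eqP ->.
by [].
Qed.

Theorem proposition3p1 (R : realType) (n q : nat)
  (hn : (3 <= n)%N) (hnq : coprime n q) (hq : (0 < q < n - 1)%N)
  (a : seq nat) (ha : hj_expansion n q a)
  (w : nat -> 'rV[int]_2) (hw : hilbert_basis R n q a w)
  (OY : comAlgType R[i]) (chi : 'rV[int]_2 -> OY)
  (hY : monoid_algebra (monY R n q) chi)
  (X : pointed_family OY) (s : nat -> nat -> fbase X) (t : nat -> fbase X)
  (x : nat -> ftotal X) (hX : arndt_family a w chi s t x) :
  (forall (h p d : nat), (1 < h < embdim a)%N -> (0 < p)%N -> (0 < d)%N ->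
    forall (o u : 'rV[R]_2) (beta gamma : R),
      segment_chart n q (w 1%N) (w h) (w (embdim a)) o u beta gamma ->
      (d * p)%:R <= gamma - beta ->
    forall (OZ : comAlgType R[i]) (chi' : 'rV[int]_3 -> OZ)
      (i : {lrmorphism OZ -> OY}),
      toric_embedding o u p (dec p d beta gamma) n q chi chi' i ->
    exists (f : {lrmorphism fbase X -> {poly R[i]}})
           (F : {lrmorphism ftotal X -> OZ}),
      [/\ @is_pullback _ _ X (toric_family p chi' i) f F,
          forall l, (1 <= l <= d)%N ->
            s_index a h (p * l) /\ f (s h (p * l)%N) = 'C(d, l)%:R *: 'X^l,
          forall j m, s_index a j m ->
            ~ (j = h /\ exists2 l, (1 <= l <= d)%N & m = (p * l)%N) ->
            f (s j m) = 0
        & forall j, t_index a j -> f (t j) = 0])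
  /\
  (forall (h d : nat), (2 < h < (embdim a).-1)%N -> (1 <= d)%N ->
    forall (o u : 'rV[R]_2) (beta gamma : R),
      segment_chart n q (w 1%N) (w h) (w (embdim a)) o u beta gamma ->
      (d <= num_lattice_points beta gamma)%N ->
    forall (OZ : comAlgType R[i]) (chi' : 'rV[int]_3 -> OZ)
      (i : {lrmorphism OZ -> OY}),
      toric_embedding o u 1 (dec_bar d beta gamma) n q chi chi' i ->
    exists (f : {lrmorphism fbase X -> {poly R[i]}})
           (F : {lrmorphism ftotal X -> OZ}),
      [/\ @is_pullback _ _ X (toric_family 1 chi' i) f F,
          f (t h) = 'X /\
          forall l, (1 <= l <= d.-1)%N ->
            s_index a h l /\ f (s h l) = 'C(d.-1, l)%:R *: 'X^l,
          forall j m, s_index a j m ->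
            ~ (j = h /\ (1 <= m <= d.-1)%N) -> f (s j m) = 0
        & forall j, t_index a j -> j <> h -> f (t j) = 0]).
Proof.
have n0 : (0 < n)%N by lia.
have [_ w1E weE _] := hw.
split=> [h p d hh p0 d0 o u beta gamma chart hlen OZ chi' i hZ|
         h d hh d0 o u beta gamma chart hd OZ chi' i hZ].
  have le_bg : beta <= gamma by rewrite -subr_ge0; apply: le_trans hlen.
  have hM : lattM R n q (w h) by have [] : monY R n q (w h) by apply: (w_monY hw); lia.
  have [psi cc hpsi] := chart_at_base n0 w1E weE hM chart le_bg.
  have hlt := length_lt_coefa hn hnq hq ha hw cc le_bg hh hpsi.
  have hD : (p * d < coefa a h)%N.
    by rewrite -(ltr_nat R) mulnC; apply: le_lt_trans hlt.
  have hlen' : beta <= gamma - (p * d)%:R by rewrite mulnC lerBrDr -lerBrDl.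
  (* x0 = - d, y0 = 0: equality in the facet of the end p d of Q_1 *)
  have lP (x1 y1 : int) : x1 <= 0 -> 0 <= beta * x1%:~R + y1%:~R ->
      0 <= gamma * x1%:~R + y1%:~R ->
      dual_cone (sigma' p (dec p d beta gamma)) (lneg p (- d%:Z) false%:Z x1 y1).
    move=> x1le _ hg; rewrite /lneg mul0r addr0; apply/P3E.
    have x1r : x1%:~R <= 0 :> R by rewrite lerz0.
    have pR : (p%:R : R) != 0 by rewrite pnatr_eq0 -lt0n.
    have yE : (y1 - (- d%:Z * x1) *+ p)%:~R =
        y1%:~R + (p * d)%:R * x1%:~R :> R.
      by rewrite intrB rmorphMn /= intrM intrN natrM -mulr_natl -pmulrn; ring.
    split.
    - rewrite yE addrA addrAC -mulrDl.
      apply: le_trans hg _; rewrite lerD2r ler_wnM2r //.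
      by move: hlen'; rewrite lerBrDr.
    - by rewrite yE (_ : _ + _ = gamma * x1%:~R + y1%:~R) //; ring.
    - by rewrite mulNr oppr_ge0 pmulr_rle0 // ltz_nat.
    - rewrite mulNr rmorphN rmorphM /= -pmulrn natrM.
      by rewrite [p%:R * _]mulrC mulfK // subrr.
  have nobar (P : Prop) : false -> P by [].
  have hx0 : false%:Z * be o (w h.-1) - (- d%:Z) = d%:Z + false%:Z.
    by rewrite mul0r add0r opprK addr0.
  have [f [F [pb fs ft]]] := toric_arndt_pullback hn hnq hq ha hw hY hX cc le_bg hh hpsi
    (D := d) (bar := false) p0 hlen' (ler0n R (p * d)) (subrK _ _) hZ lP
    (nobar _) (nobar _) hD hx0.
  exists f, F; split=> // [l hl|j m hj hne].
  - have hs : s_index a h (p * l).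
      rewrite /s_index hh muln_gt0 p0 /=; have [l0 ld] := andP hl; rewrite l0 /=.
      by apply: leq_ltn_trans hD; rewrite leq_mul2l ld orbT.
    by split=> //; rewrite fs // /s_value eqxx dvdn_mulr //= mulKn.
  - rewrite fs // /s_value; case: ifP => // /andP[/eqP jh /dvdnP[l mE]].
    rewrite mE mulnK // bin_small ?scale0r // ltnNge; apply/negP => ld; apply: hne.
    split=> //; exists l; last by rewrite mulnC.
    rewrite ld andbT; case/andP: hj => _ /andP[m0 _].
    by move: m0; rewrite mE; case: l {ld mE}.
have hh' : (1 < h < embdim a)%N by lia.
have le_bg : beta <= gamma.
  rewrite leNgt; apply/negP => lt_gb.
  have E0 : num_lattice_points beta gamma = 0%N.
    apply: (@num_lattice_points_interval _ _ _ 0) => j.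
    have -> : (0 <= j < 0 + 0%:Z) = false by lia.
    by apply/negP => /andP[h1 h2]; have := le_trans h1 h2; rewrite leNgt lt_gb.
  by move: hd; rewrite E0; lia.
have hM : lattM R n q (w h) by have [] : monY R n q (w h) by apply: (w_monY hw); lia.
have [psi cc hpsi] := chart_at_base n0 w1E weE hM chart le_bg.
have Bs := B_neighbours hw cc hh' hpsi.
have /andP[_ Bm1] := B_prev_bounds hn hnq hq ha hw cc le_bg hh' hpsi.
have /andP[_ Bp1] := B_next_bounds hn hnq hq ha hw cc le_bg hh' hpsi.
have Bm0 := B_prev_strict hn hnq hq ha hw cc le_bg hh' hpsi ltac:(lia).
have Bp0 := B_next_strict hn hnq hq ha hw cc le_bg hh' hpsi ltac:(lia).
set bm := be o (w h.-1) in Bs Bm0 Bm1; set bp := be o (w h.+1) in Bs Bp0 Bp1.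
have ha2 := coefa_ge2 ha hh'.
(* the lattice points of the segment are those strictly between - bp and bm *)
have numE : num_lattice_points beta gamma = (coefa a h).-1.
  apply: (@num_lattice_points_interval _ _ _ (1 - bp)) => j.
  have -> : (1 - bp <= j < 1 - bp + (coefa a h).-1%:Z) = (- bp < j < bm) by lia.
  apply/idP/idP => /andP[h1 h2]; apply/andP; split.
  - by rewrite -(ltr_int R) intrN; apply: lt_le_trans h1; rewrite ltrNl.
  - by rewrite -(ltr_int R); apply: le_lt_trans Bm0.
  - have : (1 - bp)%:~R <= j%:~R :> R by rewrite ler_int; lia.
    apply: le_trans; rewrite intrB; apply/ltW; move: Bp1; lra.
  - have : j%:~R <= (bm - 1)%:~R :> R by rewrite ler_int; lia.
    move=> h3; apply: le_trans h3 _; rewrite intrB; apply/ltW; move: Bm1; lra.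
rewrite numE in hd.
(* x0 = c, y0 = 1: equality in the facet of the end c of Q_0 *)
pose c : int := Num.ceil (beta + (num_lattice_points beta gamma)%:R - d%:R).
have NR : (coefa a h).-1%:R = bm%:~R + bp%:~R - 1 :> R.
  rewrite -intrD Bs; have -> : ((coefa a h)%:Z = (coefa a h).-1%:Z + 1)%R by lia.
  by rewrite intrD addrK.
have cE : c = bm - d%:Z.
  apply: ceil_def; rewrite numE NR !intrB -!pmulrn; lra.
have bmd : d%:Z <= bm + bp - 1 by rewrite Bs; lia.
have le_bc : beta <= c%:~R.
  have : (1 - bp)%:~R <= c%:~R :> R by rewrite ler_int cE; lia.
  apply: le_trans; rewrite intrB; move: Bp1; lra.
have le_cg : c%:~R <= gamma.
  have : c%:~R <= (bm - 1)%:~R :> R by rewrite ler_int cE; lia.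
  move=> h3; apply: le_trans h3 _; rewrite intrB; move: Bm1; lra.
have lP (x1 y1 : int) : x1 <= 0 -> 0 <= beta * x1%:~R + y1%:~R ->
    0 <= gamma * x1%:~R + y1%:~R ->
    dual_cone (sigma' 1 (dec_bar d beta gamma)) (lneg 1 c true%:Z x1 y1).
  move=> x1le _ hg; rewrite /lneg mul1r mulr1n; apply/P3E; rewrite -/c.
  have x1r : x1%:~R <= 0 :> R by rewrite lerz0.
  have yE : (y1 - (c * x1 + y1))%:~R = - (c%:~R * x1%:~R) :> R.
    by rewrite opprD addrCA subrr addr0 intrN intrM.
  have cg : 0 <= c%:~R * x1%:~R + y1%:~R :> R.
    by apply: le_trans hg _; rewrite lerD2r ler_wnM2r.
  split.
  - by rewrite yE -mulrBl mulr_le0 // subr_le0.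
  - by rewrite yE subrr.
  - by rewrite -(ler0z R) intrD intrM.
  - by rewrite divr1 intrD intrM addrA -mulrDl subrK.
have sumE : c%:~R + (gamma - c%:~R) = gamma by rewrite addrC subrK.
have ge0 : 0 <= gamma - c%:~R by rewrite subr_ge0.
have tidx : t_index a h by [].
have hD : (1 * d.-1 < coefa a h)%N by rewrite mul1n; lia.
have hx0 : true%:Z * bm - c = d.-1%:Z + true%:Z by rewrite cE; lia.
have [f [F [pb fs ft]]] := toric_arndt_pullback hn hnq hq ha hw hY hX cc le_bg hh' hpsi
  (p := 1) (D := d.-1) (bar := true) isT le_bc ge0 sumE hZ lP
  (fun _ => erefl) (fun _ => tidx) hD hx0.
exists f, F; split=> // [|j m hj hne|j hj jh].
- split; first by rewrite ft // /t_value eqxx.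
  move=> l hl; have hs : s_index a h l by rewrite /s_index hh' /=; lia.
  by split=> //; rewrite fs // /s_value eqxx dvd1n divn1.
- rewrite fs // /s_value dvd1n andbT divn1; case: eqP => // jh.
  rewrite bin_small ?scale0r // ltnNge; apply/negP => ld; apply: hne.
  by split=> //; rewrite ld andbT; case/andP: hj => _ /andP[].
- by rewrite ft // /t_value; case: eqP.
Qed.
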